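(* Let $\omega_1,\omega_2,\dots,\omega_L\in L^\infty(\mathbb{T})$ be bounded functions on the unit circle such that the Hankel operators $H(\omega_1),\dots,H(\omega_L)$ are compact and $$\operatorname{sing\,supp}\omega_\ell\cap\operatorname{sing\,supp}\omega_j=\varnothing,\qquad \ell\neq j.$$ Set $\omega=\omega_1+\dots+\omega_L$. Then for all $p>0$, $$\limsup_{n\to\infty} n\, s_n(H(\omega))^p\le\sum_{\ell=1}^L\limsup_{n\to\infty} n\, s_n(H(\omega_\ell))^p,$$ $$\liminf_{n\to\infty} n\, s_n(H(\omega))^p\ge\sum_{\ell=1}^L\liminf_{n\to\infty} n\, s_n(H(\omega_\ell))^p.$$ In particular, $$\lim_{n\to\infty} n\, s_n(H(\omega))^p=\sum_{\ell=1}^L\lim_{n\to\infty} n\, s_n(H(\omega_\ell))^p$$ provided that all limits in the right-hand side exist.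
   Context: $\mathbb{T}$ is the unit circle in $\mathbb{C}$ with normalized Lebesgue measure $dm$. $H^2(\mathbb{T})\subset L^2(\mathbb{T})$ is the closed subspace spanned by $1,\mu,\mu^2,\dots$; $P_+:L^2(\mathbb{T})\to H^2(\mathbb{T})$ is the orthogonal projection; $W$ is the involution $(Wf)(\mu)=f(\bar\mu)$ in $L^2(\mathbb{T})$. For $\omega\in L^\infty(\mathbb{T})$ the Hankel operator $H(\omega)$ in $H^2(\mathbb{T})$ is $H(\omega)f=P_+(\omega\, Wf)$. The singular values of a compact operator $A$ are $s_n(A)=\lambda_n(|A|)$, $n\ge1$, where $\lambda_n(|A|)$ is the non-increasing sequence of eigenvalues of $|A|=\sqrt{A^*A}$, counted with multiplicity. The singular support $\operatorname{sing\,supp}\omega$ is the smallest closed set $X\subset\mathbb{T}$ such that $\omega\in C^\infty(\mathbb{T}\setminus X)$ (functions being identified when equal almost everywhere). Upper and lower limits take values in $[0,+\infty]$. *)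

(* Defs.v *)
From HB Require Import structures.
From mathcomp Require Import all_boot all_order all_algebra.
From mathcomp Require Import generic_quotient ring_quotient sesquilinear.
From mathcomp Require Import all_classical all_reals all_analysis.
From mathcomp Require Import complex ring.
Set Implicit Arguments.
Unset Strict Implicit.
Unset Printing Implicit Defensive.
Import Order.TTheory GRing.Theory Num.Theory.
Import numFieldNormedType.Exports.

Local Open Scope classical_set_scope.
Local Open Scope ring_scope.
Local Open Scope complex_scope.
Local Open Scope quotient_scope.

(* The topology on R[i]; needed to make the unit circle a topological space. *)
HB.instance Definition _ (R : realType) := NormedModule.copy R[i] R[i]^o.


Lemma conjC_conjc (R : rcfType) (z : R[i]) : Num.conj z = conjc z.
Proof.
have [->|z0] := eqVneq z 0; first by rewrite !rmorph0.
by apply: (mulfI z0); rewrite -normCK sqr_normc.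
Qed.

Section ComplexParts.
Variable R : rcfType.
Implicit Types z w : R[i].

Lemma ReD z w : complex.Re (z + w) = complex.Re z + complex.Re w.
Proof. by case: z => ? ?; case: w. Qed.

Lemma ImD z w : complex.Im (z + w) = complex.Im z + complex.Im w.
Proof. by case: z => ? ?; case: w. Qed.

Lemma ReM z w : complex.Re (z * w) =
  complex.Re z * complex.Re w - complex.Im z * complex.Im w.
Proof. by case: z => ? ?; case: w. Qed.

Lemma ImM z w : complex.Im (z * w) =
  complex.Re z * complex.Im w + complex.Im z * complex.Re w.
Proof. by case: z => ? ?; case: w. Qed.

Lemma ReJ z : complex.Re (conjc z) = complex.Re z. Proof. by case: z. Qed.

Lemma ImJ z : complex.Im (conjc z) = - complex.Im z. Proof. by case: z. Qed.

Lemma eqC z w :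
  complex.Re z = complex.Re w -> complex.Im z = complex.Im w -> z = w.
Proof. by case: z => a b; case: w => c d /= -> ->. Qed.

End ComplexParts.

Section ComplexLfun.
Context d (T : measurableType d) (R : realType).
Variable mu : {measure set T -> \bar R}.

(* Complex-valued functions whose p-th power is integrable (essentially bounded
   functions if p = +oo). The library's Lfun is for real-valued functions only;
   |f| has finite L^p norm iff both |Re f| and |Im f| do. *)
Definition CLfun (p : \bar R) : {pred T -> R[i]} :=
  [pred f : T -> R[i] | (@complex.Re R \o f \in Lfun mu p)
                     && (@complex.Im R \o f \in Lfun mu p)].

Lemma CLfun_submod_closed (p : \bar R) (p1 : (1 <= p)%E) :
  submod_closed (CLfun p).
Proof.
have [L0 LD] := @Lfun_submod_closed _ T R mu p p1.
split; first by apply/andP; split; exact: L0.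
move=> a f g /andP[fr fi] /andP[gr gi]; apply/andP; split.
- rewrite (_ : _ \o _ = complex.Re a *: (@complex.Re R \o f) +
    ((- complex.Im a) *: (@complex.Im R \o f) + (@complex.Re R \o g))).
    by apply: (LD) => //; apply: LD.
  by apply/funext => x /=; rewrite ReD ReM -addrA -mulNr.
- rewrite (_ : _ \o _ = complex.Re a *: (@complex.Im R \o f) +
    (complex.Im a *: (@complex.Re R \o f) + (@complex.Im R \o g))).
    by apply: (LD) => //; apply: LD.
  by apply/funext => x /=; rewrite ImD ImM -addrA.
Qed.

HB.instance Definition _ := GRing.isSubmodClosed.Build _ _ (CLfun 2%:E)
  (CLfun_submod_closed (lee1n 2)).

Lemma CLfun2_mulJ (f g : T -> R[i]) : f \in CLfun 2%:E -> g \in CLfun 2%:E ->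
  (fun x => f x * conjc (g x)) \in CLfun 1.
Proof.
move=> /andP[fr fi] /andP[gr gi].
have [_ LD] := @Lfun_submod_closed _ T R mu 1%E (lexx _).
apply/andP; split.
- rewrite (_ : _ \o _ =
    1 *: ((@complex.Re R \o f) \* (@complex.Re R \o g)) +
    ((@complex.Im R \o f) \* (@complex.Im R \o g))).
    by apply: LD; exact: Lfun2_mul_Lfun1.
  by apply/funext => x /=; rewrite ReM ReJ ImJ mulrN opprK scale1r.
- rewrite (_ : _ \o _ =
    (- 1) *: ((@complex.Re R \o f) \* (@complex.Im R \o g)) +
    ((@complex.Im R \o f) \* (@complex.Re R \o g))).
    by apply: LD; exact: Lfun2_mul_Lfun1.
  by apply/funext => x /=; rewrite ImM ReJ ImJ mulrN scaleN1r.
Qed.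

Definition Cintegral (f : T -> R[i]) : R[i] :=
  (\int[mu]_x complex.Re (f x)) +i* (\int[mu]_x complex.Im (f x)).

Lemma CintegralZD (a : R[i]) (f g : T -> R[i]) :
  f \in CLfun 1 -> g \in CLfun 1 ->
  Cintegral (fun x => a * f x + g x) = a * Cintegral f + Cintegral g.
Proof.
move=> /andP[/Lfun1_integrable fr /Lfun1_integrable fi].
move=> /andP[/Lfun1_integrable gr /Lfun1_integrable gi].
have iZ (r : R) (h : T -> R) : mu.-integrable setT (EFin \o h) ->
    mu.-integrable setT (EFin \o (fun x => r * h x)).
  move=> ih; rewrite (_ : _ \o _ = (fun x => r%:E * (h x)%:E)%E)//.
  exact: integrableZl.
have iD (h k : T -> R) : mu.-integrable setT (EFin \o h) ->
    mu.-integrable setT (EFin \o k) ->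
    mu.-integrable setT (EFin \o (fun x => h x + k x)).
  move=> ih ik; rewrite (_ : _ \o _ = ((EFin \o h) \+ (EFin \o k))%E)//.
  exact: integrableD.
apply: eqC; rewrite ?ReD ?ImD ?ReM ?ImM /=.
- transitivity (\int[mu]_x (complex.Re a * complex.Re (f x) +
     (- complex.Im a * complex.Im (f x) + complex.Re (g x)))).
    by apply: eq_Rintegral => x _; rewrite ReD ReM mulNr addrA.
  rewrite RintegralD//; [|exact: iZ|by apply: iD => //; exact: iZ].
  rewrite RintegralD//; last exact: iZ.
  by rewrite !RintegralZl// mulNr addrA.
- transitivity (\int[mu]_x (complex.Re a * complex.Im (f x) +
     (complex.Im a * complex.Re (f x) + complex.Im (g x)))).
    by apply: eq_Rintegral => x _; rewrite ImD ImM addrA.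
  rewrite RintegralD//; [|exact: iZ|by apply: iD => //; exact: iZ].
  rewrite RintegralD//; last exact: iZ.
  by rewrite !RintegralZl// addrA.
Qed.

Lemma ae_eq_Cintegral (f g : T -> R[i]) : f \in CLfun 1 -> g \in CLfun 1 ->
  {ae mu, forall x, f x = g x} -> Cintegral f = Cintegral g.
Proof.
move=> /andP[/Lfun1_integrable/measurable_int fr].
move=> /Lfun1_integrable/measurable_int fi.
move=> /andP[/Lfun1_integrable/measurable_int gr].
move=> /Lfun1_integrable/measurable_int gi fg.
by apply: eqC => /=; congr fine; apply: ae_eq_integral => //;
  apply: filterS fg => x -> _.
Qed.

Record L2fun := MkL2fun
  { L2fun_val :> T -> R[i] ; _ : L2fun_val \in CLfun 2%:E }.

HB.instance Definition _ := [isSub for L2fun_val].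
HB.instance Definition _ := [Choice of L2fun by <:].
HB.instance Definition _ := [SubChoice_isSubLmodule of L2fun by <:].

Lemma L2fun_subE (f g : L2fun) x : (f - g) x = f x - g x.
Proof. by rewrite -[L2fun_val (f - g)]/(\val (f - g)) raddfB. Qed.

Definition L2null : {pred L2fun} :=
  fun f => `[< {ae mu, forall x, f x = 0} >].

Lemma L2null_zmod_closed : zmod_closed L2null.
Proof.
split; first by apply/asboolP; exact: aeW.
move=> f g /asboolP f0 /asboolP g0; apply/asboolP.
by apply: filterS2 f0 g0 => x fx gx; rewrite L2fun_subE fx gx subr0.
Qed.

HB.instance Definition _ := GRing.isZmodClosed.Build _ L2null
  L2null_zmod_closed.

(* L^2(mu; C): functions are identified when they are equal almost everywhere.
   The coercion L2_fun picks an arbitrary representative of the class. *)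
Definition L2 : Type := Quotient.quot L2null.
HB.instance Definition _ := GRing.Zmodule.on L2.
HB.instance Definition _ := EqQuotient.on L2.
Definition L2_fun (u : L2) : T -> R[i] := repr u.
Coercion L2_fun : L2 >-> Funclass.

Lemma L2_eqP (f g : L2fun) :
  reflect {ae mu, forall x, f x = g x} (\pi_L2 f == \pi_L2 g).
Proof.
rewrite -Quotient.idealrBE.
rewrite -[_ \in _]/(`[< {ae mu, forall x, (f - g) x = 0} >]).
apply: (iffP (asboolP _)); apply: filterS => x.
  by rewrite L2fun_subE => /eqP; rewrite subr_eq0 => /eqP.
by rewrite L2fun_subE => ->; rewrite subrr.
Qed.

Lemma L2_piE (f : L2fun) : {ae mu, forall x, (\pi_L2 f : L2) x = f x}.
Proof. by apply/L2_eqP; rewrite reprK. Qed.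

Lemma L2_funP (u : L2) : (u : T -> R[i]) \in CLfun 2%:E.
Proof. exact: valP. Qed.

Lemma L2_eq (u v : L2) : {ae mu, forall x, u x = v x} -> u = v.
Proof. by move=> uv; rewrite -[u]reprK -[v]reprK; apply/eqP/L2_eqP. Qed.

Lemma L2_addE (u v : L2) : {ae mu, forall x, (u + v : L2) x = u x + v x}.
Proof.
apply: filterS (L2_piE (repr u + repr v)) => x.
by rewrite raddfD /= !reprK.
Qed.

Definition L2_scale (a : R[i]) (u : L2) : L2 := \pi_L2 (a *: repr u).

Lemma L2_scaleE a (u : L2) : {ae mu, forall x, L2_scale a u x = a * u x}.
Proof. exact: L2_piE. Qed.

Lemma L2_scalerA a b (u : L2) : L2_scale a (L2_scale b u) = L2_scale (a * b) u.
Proof.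
apply: L2_eq; apply: filterS3 (L2_scaleE a (L2_scale b u)) (L2_scaleE b u)
  (L2_scaleE (a * b) u) => x -> -> ->.
by rewrite mulrA.
Qed.

Lemma L2_scale1r : left_id 1 L2_scale.
Proof. by move=> u; rewrite /L2_scale scale1r reprK. Qed.

Lemma L2_scalerDr : right_distributive L2_scale +%R.
Proof.
move=> a u v; apply: L2_eq.
apply: filterS2 (filterI (L2_scaleE a (u + v)) (L2_addE u v))
  (filterI (L2_addE (L2_scale a u) (L2_scale a v))
    (filterI (L2_scaleE a u) (L2_scaleE a v))) => x [-> ->] [-> [-> ->]].
exact: mulrDr.
Qed.

Lemma L2_scalerDl (u : L2) : {morph L2_scale^~ u : a b / a + b}.
Proof.
move=> a b; apply: L2_eq.
apply: filterS2 (L2_scaleE (a + b) u)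
  (filterI (L2_addE (L2_scale a u) (L2_scale b u))
    (filterI (L2_scaleE a u) (L2_scaleE b u))) => x -> [-> [-> ->]].
exact: mulrDl.
Qed.

HB.instance Definition _ := GRing.Zmodule_isLmodule.Build R[i] L2
  L2_scalerA L2_scale1r L2_scalerDr L2_scalerDl.

Lemma L2_zero : {ae mu, forall x, (0 : L2) x = 0}.
Proof.
have -> : (0 : L2) = \pi_L2 (0 : L2fun) by rewrite raddf0.
exact: L2_piE.
Qed.

(* Linear in the first argument. *)
Definition L2_dot (u v : L2) : R[i] := Cintegral (fun x => u x * conjc (v x)).

Lemma L2_dot_linearl (w : L2) a u v :
  L2_dot (a *: u + v) w = a * L2_dot u w + L2_dot v w.
Proof.
have J1 (f g : L2) : (fun x => f x * conjc (g x)) \in CLfun 1.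
  by apply: CLfun2_mulJ; exact: L2_funP.
rewrite -CintegralZD//; apply: ae_eq_Cintegral => //.
  have [_ LD] := @CLfun_submod_closed 1%E (lexx _).
  by have := LD a _ _ (J1 u w) (J1 v w).
apply: filterS2 (L2_addE (a *: u) v) (L2_scaleE a u) => x -> ->.
by rewrite mulrDl mulrA.
Qed.

Lemma L2_dotC (u v : L2) : L2_dot u v = Num.conj (L2_dot v u).
Proof.
rewrite conjC_conjc; apply: eqC => /=.
  by apply: eq_Rintegral => x _; rewrite !ReM ReJ ImJ ReJ ImJ mulrC !mulrN
    [complex.Im _ * _]mulrC.
have /andP[_ /Lfun1_integrable ii] : (fun x => v x * conjc (u x)) \in CLfun 1.
  by apply: CLfun2_mulJ; exact: L2_funP.
rewrite -[RHS]mulN1r -RintegralZl//.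
apply: eq_Rintegral => x _; rewrite !ImM ReJ ImJ ReJ ImJ mulN1r !mulrN.
by rewrite opprD opprK addrC [complex.Re (v x) * _]mulrC
  [complex.Im (v x) * _]mulrC.
Qed.

Lemma L2_dot_bilinear :
  bilinear_for (GRing.Scale.Law.clone _ _ ( *%R ) _)
    (GRing.Scale.Law.clone _ _ (@Num.conj R[i] \; *%R) _) L2_dot.
Proof.
split=> [w a u v|w a u v] /=; first exact: L2_dot_linearl.
rewrite L2_dotC L2_dot_linearl rmorphD rmorphM /=.
by rewrite [L2_dot w u]L2_dotC [L2_dot w v]L2_dotC.
Qed.

HB.instance Definition _ := bilinear_isBilinear.Build _ _ _ _ _ _ L2_dot
  L2_dot_bilinear.

HB.instance Definition _ := isHermitianSesquilinear.Build _ _ false Num.conj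
  L2_dot (fun u v => etrans (L2_dotC u v) (esym (mul1r _))).

Lemma L2_dot_gt0 (u : L2) : u != 0 -> 0 < L2_dot u u.
Proof.
have /andP[ir /Lfun1_integrable _] : (fun x => u x * conjc (u x)) \in CLfun 1.
  by apply: CLfun2_mulJ; exact: L2_funP.
have /Lfun1_integrable ir' := ir.
have ge0 x : 0 <= complex.Re (u x * conjc (u x)).
  by rewrite ReM ReJ ImJ mulrN opprK addr_ge0// -expr2 sqr_ge0.
have -> : L2_dot u u = (\int[mu]_x complex.Re (u x * conjc (u x)))%:C.
  apply: eqC => //=; transitivity (\int[mu]_x (0 : R)).
    by apply: eq_Rintegral => x _; rewrite ImM ReJ ImJ mulrN mulrC addNr.
  by rewrite Rintegral_cst// mul0r.
rewrite lt_def lecR Rintegral_ge0// andbT; apply: contra => /eqP[I0].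
apply/eqP/L2_eq.
have : (\int[mu]_x `|(complex.Re (u x * conjc (u x)))%:E| = 0)%E.
  under eq_integral do rewrite gee0_abs ?lee_fin//.
  by rewrite -[LHS]fineK ?integrable_fin_num// [fine _]I0.
move/ae_eq_integral_abs => /(_ measurableT (measurable_int _ ir')).
move=> H; apply: filterS2 H L2_zero => x /(_ I)[+ ->].
rewrite ReM ReJ ImJ mulrN opprK => /eqP.
rewrite paddr_eq0 -?expr2 ?sqr_ge0// !sqrf_eq0 => /andP[/eqP r0 /eqP i0].
exact: eqC.
Qed.

HB.instance Definition _ := isDotProduct.Build _ _ L2_dot L2_dot_gt0.

End ComplexLfun.

Section DotNorm.
Context (C : numClosedFieldType) (U : lmodType C) (dot : {dot U for @Num.conj C}).

Lemma dot_CauchySchwarz (u v : U) :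
  `|dot u v| ^+ 2 <= dot u u * dot v v.
Proof.
have [->|v0] := eqVneq v 0; first by rewrite !linear0r normr0 expr0n.
have vv : 0 < dot v v by rewrite dnorm_gt0.
have := dnorm_ge0 dot (dot v v *: u - dot u v *: v).
rewrite dnormB !dnormZ !linearZl_LR !linearZr_LR /=.
set a := dot u u; set b := dot v v; set c := dot u v.
have -> : Num.conj c *: (b * c) = b * `|c| ^+ 2.
  by rewrite normCK /GRing.scale /=; ring.
have bc0 : 0 <= b * `|c| ^+ 2 by rewrite mulr_ge0 ?exprn_ge0// dnorm_ge0.
rewrite (geC0_conj bc0) (ger0_norm (ltW vv)) /GRing.scale /=.
have -> : b * (b * a) + `|c| * (`|c| * b) - (b * `|c| ^+ 2 + b * `|c| ^+ 2) =
    b * (a * b - `|c| ^+ 2) by ring.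
by rewrite pmulr_rge0// subr_ge0.
Qed.

Lemma dot_triangle (u v : U) :
  sqrtC (dot (u + v) (u + v)) <= sqrtC (dot u u) + sqrtC (dot v v).
Proof.
rewrite -ler_sqr ?nnegrE ?addr_ge0 ?sqrtC_ge0 ?dnorm_ge0//.
rewrite sqrrD !sqrtCK dnormD [leRHS]addrAC lerD2l.
have cs : `|dot u v| <= sqrtC (dot u u) * sqrtC (dot v v).
  rewrite -ler_sqr ?nnegrE ?mulr_ge0 ?sqrtC_ge0 ?dnorm_ge0//.
  by rewrite exprMn !sqrtCK dot_CauchySchwarz.
have -> : dot u v + Num.conj (dot u v) = 'Re (dot u v) *+ 2.
  by rewrite ReE -mulr_natr divfK// pnatr_eq0.
by rewrite lerMn2r/= (le_trans _ cs)// leif_Re_Creal.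
Qed.

Lemma dot_normZ (a : C) (u : U) :
  sqrtC (dot (a *: u) (a *: u)) = `|a| * sqrtC (dot u u).
Proof. by rewrite dnormZ rootCMl ?exprn_ge0// sqrCK. Qed.

Lemma dot_norm0 (u : U) : sqrtC (dot u u) = 0 -> u = 0.
Proof. by move/eqP; rewrite sqrtC_eq0 dnorm_eq0 => /eqP. Qed.

End DotNorm.

Section L2Normed.
Context d (T : measurableType d) (R : realType).
Variable mu : {measure set T -> \bar R}.

HB.instance Definition _ := Lmodule_isNormed.Build R[i] (L2 mu)
  (dot_triangle (@L2_dot _ _ _ mu)) (dot_normZ (@L2_dot _ _ _ mu))
  (@dot_norm0 _ _ (@L2_dot _ _ _ mu)).

(* The class of f, with junk value 0 if f is not square integrable. *)
Definition toL2 (f : T -> R[i]) : L2 mu := \pi_(L2 mu) (insubd 0 f).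

End L2Normed.

Section Operators.
Context (R : realType) (U : normedModType R[i]) (dot : {dot U for @Num.conj R[i]}).
Implicit Types (A B : U -> U) (E : set U) (s : nat -> R).

Definition compact_operator A :=
  compact (closure (A @` [set u | `|u| <= 1])).

(* Here and below xget selects the element characterized by the predicate. It
   defaults to its first argument when there is none, which does not happen
   for compact linear operators in a Hilbert space. *)
Definition adjoint A : U -> U :=
  xget (cst 0) [set B | forall u v, dot (A u) v = dot u (B v)].

(* |A|, i.e. the positive square root of A^* A *)
Definition operator_abs A : U -> U :=
  xget (cst 0) [set B | [/\ linear B, continuous B,
    forall u, 0 <= dot (B u) u & B \o B = adjoint A \o A]].

Definition op_eigenspace B (lambda : R) : set U :=
  [set u | B u = lambda%:C *: u].

Definition has_dim E (k : nat) := exists e : 'I_k -> U,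
  (forall c : 'I_k -> R[i], \sum_(i < k) c i *: e i = 0 -> forall i, c i = 0) /\
  E = [set u | exists c : 'I_k -> R[i], u = \sum_(i < k) c i *: e i].

(* s lists the positive eigenvalues of B in non-increasing order, each repeated
   according to its multiplicity. If B has only finitely many positive
   eigenvalues, then s is eventually 0. *)
Definition eigenvalue_sequence B s :=
  [/\ forall n, 0 <= s n, nonincreasing_seq s &
      forall lambda, 0 < lambda -> exists k : nat,
        has_dim (op_eigenspace B lambda) k /\ ([set n | s n = lambda] #= `I_k)%card].

(* s_n(A) for n >= 1; the value at n = 0 is meaningless. *)
Definition singular_value A (n : nat) : R :=
  xget (cst 0) (eigenvalue_sequence (operator_abs A)) n.-1.

End Operators.

Section Circle.
Context (R : realType).

Definition circle : Type := [set z : R[i] | `|z| = 1].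
HB.instance Definition _ := Topological.on circle.

Definition mkcircle (z : R[i]) (z1 : `|z| = 1) : circle :=
  exist _ z (mem_set z1).

HB.instance Definition _ := isPointed.Build circle (mkcircle (normr1 R[i])).

Definition circle_val (z : circle) : R[i] := set_val z.

Lemma circle_valP z : `|circle_val z| = 1. Proof. exact: (set_mem (valP z)). Qed.

Definition circle_conj (z : circle) : circle :=
  mkcircle (etrans (norm_conjC (circle_val z)) (circle_valP z)).

Lemma norm_cis (t : R) : `|cos t +i* sin t| = 1.
Proof. by rewrite normc_def /= cos2Dsin2 sqrtr1. Qed.

Definition cis (t : R) : circle := mkcircle (norm_cis t).

(* Borel sigma-algebra *)
HB.instance Definition _ := Measurable.copy circle
  (g_sigma_algebraType (@open circle)).

Lemma real_complex_continuous : continuous (real_complex R : R -> R[i]).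
Proof.
move=> t; apply/cvgrPdist_lt => -[e e'].
rewrite ltcE /= => /andP[/eqP -> e0]; near=> s.
rewrite -rmorphB normc_def /= expr0n addr0 sqrtr_sqr ltcR.
by near: s; exact: cvgr_dist_lt.
Unshelve. all: by end_near. Qed.

Lemma cis_continuous : continuous cis.
Proof.
apply: continuous_comp_initial => t.
rewrite (_ : _ \o _ = fun t : R => (cos t)%:C + 'i%C * (sin t)%:C).
  apply: cvgD; last apply: cvgMr.
    apply: continuous_comp; first exact: continuous_cos.
    exact: real_complex_continuous.
  apply: continuous_comp; first exact: continuous_sin.
  exact: real_complex_continuous.
by apply/funext => s; rewrite -[LHS]/(cos s +i* sin s) [LHS]complexE.
Qed.

Lemma measurable_cis : measurable_fun [set: measurableTypeR R] cis.
Proof.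
apply: (@measurability _ _ _ _ _ cis (@open circle)) => //.
move=> _ [B oB <-]; rewrite setTI; apply: measurable_realfun.open_measurable.
by move/continuousP : cis_continuous => /(_ B oB).
Qed.

HB.instance Definition _ := isMeasurableFun.Build _ _ _ _
  (cis : measurableTypeR R -> circle) measurable_cis.

Lemma twopi_gt0 : 0 < 2 * pi :> R.
Proof. by rewrite mulr_gt0// pi_gt0. Qed.

(* Normalized arc length: the law of e^{it} for t uniform in [0, 2 pi]. *)
Definition circle_measure : probability circle R :=
  distribution (uniform_prob twopi_gt0) cis.


Local Notation m := circle_measure.

Definition Linfty : set (circle -> R[i]) := [set` CLfun m +oo%E].

Definition monomial (k : nat) : L2 m := toL2 m (fun z => circle_val z ^+ k).

Definition hardy : {pred L2 m} := mem (closure [set u : L2 m |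
  exists n (c : 'I_n -> R[i]), u = \sum_(k < n) c k *: monomial k]).

Lemma hardy_submod_closed : submod_closed hardy.
Proof.
have padE n (c : 'I_n -> R[i]) k : exists c' : 'I_(n + k) -> R[i],
    \sum_(i < n) c i *: monomial i = \sum_(i < n + k) c' i *: monomial i.
  exists (fun i => if fintype.split i is inl j then c j else 0).
  rewrite big_split_ord/= [X in _ + X]big1 ?addr0 => [|i _].
    by apply: eq_bigr => i _; rewrite -[lshift k i]/(unsplit (inl i)) unsplitK.
  by rewrite -[rshift n i]/(unsplit (inr i)) unsplitK scale0r.
split.
  apply/mem_set/subset_closure; exists 0%N, (fun=> 0).
  by rewrite big_ord0.
move=> a u v /set_mem uE /set_mem vE; apply/mem_set => B nB.
have : (fun p : L2 m * L2 m => a *: p.1 + p.2) @ (u, v) --> a *: u + v.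
  apply: cvgD; last exact: cvg_snd.
  by apply: cvgZr; exact: cvg_fst.
move=> /(_ B nB)[[V W] /= [nV nW] VW].
have [u' [[n [c ->]] Vu]] := uE _ nV.
have [v' [[k [e ->]] Wv]] := vE _ nW.
exists (a *: (\sum_(i < n) c i *: monomial i) + \sum_(i < k) e i *: monomial i).
split; last by apply: (VW (_, _)).
have [c' ->] := padE n c k.
have [e' ->] := padE k e n; rewrite addnC in c' *.
exists (k + n)%N, (fun i => a * c' i + e' i).
rewrite scaler_sumr -big_split/=; apply: eq_bigr => i _.
by rewrite scalerDl scalerA.
Qed.

HB.instance Definition _ := GRing.isSubmodClosed.Build _ _ hardy
  hardy_submod_closed.

Record H2 := MkH2 { H2_val :> L2 m ; _ : H2_val \in hardy }.

HB.instance Definition _ := [isSub for H2_val].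
HB.instance Definition _ := [Choice of H2 by <:].
HB.instance Definition _ := [SubChoice_isSubLmodule of H2 by <:].

Definition H2_dot (u v : H2) : R[i] := L2_dot (\val u) (\val v).

Lemma H2_dot_bilinear :
  bilinear_for (GRing.Scale.Law.clone _ _ ( *%R ) _)
    (GRing.Scale.Law.clone _ _ (@Num.conj R[i] \; *%R) _) H2_dot.
Proof.
split=> [w a u v|w a u v] /=; rewrite /H2_dot linearP.
  by rewrite linearDl linearZl_LR.
by rewrite linearDr linearZr_LR.
Qed.

HB.instance Definition _ := bilinear_isBilinear.Build _ _ _ _ _ _ H2_dot
  H2_dot_bilinear.

HB.instance Definition _ := isHermitianSesquilinear.Build _ _ false Num.conj
  H2_dot (fun u v => hermitian_subproof (\val u) (\val v)).

Lemma H2_dot_gt0 (u : H2) : u != 0 -> 0 < H2_dot u u.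
Proof.
move=> u0; apply: L2_dot_gt0; apply: contra u0 => /eqP u0.
by apply/eqP/val_inj; rewrite u0 raddf0.
Qed.

HB.instance Definition _ := isDotProduct.Build _ _ H2_dot H2_dot_gt0.

HB.instance Definition _ := Lmodule_isNormed.Build R[i] H2
  (dot_triangle H2_dot) (dot_normZ H2_dot) (@dot_norm0 _ _ H2_dot).

(* The orthogonal projection P_+ onto H2 *)
Definition riesz_proj (f : L2 m) : H2 :=
  xget 0 [set g : H2 | forall h : H2, L2_dot (f - \val g) (\val h) = 0].

(* (W f)(z) = f(conj z) *)
Definition reflection (f : L2 m) : L2 m := toL2 m (fun z => f (circle_conj z)).

Definition multiplication (omega : circle -> R[i]) (f : L2 m) : L2 m :=
  toL2 m (fun z => omega z * f z).

(* H(omega) f = P_+ (omega W f) *)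
Definition hankel (omega : circle -> R[i]) (f : H2) : H2 :=
  riesz_proj (multiplication omega (reflection f)).

(* s_n(H(omega)), n >= 1 *)
Definition hankel_sv (omega : circle -> R[i]) (n : nat) : R :=
  singular_value H2_dot (hankel omega) n.

(* Derivatives are taken with respect to the angle; derive1n is total, but for
   open A the derivatives at points of A only depend on f on A. *)
Definition Cinfty_on (A : set circle) (f : circle -> R[i]) :=
  forall t, A (cis t) -> forall n,
    derivable (derive1n n (fun s => complex.Re (f (cis s)))) t 1 /\
    derivable (derive1n n (fun s => complex.Im (f (cis s)))) t 1.

(* omega is C^oo on the complement of X, after modification on a null set *)
Definition ae_Cinfty_off (X : set circle) (omega : circle -> R[i]) :=
  exists2 g, Cinfty_on (~` X) g & {ae m, forall z, ~ X z -> omega z = g z}.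

Definition sing_supp (omega : circle -> R[i]) : set circle :=
  smallest (fun X => closed X /\ ae_Cinfty_off X omega) set0.

End Circle.

(* Main.v *)
(* Write A_l = H(omega_l). Once A_l^* A_j and A_l A_j^* (l <> j) have
   singular values O(n^-q) with q p > 4, the counting functions of the singular values add up,
   counting(s; A_1 + A_2) ~ counting(s; A_1) + counting(s; A_2) up to o(s^-p) and a factor
   1 + o(1) on s, because the two operators are almost orthogonal; this is a min-max argument on
   subspaces of finite codimension, and it yields both inequalities.
   For the smallness, the disjoint singular supports give a smooth real chi on the circle for
   which chi omega_j and (1 - chi) omega_l are smooth up to null sets. Smooth functions are
   approximated to order M^-q by trigonometric polynomials of degree M, so Hankel operators with
   smooth symbols, and commutators of P_+ with smooth functions, coincide up to O(M^-q) with
   operators vanishing on a subspace of codimension O(M). Inserting chi between the two factors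
   of A_l^* A_j or A_l A_j^* leaves only such terms. *)
Require Import Defs.
From HB Require Import structures.
From mathcomp Require Import all_boot all_order all_algebra.
From mathcomp Require Import sesquilinear.
From mathcomp Require Import all_classical all_reals all_analysis.
From mathcomp Require Import measurable_realfun.
From mathcomp Require Import complex finmap ring lra zify.
Set Implicit Arguments.
Unset Strict Implicit.
Unset Printing Implicit Defensive.
Import Order.TTheory GRing.Theory Num.Theory.
Import numFieldNormedType.Exports.

Local Open Scope classical_set_scope.
Local Open Scope ring_scope.
Local Open Scope complex_scope.

(** * Hermitian spaces *)

(** The exponent 4 in q p > 4 comes from the upper bound. At level s, the product A_l A_j^* A_j must
    be at most z s^4, z small, outside codimension o(s^-p). Singular values O(n^-q) achieve this in
    codimension of order s^(-4/q), and 4/q < p. Since the symbols are C^oo off their singular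
    supports, every q is available; q is fixed once p is given, and smoothness of order q + 2
    becomes the working notion. No rate of decay of the singular values is assumed and the limits
    may be infinite, so all operator estimates are made level by level in s, and limits are taken
    only at the end. Adjoint, absolute value and eigenvalue sequence are defined by selection, so
    existence and uniqueness must be established before a singular value can be used. Both rest on
    eigenvectors of A^*A found by successive maximization. The min-max principle then replaces
    singular values by the predicate [cod], which behaves well under sums and compositions. *)

Section RealNorm.
Context {R : realType}.
Implicit Types (z w : R[i]).

(* The modulus, as an element of R; `|z| has type R[i]. *)
Definition cm z : R := complex.Re `|z|.

Lemma normcm z : `|z| = (cm z)%:C.
Proof. by rewrite /cm RRe_real// realE normr_ge0. Qed.

Lemma cm_ge0 z : 0 <= cm z.
Proof. by rewrite -lecR -normcm normr_ge0. Qed.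

Lemma cmM z w : cm (z * w) = cm z * cm w.
Proof. by apply: complexI; rewrite rmorphM /= -!normcm normrM. Qed.

Lemma cmD z w : cm (z + w) <= cm z + cm w.
Proof. by rewrite -lecR rmorphD /= -!normcm ler_normD. Qed.

Lemma cmN z : cm (- z) = cm z. Proof. by rewrite /cm normrN. Qed.

Lemma cm0 : cm 0 = 0. Proof. by rewrite /cm normr0. Qed.

Lemma cm1 : cm 1 = 1. Proof. by rewrite /cm normr1. Qed.

Lemma cm_eq0 z : cm z = 0 -> z = 0.
Proof. by move=> z0; apply/eqP; rewrite -normr_eq0 normcm z0. Qed.

Lemma cmE z : cm z = Num.sqrt (complex.Re z ^+ 2 + complex.Im z ^+ 2).
Proof. by rewrite /cm normc_def. Qed.

Lemma cm_sqr z : cm z ^+ 2 = complex.Re z ^+ 2 + complex.Im z ^+ 2.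
Proof. by rewrite cmE sqr_sqrtr// addr_ge0 ?sqr_ge0. Qed.

Lemma cmJ z : cm (conjc z) = cm z.
Proof. by rewrite /cm normcJ. Qed.

Lemma cm_real (r : R) : cm r%:C = `|r|.
Proof. by rewrite cmE /= expr0n addr0 sqrtr_sqr. Qed.

Lemma mulcJ z : z * conjc z = (cm z ^+ 2)%:C.
Proof. by rewrite -sqr_normc normcm rmorphXn. Qed.

Lemma ler_Re_cm z : `|complex.Re z| <= cm z.
Proof. by rewrite -lecR -normcm normc_ge_Re. Qed.

Lemma ler_Im_cm z : `|complex.Im z| <= cm z.
Proof.
rewrite -(ler_sqr (normr_ge0 _) (cm_ge0 _)) cm_sqr real_normK ?num_real//.
by rewrite lerDr sqr_ge0.
Qed.

Lemma cmX z n : cm (z ^+ n) = cm z ^+ n.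
Proof. by elim: n => [|n IH]; rewrite ?expr0 ?cm1// !exprS cmM IH. Qed.

Context {U : normedModType R[i]}.
Implicit Types u v : U.

Definition nr u : R := complex.Re `|u|.

Lemma normnr u : `|u| = (nr u)%:C.
Proof. by rewrite /nr RRe_real// realE normr_ge0. Qed.

Lemma nr_ge0 u : 0 <= nr u.
Proof. by rewrite -lecR -normnr normr_ge0. Qed.

Lemma nrD u v : nr (u + v) <= nr u + nr v.
Proof. by rewrite -lecR rmorphD /= -!normnr ler_normD. Qed.

Lemma nrN u : nr (- u) = nr u. Proof. by rewrite /nr normrN. Qed.

Lemma nrB u v : nr (u - v) <= nr u + nr v.
Proof. by rewrite -(nrN v) nrD. Qed.

Lemma nrBC u v : nr (u - v) = nr (v - u).
Proof. by rewrite -nrN opprB. Qed.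

Lemma nr0 : nr 0 = 0. Proof. by rewrite /nr normr0. Qed.

Lemma nr_eq0 u : nr u = 0 -> u = 0.
Proof. by move=> z0; apply/eqP; rewrite -normr_eq0 normnr z0. Qed.

Lemma nrZ (a : R[i]) u : nr (a *: u) = cm a * nr u.
Proof. by apply: complexI; rewrite rmorphM /= -normnr -normcm -normnr normrZ. Qed.

Lemma nr_gt0 u : u != 0 -> 0 < nr u.
Proof. by move=> u0; rewrite lt_def nr_ge0 andbT; apply: contra u0 => /eqP/nr_eq0 ->. Qed.

Lemma nr_unitball u : (`|u| <= 1) = (nr u <= 1).
Proof. by rewrite normnr -lecR. Qed.

End RealNorm.

Section DotTheory.
Context {R : realType} {U : normedModType R[i]} (dot : {dot U for @Num.conj R[i]}).
Hypothesis normE : forall u : U, `|u| = sqrtC (dot u u).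
Implicit Types u v w : U.

Lemma dotDl u v w : dot (u + v) w = dot u w + dot v w.
Proof. exact: linearDl. Qed.
Lemma dotDr u v w : dot u (v + w) = dot u v + dot u w.
Proof. exact: linearDr. Qed.
Lemma dotNl u v : dot (- u) v = - dot u v.
Proof. exact: linearNl. Qed.
Lemma dotNr u v : dot u (- v) = - dot u v.
Proof. exact: linearNr. Qed.
Lemma dotBl u v w : dot (u - v) w = dot u w - dot v w.
Proof. by rewrite dotDl dotNl. Qed.
Lemma dotBr u v w : dot u (v - w) = dot u v - dot u w.
Proof. by rewrite dotDr dotNr. Qed.
Lemma dotZl (a : R[i]) u v : dot (a *: u) v = a * dot u v.
Proof. by rewrite linearZl_LR. Qed.
Lemma dotZr (a : R[i]) u v : dot u (a *: v) = conjc a * dot u v.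
Proof. by rewrite linearZr_LR /= conjC_conjc. Qed.
Lemma dot0l u : dot 0 u = 0. Proof. exact: linear0l. Qed.
Lemma dot0r u : dot u 0 = 0. Proof. exact: linear0r. Qed.
Lemma dotC u v : dot u v = conjc (dot v u).
Proof. by rewrite -conjC_conjc hermC expr0 mul1r. Qed.
Lemma dot_suml I (r : seq I) (F : I -> U) v :
  dot (\sum_(i <- r) F i) v = \sum_(i <- r) dot (F i) v.
Proof.
elim: r => [|i r IH]; first by rewrite !big_nil dot0l.
by rewrite !big_cons dotDl IH.
Qed.
Lemma dot_sumr I (r : seq I) (F : I -> U) v :
  dot v (\sum_(i <- r) F i) = \sum_(i <- r) dot v (F i).
Proof.
elim: r => [|i r IH]; first by rewrite !big_nil dot0r.
by rewrite !big_cons dotDr IH.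
Qed.

Lemma dotuu u : dot u u = (nr u ^+ 2)%:C.
Proof. by rewrite rmorphXn /= -normnr normE sqrtCK. Qed.

Lemma nr_sqrE u : nr u ^+ 2 = complex.Re (dot u u).
Proof. by rewrite dotuu. Qed.

Lemma dot_CS u v : cm (dot u v) <= nr u * nr v.
Proof.
rewrite -ler_sqr ?nnegrE ?mulr_ge0 ?cm_ge0 ?nr_ge0// exprMn.
have := dot_CauchySchwarz dot u v.
by rewrite !dotuu normcm -rmorphXn -rmorphM lecR.
Qed.

Lemma dot_eq0C u v : dot u v = 0 -> dot v u = 0.
Proof. by rewrite [dot v u]dotC => ->; rewrite conjc0. Qed.

Lemma Re_dotC u v : complex.Re (dot v u) = complex.Re (dot u v).
Proof. by rewrite dotC ReJ. Qed.

Lemma nrD_sqr u v : nr (u + v) ^+ 2 = nr u ^+ 2 + nr v ^+ 2 + 2 * complex.Re (dot u v).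
Proof.
rewrite !nr_sqrE dotDl !dotDr !ReD (Re_dotC u v); ring.
Qed.

Lemma nrB_sqr u v : nr (u - v) ^+ 2 = nr u ^+ 2 + nr v ^+ 2 - 2 * complex.Re (dot u v).
Proof.
by rewrite nrD_sqr nrN dotNr; case: (dot u v) => a b /=; rewrite mulrN.
Qed.

Lemma nr_pythagoras u v : dot u v = 0 -> nr (u + v) ^+ 2 = nr u ^+ 2 + nr v ^+ 2.
Proof. by move=> uv; rewrite nrD_sqr uv /= mulr0 addr0. Qed.

Lemma nr_sum_sqr n (F : 'I_n -> U) : (forall i j, i != j -> dot (F i) (F j) = 0) ->
  nr (\sum_(i < n) F i) ^+ 2 = \sum_(i < n) nr (F i) ^+ 2.
Proof.
elim: n F => [|n IH] F H; first by rewrite !big_ord0 nr0 expr0n.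
rewrite !big_ord_recr /= nr_pythagoras ?IH//; last first.
  rewrite dot_suml big1// => i _; apply: H.
  by rewrite -val_eqE /= neq_ltn ltn_ord.
by move=> i j ij; apply: H; apply: contra ij => /eqP/(congr1 val)/= ij; apply/eqP/val_inj.
Qed.

Lemma dot_inj u v : (forall w, dot u w = dot v w) -> u = v.
Proof.
move=> H; apply/eqP; rewrite -subr_eq0 -(dnorm_eq0 dot).
by rewrite dotBl H subrr.
Qed.

Lemma dot_injr u v : (forall w, dot w u = dot w v) -> u = v.
Proof. by move=> H; apply: dot_inj => w; rewrite dotC H -dotC. Qed.

End DotTheory.

(** * Bounds on subspaces of finite codimension *)

Section LinearFunctions.
Context {K : pzRingType} {U V : lmodType K} (A : U -> V).
Hypothesis lA : linear A.

Lemma lin0 : A 0 = 0.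
Proof. by have := lA (-1) 0 0; rewrite scaler0 addr0 scaleN1r addNr. Qed.
Lemma linD u v : A (u + v) = A u + A v.
Proof. by have := lA 1 u v; rewrite !scale1r. Qed.
Lemma linZ a u : A (a *: u) = a *: A u.
Proof. by have := lA a u 0; rewrite !addr0 lin0 addr0. Qed.
Lemma linN u : A (- u) = - A u.
Proof. by rewrite -scaleN1r linZ scaleN1r. Qed.
Lemma linB u v : A (u - v) = A u - A v.
Proof. by rewrite linD linN. Qed.
Lemma lin_sum I (r : seq I) (F : I -> U) :
  A (\sum_(i <- r) F i) = \sum_(i <- r) A (F i).
Proof.
elim: r => [|i r IH]; first by rewrite !big_nil lin0.
by rewrite !big_cons linD IH.
Qed.
End LinearFunctions.

Lemma scalar_sum (K : pzRingType) (U : lmodType K) (f : U -> K) I (r : seq I)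
  (c : I -> K) (F : I -> U) : scalar f ->
  f (\sum_(i <- r) c i *: F i) = \sum_(i <- r) c i * f (F i).
Proof.
move=> lf; elim: r => [|i r IH]; last by rewrite !big_cons lf IH.
by rewrite !big_nil; have := lf (-1) 0 0; rewrite scaler0 addr0 mulN1r addNr.
Qed.

Lemma scalarD (K : pzRingType) (U : lmodType K) (f : U -> K) u v : scalar f ->
  f (u + v) = f u + f v.
Proof. by move=> lf; have := lf 1 u v; rewrite scale1r mul1r. Qed.

(** A homogeneous system with more unknowns than equations. The dimension counts below go through
    it; arbitrary finite index types allow families to be joined by sums of types. *)
Lemma exists_kernel_vector (F : fieldType) (I J : finType) (m : I -> J -> F) :
  (#|J| < #|I|)%N ->
  exists a : I -> F, (exists i, a i != 0) /\ forall j, \sum_i a i * m i j = 0.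
Proof.
move=> JI; pose M : 'M[F]_(#|I|, #|J|) := \matrix_(i, j) m (enum_val i) (enum_val j).
have : kermx M != 0.
  rewrite kermx_eq0; apply/negP => /eqP rM.
  by have := rank_leq_col M; rewrite rM leqNgt JI.
case/rowV0Pn => v /sub_kermxP vM v0.
exists (fun i => v 0 (enum_rank i)); split.
  case/rV0Pn : v0 => i vi; exists (enum_val i).
  by rewrite enum_valK.
move=> j; have /rowP/(_ (enum_rank j)) := vM; rewrite !mxE => e; apply: etrans e.
rewrite (reindex (@enum_val I I)) /=; last first.
  by exists enum_rank => x _; rewrite ?enum_valK ?enum_rankK.
by apply: eq_bigr => i _; rewrite mxE enum_valK enum_rankK.
Qed.

Section Codimension.
Context {R : realType}.
Implicit Types U V W : normedModType R[i].

(* [cod A k s]: A is bounded by s on a subspace of codimension at most k;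
   for compact A this says that the (k+1)st singular value is at most s. *)
Definition cod {U V} (A : U -> V) (k : nat) (s : R) :=
  exists (J : finType) (f : J -> U -> R[i]),
    [/\ (#|J| <= k)%N, forall j, scalar (f j) &
        forall u, (forall j, f j u = 0) -> nr (A u) <= s * nr u].

Definition opbound {U V} (A : U -> V) (b : R) := forall u, nr (A u) <= b * nr u.

Lemma cod_mono U V (A : U -> V) k l s t :
  cod A k s -> (k <= l)%N -> s <= t -> cod A l t.
Proof.
move=> [J [f [Jk lf fA]]] kl st; exists J, f; split => //.
  exact: leq_trans kl.
by move=> u fu; rewrite (le_trans (fA u fu))// ler_wpM2r ?nr_ge0.
Qed.

Lemma cod_add U V (A B : U -> V) k l s t :
  cod A k s -> cod B l t -> cod (fun u => A u + B u) (k + l) (s + t).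
Proof.
move=> [J [f [Jk lf fA]]] [J' [g [Jl lg gB]]].
exists (J + J')%type, (fun x => match x with inl j => f j | inr j => g j end).
split; first by rewrite card_sum leq_add.
  by case.
move=> u H; rewrite mulrDl (le_trans (nrD _ _))// lerD//.
  by apply: fA => j; exact: (H (inl j)).
by apply: gB => j; exact: (H (inr j)).
Qed.

Lemma cod_compl U V W (A : U -> V) (B : V -> W) b k s : 0 <= b ->
  opbound B b -> cod A k s -> cod (fun u => B (A u)) k (b * s).
Proof.
move=> b0 bB [J [f [Jk lf fA]]]; exists J, f; split => // u fu.
by rewrite (le_trans (bB _))// -mulrA ler_wpM2l// fA.
Qed.

Lemma cod_compr U V W (A : V -> W) (B : U -> V) b k s : 0 <= s -> linear B ->
  opbound B b -> cod A k s -> cod (fun u => A (B u)) k (s * b).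
Proof.
move=> s0 lB bB [J [f [Jk lf fA]]]; exists J, (fun j u => f j (B u)).
split => //; first by move=> j a u v; rewrite lB lf.
by move=> u fu; rewrite (le_trans (fA _ fu))// -mulrA ler_wpM2l.
Qed.

(** One constant c governs both the codimension and the bound, so for compact A this is s_n(A) =
    O(n^-q). The shift of M keeps the denominators positive. *)
Definition small (q : nat) {U V} (A : U -> V) :=
  exists c : nat, forall M : nat, cod A (c * M.+1) (c%:R / M.+1%:R ^+ q).

Lemma small_add q U V (A B : U -> V) : small q A -> small q B ->
  small q (fun u => A u + B u).
Proof.
move=> [c cA] [d dB]; exists (c + d)%N => M.
by rewrite mulnDl natrD mulrDl; apply: cod_add.
Qed.

Lemma small_ext q U V (A B : U -> V) : A =1 B -> small q A -> small q B.
Proof. by move=> /funext ->. Qed.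

Lemma small0 q U V : small q (fun _ : U => 0 : V).
Proof.
exists 0%N => M; exists 'I_0, (fun _ _ => 0).
split; first by rewrite card_ord.
  by move=> j a u v; rewrite mulr0 addr0.
by move=> u _; rewrite nr0 !mul0r.
Qed.

Lemma small_sum q U V I (r : seq I) (A : I -> U -> V) :
  (forall i, small q (A i)) -> small q (fun u => \sum_(i <- r) A i u).
Proof.
move=> sA; elim: r => [|i r IH].
  by apply: small_ext (@small0 q U V) => u; rewrite big_nil.
by apply: small_ext (small_add (sA i) IH) => u; rewrite big_cons.
Qed.

Lemma nat_ubound (b : R) : exists n : nat, b <= n%:R.
Proof. by exists (Num.bound b); rewrite (le_trans (ler_norm _))// ltW// truncnS_gt. Qed.

(** A real factor b and a separate codimension factor c are absorbed into a single natural
    number. *)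
Lemma small_le q U V (A : U -> V) (b : R) (c : nat) :
  (forall M : nat, cod A (c * M.+1) (b / M.+1%:R ^+ q)) -> small q A.
Proof.
move=> H; have [n bn] := nat_ubound b; exists (c + n)%N => M.
apply: cod_mono (H M) _ _; first by rewrite leq_mul2r leq_addr orbT.
rewrite ler_wpM2r ?invr_ge0 ?exprn_ge0//.
by rewrite natrD (le_trans bn)// lerDr.
Qed.

Lemma small_compl q U V W (A : U -> V) (B : V -> W) b : 0 <= b ->
  opbound B b -> small q A -> small q (fun u => B (A u)).
Proof.
move=> b0 bB [c cA]; apply: (@small_le _ _ _ _ (b * c%:R) c) => M.
by rewrite -mulrA; apply: cod_compl.
Qed.

Lemma small_compr q U V W (A : V -> W) (B : U -> V) b : linear B ->
  opbound B b -> small q A -> small q (fun u => A (B u)).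
Proof.
move=> lB bB [c cA]; apply: (@small_le _ _ _ _ (c%:R * b) c) => M.
rewrite mulrAC; by apply: cod_compr => //; rewrite divr_ge0 ?exprn_ge0.
Qed.

End Codimension.

(** * Neighbourhoods and convergence through the real-valued norm *)

Section Topology.
Context {R : realType} {U : normedModType R[i]}.

(** Radii of balls lie in [R[i]], but 0 < e forces e to be real. *)
Lemma nbhs_nrP (u : U) (B : set U) :
  nbhs u B <-> exists2 e : R, 0 < e & forall v, nr (u - v) < e -> B v.
Proof.
split.
  move=> /nbhs_ballP[e /= e0 eB]; have er : e = (complex.Re e)%:C by rewrite RRe_real// gtr0_real.
  exists (complex.Re e) => [|v uv]; first by rewrite -ltcR -er.
  by apply: eB; rewrite -ball_normE /= normnr er ltcR.
move=> [e e0 eB]; apply/nbhs_ballP; exists e%:C => /=; first by rewrite ltcR.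
by move=> v; rewrite -ball_normE /= normnr ltcR => /eB.
Qed.

Lemma cvg_nrP {T} (F : set_system T) {FF : Filter F} (x : T -> U) (u : U) :
  (x @ F --> u) <-> forall e : R, 0 < e -> \forall t \near F, nr (u - x t) < e.
Proof.
split=> [xu e e0|H B /nbhs_nrP[e e0 eB]].
  by apply: (xu [set v | nr (u - v) < e]); apply/nbhs_nrP; exists e.
by apply: filterS (H e e0) => t; exact: eB.
Qed.

End Topology.

(** * Singular values of compact operators *)

Section CompactOperators.
Context {R : realType} {U : normedModType R[i]} (dot : {dot U for @Num.conj R[i]}).
Hypothesis normE : forall u : U, `|u| = sqrtC (dot u u).
Variables A As : U -> U.
Hypothesis lA : linear A.
Hypothesis adjA : forall u v, dot (A u) v = dot u (As v).

Lemma adjoint_linear : linear As.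
Proof.
move=> a u v; apply: (dot_injr (dot := dot)) => w.
by rewrite -adjA !dotDr// !dotZr// !adjA.
Qed.

Lemma adjoint_sym u v : dot (As u) v = dot u (A v).
Proof. by rewrite dotC -adjA -dotC. Qed.

Lemma opbound_adjoint b : 0 <= b -> opbound A b -> opbound As b.
Proof.
move=> b0 Ab v; have [->|n0] := eqVneq (nr (As v)) 0.
  by rewrite mulr_ge0 ?nr_ge0.
have n1 : 0 < nr (As v) by rewrite lt_def n0 nr_ge0.
rewrite -(ler_pM2r n1) -expr2 (nr_sqrE normE).
rewrite -adjA (le_trans (ler_norm _))// (le_trans (ler_Re_cm _))//.
apply: le_trans (dot_CS normE _ _) _.
by rewrite [leRHS]mulrAC ler_wpM2r ?nr_ge0.
Qed.

Lemma nr_op_sqr u : nr (A u) ^+ 2 = complex.Re (dot (As (A u)) u).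
Proof. by rewrite (nr_sqrE normE) adjoint_sym. Qed.

Hypothesis cA : compact_operator A.

(** Compactness is tested on the filter of tails of A x_n, which gives a point approached at
    arbitrarily large indices. *)
Lemma compact_operator_cluster (x : nat -> U) : (forall n, nr (x n) <= 1) ->
  exists w, forall e, 0 < e -> forall N, exists2 n, (N <= n)%N & nr (w - A (x n)) < e.
Proof.
move=> x1; have [|w [_ cw]] := cA (F := (A \o x) @ \oo) _.
  exists 0%N => // n _ /=; apply: subset_closure; exists (x n) => //=.
  by rewrite nr_unitball.
exists w => e e0 N.
have [||v [[n /= Nn <-] vw]] := cw ((A \o x) @` [set n | (N <= n)%N])
   [set v | nr (w - v) < e].
- by exists N => // n /= Nn; exists n.
- by apply/nbhs_nrP; exists e.
by exists n.
Qed.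

(** Otherwise there are x_n of norm at most 1 with |A x_n| > n, and a cluster point w of A x_n is
    contradicted by large n >= |w| + 1. *)
Lemma compact_operator_bounded : exists2 b, 0 <= b & opbound A b.
Proof.
have [n Hn] : exists n : nat, forall u, nr u <= 1 -> nr (A u) <= n%:R.
  apply: contrapT => H.
  have /choice[x xP] (n : nat) : exists u, nr u <= 1 /\ n%:R < nr (A u).
    apply: contrapT => Hn; apply: H; exists n => u u1.
    by rewrite leNgt; apply/negP => nu; apply: Hn; exists u.
  have [|w wP] := @compact_operator_cluster x; first by move=> n; case: (xP n).
  have [N Nw] := nat_ubound (nr w + 1).
  have [n Nn wn] := wP 1 ltr01 N.
  have [_ nx] := xP n.
  have : nr (A (x n)) <= nr w + nr (w - A (x n)).
    by rewrite -{1}[A (x n)](subKr w) nrB.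
  have : (N%:R : R) <= n%:R by rewrite ler_nat.
  by lra.
exists n%:R => // u; have [->|u0] := eqVneq u 0.
  by rewrite lin0// nr0 mulr0.
have nu : 0 < nr u by exact: nr_gt0.
have := Hn ((nr u)^-1%:C *: u); rewrite linZ// !nrZ cm_real.
rewrite ger0_norm ?invr_ge0 ?nr_ge0// mulVf ?gt_eqF// => /(_ (lexx _)).
by rewrite ler_pdivrMl// mulrC.
Qed.

Definition orth_seq (S : seq U) (u : U) := forall e, e \in S -> dot u e = 0.

(* The maximum of |A u| over unit vectors u orthogonal to S is attained at a
   multiple of As w, where w is a cluster point of A x_n for a maximizing x. *)
Lemma maximizing_eigenvector (S : seq U) :
  (forall e, e \in S -> exists m : R, As (A e) = m%:C *: e) ->
  exists p : U * R, [/\ 0 <= p.2, As (A p.1) = p.2%:C *: p.1, orth_seq S p.1,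
    0 < p.2 -> nr p.1 = 1 &
    forall u, orth_seq S u -> nr (A u) ^+ 2 <= p.2 * nr u ^+ 2].
Proof.
move=> eS; have [b b0 Ab] := compact_operator_bounded.
pose E : set R := [set nr (A u) | u in [set u | nr u <= 1 /\ orth_seq S u]].
have S0 : orth_seq S 0 by move=> e _; rewrite dot0l.
have E0 : E 0 by exists 0; rewrite /= ?lin0// nr0 //; split.
have hE : has_sup E.
  split; first by exists 0.
  exists b => _ [u [u1 _] <-]; rewrite (le_trans (Ab u))//.
  by rewrite ler_piMr.
pose M := sup E; have ubE : ubound E M by exact: sup_upper_bound.
have M0 : 0 <= M by exact: ubE.
have ME u : orth_seq S u -> nr (A u) <= M * nr u.
  move=> uS; have [->|u0] := eqVneq u 0; first by rewrite lin0// nr0 mulr0.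
  have nu : 0 < nr u by exact: nr_gt0.
  have : E (nr (A ((nr u)^-1%:C *: u))).
    exists ((nr u)^-1%:C *: u) => //; split => [|e eS'].
      by rewrite nrZ cm_real ger0_norm ?invr_ge0 ?nr_ge0// mulVf ?gt_eqF.
    by rewrite dotZl uS// mulr0.
  move/ubE; rewrite linZ// nrZ cm_real ger0_norm ?invr_ge0 ?nr_ge0//.
  by rewrite ler_pdivrMl// mulrC.
have [M0'|M1] := eqVneq M 0.
  (* Here A vanishes on the orthogonal complement of S and the zero vector serves; this is why unit
     length is claimed only for p.2 > 0. *)
  exists (0, 0); split => //=; first by rewrite scaler0 (lin0 lA) (lin0 adjoint_linear).
    by rewrite ltxx.
  move=> u /ME; rewrite M0' mul0r => Au; rewrite mul0r.
  by rewrite (_ : nr (A u) = 0) ?expr0n//; apply/eqP; rewrite eq_le Au nr_ge0.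
have {M1}M1 : 0 < M by rewrite lt_def M1 M0.
(* The bound M passes to [As] by duality: |As y|^2 = <y, A (As y)>, where [As y] is again orthogonal
   to S. *)
have bAs y : (forall e, e \in S -> dot y (A e) = 0) -> orth_seq S (As y) /\ nr (As y) <= M * nr y.
  move=> yS; have oS : orth_seq S (As y) by move=> e /yS; rewrite adjoint_sym.
  split => //; have [->|n0] := eqVneq (nr (As y)) 0.
    by rewrite mulr_ge0 ?nr_ge0.
  have n1 : 0 < nr (As y) by rewrite lt_def n0 nr_ge0.
  rewrite -(ler_pM2r n1) -expr2 (nr_sqrE normE) adjoint_sym.
  rewrite (le_trans (ler_norm _))// (le_trans (ler_Re_cm _))//.
  rewrite (le_trans (dot_CS normE _ _))// mulrC [leRHS]mulrAC ler_wpM2r ?nr_ge0//.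
  exact: ME.
have /choice[x xP] (n : nat) : exists u, [/\ nr u <= 1, orth_seq S u & M - n.+1%:R^-1 < nr (A u)].
  have [|_ [u [u1 uS] <-] Mu] := @sup_adherent _ E n.+1%:R^-1 _ hE.
    by rewrite invr_gt0.
  by exists u; split.
have [|w wP] := @compact_operator_cluster x; first by move=> n; case: (xP n).
have wP' e : 0 < e -> exists n, nr (w - A (x n)) < e /\ M - e < nr (A (x n)).
  move=> e0; have [N Ne] := nat_ubound e^-1.
  have [n Nn wn] := wP e e0 N; exists n; split => //.
  have [_ _] := xP n; apply: le_lt_trans; rewrite lerD2l lerN2.
  rewrite -[leRHS]invrK lef_pV2 ?posrE ?invr_gt0// (le_trans Ne)// ler_nat.
  exact: leq_trans Nn _.
have nwM : nr w = M.
  apply/eqP; rewrite eq_le; apply/andP; split.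
    apply/ler_addgt0Pr => e e0; have [n [wn _]] := wP' e e0.
    rewrite -(subrK (A (x n)) w) (le_trans (nrD _ _))// addrC lerD ?(ltW wn)//.
    by have [x1 xS _] := xP n; rewrite (le_trans (ME _ xS))// ler_piMr.
  apply/ler_addgt0Pr => e e0; have [|n [wn An]] := wP' (e / 2).
    by rewrite divr_gt0.
  have : nr (A (x n)) <= nr w + nr (w - A (x n)).
    by rewrite -{1}[A (x n)](subKr w) nrB.
  by lra.
have wS e : e \in S -> dot w (A e) = 0.
  move=> eS'; apply: cm_eq0; apply/eqP; rewrite eq_le cm_ge0 andbT.
  apply/ler_addgt0Pr => d d0; have [|n [wn _]] := wP' (d / (nr (A e) + 1)).
    by rewrite divr_gt0// ltr_wpDl ?nr_ge0.
  have [_ xS _] := xP n; have [m em] := eS e eS'.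
  have -> : dot w (A e) = dot (w - A (x n)) (A e).
    by rewrite dotBl [dot (A (x n)) _]adjA em dotZr xS// mulr0 subr0.
  rewrite add0r (le_trans (dot_CS normE _ _))//.
  rewrite (@le_trans _ _ (d / (nr (A e) + 1) * nr (A e)))//.
    by rewrite ler_wpM2r ?nr_ge0 ?ltW.
  rewrite mulrAC ler_pdivrMr ?ltr_wpDl ?nr_ge0// ler_wpM2l ?(ltW d0)//.
  by rewrite lerDl.
have [AswS Asw] := bAs w wS; rewrite nwM in Asw.
(* <x_n, As w> = <A x_n, w> comes arbitrarily close to |w|^2 = M^2, while |x_n| <= 1. *)
have AswM : nr (As w) = M * M.
  apply/eqP; rewrite eq_le Asw /=; apply/ler_addgt0Pr => d d0.
  have [|n [wn _]] := wP' (d / M); first by rewrite divr_gt0.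
  have [x1 xS _] := xP n.
  have h1 : complex.Re (dot (x n) (As w)) <= nr (As w).
    rewrite (le_trans (ler_norm _))// (le_trans (ler_Re_cm _))//.
    by rewrite (le_trans (dot_CS normE _ _))// ler_piMl// nr_ge0.
  have h2 : complex.Re (dot (w - A (x n)) w) <= d.
    rewrite (le_trans (ler_norm _))// (le_trans (ler_Re_cm _))//.
    rewrite (le_trans (dot_CS normE _ _))// nwM.
    by rewrite -ler_pdivlMr// ltW.
  move: h2; rewrite dotBl ReD; case E1 : (dot (A (x n)) w) => [p r] /=.
  move: h1; rewrite -adjA E1 /= -(nr_sqrE normE) nwM expr2; lra.
pose v := (M ^- 2)%:C *: As w.
have M2 : 0 < M ^+ 2 by rewrite exprn_gt0.
have nv : nr v = 1.
  by rewrite nrZ cm_real ger0_norm ?invr_ge0 ?exprn_ge0// AswM -expr2 mulVf// gt_eqF.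
have vS : orth_seq S v by move=> e eS'; rewrite dotZl AswS// mulr0.
have Avw : dot (A v) w = (M ^+ 2)%:C.
  rewrite adjA dotZl (dotuu normE) AswM -rmorphM /=; congr (_%:C).
  by field; rewrite gt_eqF.
have AvM : nr (A v) = M.
  apply/eqP; rewrite eq_le; apply/andP; split.
    by rewrite (le_trans (ME _ vS))// nv mulr1.
  have := dot_CS normE (A v) w; rewrite Avw cm_real ger0_norm ?exprn_ge0// nwM.
  by rewrite expr2 ler_pM2r.
have [TvS Tv] : orth_seq S (As (A v)) /\ nr (As (A v)) <= M * nr (A v).
  apply: bAs => e eS'; have [m em] := eS e eS'.
  by rewrite adjA em dotZr vS// mulr0.
exists (v, M ^+ 2); split => //=; first exact: ltW.
  (* |As A v - M^2 v|^2 = |As A v|^2 - 2 M^2 |A v|^2 + M^4 is at most 0, because |A v| = M and |As A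
     v| <= M^2. *)
  apply/eqP; rewrite -subr_eq0; apply/eqP; apply: nr_eq0.
  apply/eqP; rewrite -sqrf_eq0 eq_le sqr_ge0 andbT.
  rewrite (nrB_sqr normE) nrZ cm_real ger0_norm ?exprn_ge0// nv mulr1.
  rewrite dotZr conjc_real Defs.ReM /= mul0r subr0 -nr_op_sqr AvM.
  have : nr (As (A v)) ^+ 2 <= (M * M) ^+ 2.
    by rewrite ler_sqr ?nnegrE ?nr_ge0 ?mulr_ge0// (le_trans Tv)// AvM.
  by rewrite -expr2; set t := M ^+ 2; nra.
by move=> u /ME Au; rewrite -exprMn ler_sqr ?nnegrE ?nr_ge0// mulr_ge0// nr_ge0.
Qed.

End CompactOperators.

(** * Spectral decomposition of A^*A *)

Section EigenSystem.
Context {R : realType} {U : normedModType R[i]} (dot : {dot U for @Num.conj R[i]}).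
Hypothesis normE : forall u : U, `|u| = sqrtC (dot u u).

(** [lam] lists the squares of the singular values. The extremal bound [eig_bound] stands for
    completeness of the system. An operator of finite rank runs out of eigenvectors, so e n may be 0
    when lam n = 0. *)
Record eigen_system (A As : U -> U) (e : nat -> U) (lam : nat -> R) := EigenSystem {
  lam_ge0 : forall n, 0 <= lam n;
  eig_eq : forall n, As (A (e n)) = (lam n)%:C *: e n;
  eig_orth : forall i j, i != j -> dot (e i) (e j) = 0;
  eig_unit : forall n, 0 < lam n -> nr (e n) = 1;
  eig_bound : forall n u, (forall i, (i < n)%N -> dot u (e i) = 0) ->
    nr (A u) ^+ 2 <= lam n * nr u ^+ 2 }.

Variables A As : U -> U.
Hypothesis lA : linear A.
Hypothesis adjA : forall u v, dot (A u) v = dot u (As v).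

Lemma eigen_system_exists : compact_operator A ->
  exists e lam, eigen_system A As e lam.
Proof.
move=> cA.
pose good (S : seq U) := forall e : U, e \in S -> exists m : R, As (A e) = m%:C *: e.
(* The requirement is conditional on S consisting of eigenvectors, so that choice yields a total
   function [next]; [gS] discharges the condition along the iteration. *)
pose P (S : seq U) (p : U * R) := good S -> [/\ 0 <= p.2, As (A p.1) = p.2%:C *: p.1,
  orth_seq dot S p.1, 0 < p.2 -> nr p.1 = 1 &
  forall u, orth_seq dot S u -> nr (A u) ^+ 2 <= p.2 * nr u ^+ 2].
have /choice[next nP] S : exists p, P S p.
  have [gS|nS] := pselect (good S); last by exists (0, 0).
  by have [p pP] := maximizing_eigenvector normE lA adjA cA gS; exists p.
pose S n := iter n (fun s => rcons s (next s).1) [::].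
pose e n := (next (S n)).1; pose lam n := (next (S n)).2.
have SS n : S n.+1 = rcons (S n) (e n) by [].
have gS n : good (S n).
  elim: n => [//|n IH] x; rewrite SS mem_rcons inE => /orP[/eqP ->|]; last exact: IH.
  by exists (lam n); have [] := nP (S n) IH.
have eP n := nP (S n) (gS n).
have memS i n : (i < n)%N -> e i \in S n.
  elim: n => // n IH; rewrite ltnS SS mem_rcons inE leq_eqVlt => /orP[/eqP ->|/IH ->].
    by rewrite eqxx.
  by rewrite orbT.
have lt_orth i j : (i < j)%N -> dot (e j) (e i) = 0.
  by move=> ij; have [_ _ o _ _] := eP j; apply: o; exact: memS.
exists e, lam; split=> [n|n|i j ij|n|n u un].
- by have [] := eP n.
- by have [] := eP n.
- have [ij'|ji|/eqP] := ltngtP i j; [exact/dot_eq0C/lt_orth|exact: lt_orth|by rewrite (negbTE ij)].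
- by have [] := eP n.
have [_ _ _ _] := eP n; apply => x.
have : forall k, (k <= n)%N -> x \in S k -> dot u x = 0.
  elim=> [//|k IH] kn; rewrite SS mem_rcons inE => /orP[/eqP ->|]; first exact: un.
  by apply: IH; exact: ltnW.
exact.
Qed.

Section Properties.
Variables (e : nat -> U) (lam : nat -> R).
Hypothesis ES : eigen_system A As e lam.

Lemma nr_op_eig n : nr (A (e n)) ^+ 2 = lam n * nr (e n) ^+ 2.
Proof.
by rewrite (nr_op_sqr normE adjA) (eig_eq ES) dotZl (dotuu normE) -rmorphM.
Qed.

(** e n.+1 is orthogonal to all e i with i < n, hence a test vector for the bound at n. *)
Lemma lam_nonincreasing : {homo lam : m n / (m <= n)%N >-> n <= m}.
Proof.
apply: (homo_leq (r := fun x y => y <= x)) => // [y x z yx zy|n].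
  exact: le_trans zy yx.
have := lam_ge0 ES n.+1; rewrite le_eqVlt => /orP[/eqP <-|l0]; first exact: lam_ge0 ES n.
have := eig_bound ES (n := n) (u := e n.+1); rewrite nr_op_eig (eig_unit ES l0).
by rewrite !expr1n !mulr1; apply => i ni; apply: (eig_orth ES); lia.
Qed.

Lemma dot_op_eig i j : i != j -> dot (A (e i)) (A (e j)) = 0.
Proof. by move=> ij; rewrite adjA (eig_eq ES) dotZr (eig_orth ES)// mulr0. Qed.

(** If lam n >= d for all n, the vectors A (e n) are pairwise at distance at least sqrt (2 d), which
    excludes a cluster point. *)
Lemma lam_cvg0 : compact_operator A -> forall d, 0 < d -> exists n, lam n < d.
Proof.
move=> cA d d0; apply: contrapT => H.
have dl n : d <= lam n by rewrite leNgt; apply/negP => ld; apply: H; exists n.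
have l0 n : 0 < lam n by exact: lt_le_trans (dl n).
have [|w wP] := compact_operator_cluster cA (x := e).
  by move=> n; rewrite (eig_unit ES).
pose c := Num.sqrt d / 2; have c0 : 0 < c by rewrite divr_gt0// sqrtr_gt0.
have [n _ wn] := wP c c0 0%N; have [m nm wm] := wP c c0 n.+1.
have : nr (A (e n) - A (e m)) ^+ 2 = lam n + lam m.
  rewrite (nrB_sqr normE) dot_op_eig; last by lia.
  by rewrite !nr_op_eig !(eig_unit ES)//= !expr1n !mulr1 mulr0 subr0.
have : nr (A (e n) - A (e m)) <= nr (w - A (e m)) + nr (w - A (e n)).
  rewrite -(nrN (w - A (e n))) (_ : A (e n) - A (e m) = (w - A (e m)) + - (w - A (e n))) ?nrD//.
  by rewrite opprB [RHS]addrC addrA subrK.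
have := dl n; have := dl m; have := nr_ge0 (A (e n) - A (e m)).
have : c ^+ 2 * 4 = d by rewrite expr_div_n sqr_sqrtr ?ltW//; field.
move: wn wm; set x := nr _; set y := nr _; set z := nr _.
by nra.
Qed.

Lemma nr_eig_comb n (a : 'I_n -> R[i]) : (forall i : 'I_n, 0 < lam i) ->
  nr (\sum_(i < n) a i *: e i) ^+ 2 = \sum_(i < n) cm (a i) ^+ 2.
Proof.
move=> l0; rewrite (nr_sum_sqr normE) => [|i j ij].
  by apply: eq_bigr => i _; rewrite nrZ (eig_unit ES (l0 i)) mulr1.
by rewrite dotZl dotZr (eig_orth ES) ?mulr0.
Qed.

Lemma dot_comb_eig n (a : nat -> R[i]) k :
  dot (\sum_(i < n) a i *: e i) (e k) = if (k < n)%N then a k * (nr (e k) ^+ 2)%:C else 0.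
Proof.
rewrite dot_suml; case: ifP => kn.
  rewrite (bigD1 (Ordinal kn))//= dotZl (dotuu normE) big1 ?addr0// => i ik.
  by rewrite dotZl (eig_orth ES) ?mulr0.
apply: big1 => i _; rewrite dotZl (eig_orth ES) ?mulr0//.
by apply/eqP => ik; rewrite -ik ltn_ord in kn.
Qed.

Definition eig_proj n (u : U) := \sum_(i < n) dot u (e i) *: e i.

Lemma dot_eig_rem n u k : (k < n)%N -> 0 < lam k -> dot (u - eig_proj n u) (e k) = 0.
Proof.
move=> kn l0; rewrite dotBl (dot_comb_eig n (fun i => dot u (e i))) kn.
by rewrite (eig_unit ES l0) expr1n mulr1 subrr.
Qed.

Lemma op_eig_rem n u : nr (A (u - eig_proj n u)) ^+ 2 <= lam n * nr u ^+ 2.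
Proof.
have := lam_ge0 ES n; rewrite le_eqVlt => /orP[/eqP l0|ln].
  (* If lam n = 0, the last e k need not have unit length, so [eig_proj] need not remove the
     components along them. But A kills them, and they are dropped until all remaining eigenvalues
     are positive. *)
  rewrite -l0 mul0r; elim: n l0 => [|n IH] l0.
    have := eig_bound ES (n := 0%N) (u := u); rewrite -l0 mul0r.
    by rewrite /eig_proj big_ord0 subr0; apply.
  have := lam_ge0 ES n; rewrite le_eqVlt => /orP[/eqP l0'|ln].
    have A0 : A (e n) = 0.
      apply/nr_eq0/eqP; rewrite -sqrf_eq0 nr_op_eig -l0' mul0r//.
    rewrite /eig_proj big_ord_recr /= opprD addrA (linB lA _ (_ *: _)) (linZ lA) A0.
    by rewrite scaler0 subr0; exact: IH.
  have := eig_bound ES (n := n.+1) (u := u - eig_proj n.+1 u).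
  rewrite -l0 mul0r; apply => i /[!ltnS] ni; apply: dot_eig_rem => //.
  by apply: lt_le_trans ln _; exact: lam_nonincreasing.
apply: le_trans (eig_bound ES (n := n) _) _.
  move=> i ni; apply: dot_eig_rem => //.
  by apply: lt_le_trans ln _; exact/lam_nonincreasing/ltnW.
rewrite ler_wpM2l ?(ltW ln)//.
have : nr u ^+ 2 = nr (u - eig_proj n u) ^+ 2 + nr (eig_proj n u) ^+ 2.
  rewrite -(nr_pythagoras normE) ?subrK// dot_sumr big1// => i _.
  rewrite dotZr dot_eig_rem ?mulr0//.
  by apply: lt_le_trans ln _; exact/lam_nonincreasing/ltnW.
by move=> ->; rewrite lerDl sqr_ge0.
Qed.

End Properties.
End EigenSystem.

Lemma has_dim_le (R : realType) (U : normedModType R[i]) (E : set U) k l :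
  has_dim E k -> has_dim E l -> (k <= l)%N.
Proof.
move=> [e [ei Ee]] [f [_ Ef]]; rewrite leqNgt; apply/negP => lk.
have /choice[m mP] (i : 'I_k) : exists c : 'I_l -> R[i], e i = \sum_(j < l) c j *: f j.
  have : E (e i).
    rewrite Ee; exists (fun j => (j == i)%:R).
    rewrite (bigD1 i)//= eqxx scale1r big1 ?addr0// => j /negPf ->.
    by rewrite scale0r.
  by rewrite Ef.
have [|a [[i ai] am]] := @exists_kernel_vector _ 'I_k 'I_l m.
  by rewrite !card_ord.
move: ai; rewrite ei ?eqxx//.
under eq_bigr do rewrite mP scaler_sumr.
rewrite exchange_big big1//= => j _.
under eq_bigr do rewrite scalerA.
by rewrite -scaler_suml am scale0r.
Qed.

Lemma has_dim_unique (R : realType) (U : normedModType R[i]) (E : set U) k l :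
  has_dim E k -> has_dim E l -> k = l.
Proof. by move=> Ek El; apply/eqP; rewrite eqn_leq !(has_dim_le Ek El, has_dim_le El Ek). Qed.

(** n is an index up to which s and t agree. From n on t stays below s n, so the level set of t at s
    n lies in that of s; equal finite cardinality makes them equal, yet only the second contains
    n. *)
Lemma level_sets_lt (R : realType) (s t : nat -> R) n k :
  nonincreasing_seq t -> (forall m, (m < n)%N -> s m = t m) ->
  ([set m | s m = s n] #= `I_k)%card -> ([set m | t m = s n] #= `I_k)%card ->
  t n < s n -> False.
Proof.
move=> ti st Sk Tk tn.
have fS : finite_set [set m | s m = s n] by exists k.
have fT : finite_set [set m | t m = s n] by exists k.
have TS : [set m | t m = s n] `<=` [set m | s m = s n].
  move=> m /= tm; have [mn|nm] := ltnP m n; first by rewrite st.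
  by have := ti _ _ nm; rewrite tm leNgt tn.
have : fset_set [set m | t m = s n] == fset_set [set m | s m = s n].
  rewrite eqEfcard; apply/andP; split; first by rewrite -fset_set_sub.
  by rewrite (card_fset_set Sk) (card_fset_set Tk).
move/eqP/(fset_set_inj fT fS) => e.
have : [set m | t m = s n] n by rewrite e.
by move=> /= tn'; move: tn; rewrite tn' ltxx.
Qed.

Lemma eigenvalue_sequence_unique (R : realType) (U : normedModType R[i]) (B : U -> U) s t :
  eigenvalue_sequence B s -> eigenvalue_sequence B t -> s = t.
Proof.
move=> [s0 si sE] [t0 ti tE]; apply/funext => n.
elim/ltn_ind: n => n IH.
have H (l : R) : 0 < l -> exists k, ([set m | s m = l] #= `I_k)%card /\ ([set m | t m = l] #= `I_k)%card.
  move=> l0; have [k [Ek sk]] := sE l l0; have [k' [Ek' tk]] := tE l l0.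
  by exists k; split => //; rewrite (has_dim_unique Ek Ek').
have [st|ts|//] := ltgtP (s n) (t n); exfalso.
  have [|k [sk tk]] := H (t n); first exact: le_lt_trans st.
  by apply: (level_sets_lt si _ tk sk st) => m /IH.
have [|k [sk tk]] := H (s n); first exact: le_lt_trans ts.
exact: (level_sets_lt ti IH sk tk ts).
Qed.

(** * The operator |A| and its eigenvalue sequence *)

Section AbsoluteValue.
Context {R : realType} {U : normedModType R[i]} (dot : {dot U for @Num.conj R[i]}).
Hypothesis normE : forall u : U, `|u| = sqrtC (dot u u).

Definition nr_complete (V : normedModType R[i]) := forall x : nat -> V,
  (forall d, 0 < d -> exists N, forall m n, (N <= m)%N -> (N <= n)%N -> nr (x m - x n) < d) ->
  exists w : V, x @ \oo --> w.

Variables A As : U -> U.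
Hypothesis lA : linear A.
Hypothesis adjA : forall u v, dot (A u) v = dot u (As v).
Hypothesis cA : compact_operator A.
Variables (e : nat -> U) (lam : nat -> R).
Hypothesis ES : eigen_system dot A As e lam.

Let s n := Num.sqrt (lam n).
Let s_ge0 n : 0 <= s n. Proof. exact: sqrtr_ge0. Qed.
Let s_sqr n : s n ^+ 2 = lam n. Proof. by rewrite sqr_sqrtr// (lam_ge0 ES). Qed.

(** s N tends to 0, so estimates with error K s N for every N become identities. *)
Lemma sqrt_lam_limit (x K : R) : 0 <= K -> (forall N, x <= K * s N) -> x <= 0.
Proof.
move=> K0 H; apply/ler_addgt0Pr => d d0; rewrite add0r.
have [|N lN] := lam_cvg0 normE adjA ES cA (d := (d / (K + 1)) ^+ 2).
  by rewrite exprn_gt0// divr_gt0// ltr_wpDl.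
have sN : s N <= d / (K + 1).
  rewrite -ler_sqr ?nnegrE ?s_ge0// ?s_sqr ?(ltW lN)//.
  by rewrite divr_ge0 ?addr_ge0 ?(ltW d0).
apply: le_trans (H N) (le_trans (ler_wpM2l K0 sN) _).
by rewrite mulrCA ler_piMr ?(ltW d0)// ler_pdivrMr ?mul1r ?lerDl// ltr_wpDl.
Qed.

Let Bn N u := \sum_(n < N) (dot u (e n) * (s n)%:C) *: e n.

Let nr_Bn_op N (a : nat -> R[i]) :
  nr (\sum_(n < N) (a n * (s n)%:C) *: e n) = nr (A (\sum_(n < N) a n *: e n)).
Proof.
apply/eqP; rewrite -(eqrXn2 (n := 2))// ?nr_ge0//; apply/eqP.
rewrite (lin_sum lA) !(nr_sum_sqr normE) => [|i j ij|i j ij].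
- apply: eq_bigr => i _; rewrite (linZ lA) !nrZ cmM cm_real ger0_norm ?s_ge0//.
  by rewrite !exprMn s_sqr (nr_op_eig normE adjA ES) -mulrA.
- by rewrite !(linZ lA) dotZl dotZr (dot_op_eig adjA ES) ?mulr0.
- by rewrite dotZl dotZr (eig_orth ES) ?mulr0.
Qed.

(** By [nr_Bn_op], which is polar decomposition on the span of the e n, the difference has the norm
    of A applied to a difference of projections; two remainders of A bound it. *)
Let Bn_dist N M u : (N <= M)%N -> nr (Bn M u - Bn N u) <= 2 * s N * nr u.
Proof.
move=> NM; pose a n := if (n < N)%N then 0 else dot u (e n).
have sumB (F : nat -> U) (c : nat -> R[i]) :
    \sum_(n < M) (dot u (e n) * c n) *: F n - \sum_(n < N) (dot u (e n) * c n) *: F n =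
    \sum_(n < M) (a n * c n) *: F n.
  rewrite -(subnKC NM) !big_split_ord /= addrAC subrr add0r.
  rewrite [X in X + _]big1 ?add0r => [|i _]; last by rewrite /a ltn_ord mul0r scale0r.
  by apply: eq_bigr => i _; rewrite /a ltnNge leq_addr.
rewrite /Bn (sumB e (fun n => (s n)%:C)) nr_Bn_op.
have -> : \sum_(n < M) a n *: e n = eig_proj dot e M u - eig_proj dot e N u.
  have := sumB e (fun=> 1); rewrite /eig_proj; under eq_bigr do rewrite mulr1.
  under [X in _ - X]eq_bigr do rewrite mulr1.
  by move=> ->; apply: eq_bigr => i _; rewrite mulr1.
have -> : eig_proj dot e M u - eig_proj dot e N u =
    (u - eig_proj dot e N u) - (u - eig_proj dot e M u).
  by rewrite opprB [RHS]addrC addrA subrK.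
rewrite (linB lA) (le_trans (nrB _ _))//.
have H n : nr (A (u - eig_proj dot e n u)) <= s n * nr u.
  rewrite -ler_sqr ?nnegrE ?mulr_ge0 ?nr_ge0// exprMn s_sqr.
  exact: op_eig_rem.
have sNM : s M <= s N by rewrite ler_wsqrtr// (lam_nonincreasing normE adjA ES).
have := H M; have := H N; have := ler_wpM2r (nr_ge0 u) sNM; lra.
Qed.

(** B u is the sum of the series s n <u, e n> e n. The explicit rate is what feeds
    [sqrt_lam_limit]. *)
Lemma abs_limit : nr_complete U ->
  exists B : U -> U, forall N u, nr (B u - Bn N u) <= 2 * s N * nr u.
Proof.
move=> cU; have /choice[B BP] u : exists w, forall N, nr (w - Bn N u) <= 2 * s N * nr u.
  have [|w wP] := cU (Bn^~ u).
    move=> d d0; have [N Nd] : exists N, 2 * s N * nr u * 2 < d.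
      apply: contrapT => H.
      have : d <= 0.
        apply: (sqrt_lam_limit (K := 4 * nr u)); first by rewrite mulr_ge0 ?nr_ge0.
        move=> N; rewrite leNgt; apply/negP => Nd; apply: H; exists N.
        by apply: le_lt_trans Nd; rewrite le_eqVlt; apply/orP; left; apply/eqP; ring.
      by rewrite leNgt d0.
    exists N => m n Nm Nn; apply: le_lt_trans Nd.
    rewrite (_ : Bn m u - Bn n u = (Bn m u - Bn N u) - (Bn n u - Bn N u)).
      apply: le_trans (nrB _ _) _; have := Bn_dist u Nm; have := Bn_dist u Nn; lra.
    by rewrite opprB addrA subrK.
  exists w => N; apply/ler_addgt0Pr => d d0.
  have /cvg_nrP/(_ d d0)[M _ MP] := wP.
  pose m := maxn M N.
  have -> : w - Bn N u = (Bn m u - Bn N u) + (w - Bn m u).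
    by rewrite [RHS]addrC addrA subrK.
  apply: le_trans (nrD _ _) _; apply: lerD; first exact/Bn_dist/leq_maxr.
  by apply: ltW; apply: MP; rewrite /= leq_maxl.
by exists B.
Qed.

Lemma abs_exists : nr_complete U -> exists B : U -> U,
  [/\ linear B, continuous B, forall u, 0 <= dot (B u) u & B \o B = As \o A].
Proof.
move=> /abs_limit[B BP]; exists B.
have [b b0 Ab] := compact_operator_bounded lA cA.
have lB : linear B.
  move=> a u v; apply/eqP; rewrite -subr_eq0; apply/eqP/nr_eq0/eqP.
  rewrite eq_le nr_ge0 andbT.
  apply: (sqrt_lam_limit (K := 2 * nr (a *: u + v) + cm a * (2 * nr u) + 2 * nr v)).
    by rewrite !addr_ge0 ?mulr_ge0 ?cm_ge0 ?nr_ge0.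
  move=> N.
  have BnE : Bn N (a *: u + v) = a *: Bn N u + Bn N v.
    rewrite /Bn scaler_sumr -big_split; apply: eq_bigr => i _ /=.
    by rewrite dotDl dotZl mulrDl scalerDl scalerA mulrA.
  have -> : B (a *: u + v) - (a *: B u + B v) =
     (B (a *: u + v) - Bn N (a *: u + v)) - (a *: (B u - Bn N u) + (B v - Bn N v)).
    rewrite BnE scalerBr; set x := B _; set y := a *: B u; set z := a *: Bn N u.
    have -> : y + B v = (z + Bn N v) + ((y - z) + (B v - Bn N v)).
      by rewrite addrACA !subrKC.
    by rewrite opprD addrA.
  apply: le_trans (nrB _ _) _; apply: le_trans (lerD (BP _ _) (nrD _ _)) _.
  rewrite nrZ; have := ler_wpM2l (cm_ge0 a) (BP N u); have := BP N v; lra.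
have bB u : nr (B u) <= 2 * s 0%N * nr u.
  by have := BP 0%N u; rewrite /Bn big_ord0 subr0.
have s0 : 0 <= 2 * s 0%N by rewrite mulr_ge0.
split => //.
- move=> u; apply/cvg_nrP => d d0.
  have : \forall v \near u, nr (u - v) < d / (2 * s 0%N + 1).
    by apply/nbhs_nrP; exists (d / (2 * s 0%N + 1)); rewrite ?divr_gt0 ?ltr_wpDl.
  apply: filterS => v uv; rewrite -(linB lB); apply: le_lt_trans (bB _) _.
  move: uv; rewrite ltr_pdivlMr ?ltr_wpDl//; have := nr_ge0 (u - v).
  set x := nr _; set y := s 0%N; nra.
- move=> u.
  have K0 : 0 <= 2 * nr u * nr u by rewrite !mulr_ge0 ?nr_ge0.
  have H N : cm (dot (B u - Bn N u) u) <= 2 * nr u * nr u * s N.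
    apply: le_trans (dot_CS normE _ _) _.
    by apply: le_trans (ler_wpM2r (nr_ge0 u) (BP N u)) _; rewrite le_eqVlt; apply/orP; left; apply/eqP; ring.
  have Bn0 N : exists2 r : R, 0 <= r & dot (Bn N u) u = r%:C.
    exists (\sum_(n < N) cm (dot u (e n)) ^+ 2 * s n).
      by rewrite sumr_ge0// => n _; rewrite mulr_ge0 ?sqr_ge0.
    rewrite /Bn dot_suml rmorph_sum; apply: eq_bigr => n _ /=.
    by rewrite dotZl [dot (e n) u]dotC mulrAC mulcJ -rmorphM.
  rewrite lecE /=; apply/andP; split.
    rewrite -normr_eq0 eq_le normr_ge0 andbT; apply: (sqrt_lam_limit K0) => N.
    apply: le_trans (H N); apply: le_trans (ler_Im_cm _).
    have [r _ rE] := Bn0 N; rewrite dotBl rE.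
    by case: (dot (B u) u) => x y /=; rewrite oppr0 addr0.
  rewrite -oppr_le0; apply: (sqrt_lam_limit K0) => N.
  apply: le_trans (H N); apply: le_trans (ler_Re_cm _).
  have [r r0 rE] := Bn0 N; rewrite dotBl rE -normrN; apply: le_trans (ler_norm _).
  by case: (dot (B u) u) => x y /=; lra.
apply/funext => u /=; apply/eqP; rewrite -subr_eq0; apply/eqP/nr_eq0/eqP.
rewrite eq_le nr_ge0 andbT.
have Be k : B (e k) = (s k)%:C *: e k.
  apply/eqP; rewrite -subr_eq0; apply/eqP/nr_eq0/eqP; rewrite eq_le nr_ge0 andbT.
  have Bk N : (k < N)%N -> Bn N (e k) = (s k)%:C *: e k.
    move=> kN; rewrite /Bn (bigD1 (Ordinal kN))//= big1 => [|i ik].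
      rewrite addr0 (dotuu normE); have := lam_ge0 ES k.
      rewrite le_eqVlt => /orP[/eqP l0|/(eig_unit ES) ->].
        by rewrite /s -l0 sqrtr0 mulr0 !scale0r.
      by rewrite expr1n mul1r.
    rewrite (eig_orth ES) ?mul0r ?scale0r//.
    by apply: contra ik => /eqP ik; apply/eqP/val_inj.
  apply: (sqrt_lam_limit (K := 2 * nr (e k))); first by rewrite mulr_ge0 ?nr_ge0.
  move=> N; rewrite -(Bk (maxn N k.+1)); last by rewrite leq_max ltnSn orbT.
  apply: le_trans (BP _ _) _; rewrite [leRHS]mulrAC ler_wpM2r ?nr_ge0// ler_wpM2l//.
  by rewrite ler_wsqrtr// (lam_nonincreasing normE adjA ES)// leq_maxl.
apply: (sqrt_lam_limit (K := 2 * s 0%N * 2 * nr u + b * nr u)).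
  by rewrite !(addr_ge0, mulr_ge0) ?nr_ge0.
move=> N.
(* B (Bn N u) = As (A (eig_proj N u)), since both sides multiply the term along e k by lam k; only
   remainders are left. *)
have -> : B (B u) - As (A u) = B (B u - Bn N u) - As (A (u - eig_proj dot e N u)).
  have lAs := adjoint_linear adjA.
  rewrite (linB lB) (linB lA) (linB lAs) opprB addrA; congr (_ - _).
  rewrite -[LHS]addr0 -addrA; congr (_ + _); apply/eqP; rewrite eq_sym addrC subr_eq0; apply/eqP.
  rewrite /Bn /eig_proj (lin_sum lA) (lin_sum lAs) (lin_sum lB).
  apply: eq_bigr => i _; rewrite (linZ lA) (linZ lAs) (linZ lB) (eig_eq ES) Be !scalerA.
  by rewrite -mulrA -rmorphM -expr2 s_sqr.
apply: le_trans (nrB _ _) _; rewrite mulrDl; apply: lerD.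
  apply: le_trans (bB _) _; rewrite -!mulrA; apply: ler_wpM2l => //.
  by apply: ler_wpM2l => //; have := BP N u; rewrite -mulrA [nr u * _]mulrC mulrA.
apply: le_trans (opbound_adjoint normE adjA b0 Ab _) _; rewrite -mulrA ler_wpM2l//.
rewrite -ler_sqr ?nnegrE ?mulr_ge0 ?nr_ge0// exprMn s_sqr mulrC.
exact: op_eig_rem.
Qed.

(** B is an arbitrary positive square root, since [operator_abs] is merely selected. Its eigenspaces
    are therefore read off from those of As A. *)
Lemma eigenvalue_sequence_abs (B : U -> U) : linear B ->
  (forall u, 0 <= dot (B u) u) -> B \o B = As \o A -> eigenvalue_sequence B s.
Proof.
move=> lB B0 BB; split => // [m n mn|l l0].
  by rewrite ler_wsqrtr// (lam_nonincreasing normE adjA ES).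
have l2 : 0 < l ^+ 2 by rewrite exprn_gt0.
(* If B^2 u = l^2 u, then w = B u - l u satisfies B w = - l w, and positivity of B forces w = 0. *)
have eigB u : op_eigenspace B l u <-> As (A u) = (l ^+ 2)%:C *: u.
  rewrite -[As (A u)]/((As \o A) u) -BB /op_eigenspace /=; split=> [Bu|Bu].
    by rewrite Bu (linZ lB) Bu scalerA -rmorphM -expr2.
  pose w := B u - l%:C *: u.
  have Bw : B w = - (l%:C *: w).
    rewrite /w (linB lB) (linZ lB) Bu scalerBr opprB scalerA -rmorphM -expr2.
    by [].
  have := B0 w; rewrite Bw dotNl dotZl (dotuu normE) -rmorphM -rmorphN lecR.
  rewrite oppr_ge0 pmulr_rle0// => w2.
  have /nr_eq0 : nr w = 0.
    by apply/eqP; rewrite -sqrf_eq0 eq_le w2 sqr_ge0.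
  by move/eqP; rewrite subr_eq0 => /eqP.
have ltP d : 0 < d -> exists n, s n < d.
  move=> d0; have [|n nd] := lam_cvg0 normE adjA ES cA (d := d ^+ 2).
    by rewrite exprn_gt0.
  by exists n; rewrite -ltr_sqr ?nnegrE ?(ltW d0)// s_sqr.
have s_noninc m n : (m <= n)%N -> s n <= s m.
  by move=> mn; rewrite ler_wsqrtr// (lam_nonincreasing normE adjA ES).
(* The indices with s n = l will be those with a <= n < b. *)
have [a aP amin] : exists2 a, s a <= l & forall n, (n < a)%N -> l < s n.
  have ex : exists n, s n <= l by have [n /ltW] := ltP l l0; exists n.
  case: (ex_minnP ex) => a aP amin; exists a => // n na.
  by rewrite ltNge; apply: contraL na => /amin; rewrite -leqNgt.
have [b bP bmin] : exists2 b, s b < l & forall n, (n < b)%N -> l <= s n.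
  case: (ex_minnP (ltP l l0)) => b bP bmin; exists b => // n nb.
  by rewrite leNgt; apply: contraL nb => /bmin; rewrite -leqNgt.
have ab : (a <= b)%N.
  by rewrite leqNgt; apply/negP => /amin; rewrite ltNge (ltW bP).
have sl n : (a <= n)%N -> (n < b)%N -> s n = l.
  by move=> an nb; apply/eqP; rewrite eq_le bmin// (le_trans _ aP)// s_noninc.
have lamE n : (a <= n)%N -> (n < b)%N -> lam n = l ^+ 2.
  by move=> an nb; rewrite -s_sqr sl.
exists (b - a)%N; split; last first.
  rewrite (_ : [set n | s n = l] = `I_b `\` `I_a) ?card_IID//.
  apply/seteqP; split=> n /=.
    move=> sn; split; first by rewrite ltnNge; apply/negP => /s_noninc; rewrite sn leNgt bP.
    by move=> /amin; rewrite sn ltxx.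
  by move=> [nb /negP]; rewrite -leqNgt => an; exact: sl.
have lt_b (i : 'I_(b - a)) : (a + i < b)%N by rewrite -ltn_subRL.
have un (i : 'I_(b - a)) : nr (e (a + i)) = 1.
  by rewrite (eig_unit ES)// lamE// leq_addr.
have orth (c : 'I_(b - a) -> R[i]) (j : 'I_(b - a)) :
    dot (\sum_i c i *: e (a + i)%N) (e (a + j)%N) = c j.
  rewrite dot_suml (bigD1 j)//= dotZl (dotuu normE) un expr1n mulr1 big1 ?addr0// => i ij.
  by rewrite dotZl (eig_orth ES) ?mulr0// eqn_add2l.
exists (fun i => e (a + i)%N); split=> [c c0 i|].
  by rewrite -(orth c i) c0 dot0l.
apply/seteqP; split=> u /=; last first.
  move=> [c ->]; apply/eigB.
  rewrite (lin_sum lA) (lin_sum (adjoint_linear adjA)) scaler_sumr.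
  apply: eq_bigr => i _; rewrite (linZ lA) (linZ (adjoint_linear adjA)) (eig_eq ES).
  by rewrite lamE ?leq_addr// !scalerA mulrC.
move=> /eigB Tu; exists (fun i => dot u (e (a + i)%N)).
(* u - v satisfies the eigenvalue equation for l^2 and is orthogonal to e i for all i < b: by
   construction if a <= i, by distinct eigenvalues if i < a. Then [eig_bound] at b, where lam b <
   l^2, forces u = v. *)
set v := \sum_i _; apply/eqP; rewrite -subr_eq0; apply/eqP/nr_eq0.
have Tw : As (A (u - v)) = (l ^+ 2)%:C *: (u - v).
  rewrite (linB lA) (linB (adjoint_linear adjA)) Tu scalerBr; congr (_ - _).
  rewrite /v (lin_sum lA) (lin_sum (adjoint_linear adjA)) scaler_sumr.
  apply: eq_bigr => i _; rewrite (linZ lA) (linZ (adjoint_linear adjA)) (eig_eq ES).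
  by rewrite lamE ?leq_addr// !scalerA mulrC.
have := eig_bound ES (n := b) (u := u - v); rewrite (nr_op_sqr normE adjA) Tw dotZl.
rewrite (dotuu normE) -rmorphM /= => H.
apply/eqP; rewrite -sqrf_eq0 eq_le sqr_ge0 andbT.
have lb : lam b < l ^+ 2 by rewrite -s_sqr ltr_sqr ?nnegrE// ltW.
suff : l ^+ 2 * nr (u - v) ^+ 2 <= lam b * nr (u - v) ^+ 2.
  by rewrite -subr_le0 -mulrBl pmulr_rle0// subr_gt0.
apply: H => i ib.
have [ia|ai] := ltnP i a; last first.
  have iE : i = (a + Ordinal (n := b - a) (m := i - a) (ltn_sub2r (leq_ltn_trans ai ib) ib))%N.
    by rewrite /= subnKC.
  by rewrite iE dotBl orth subrr.
have li : l ^+ 2 < lam i by rewrite -s_sqr ltr_sqr ?nnegrE ?(ltW l0)// amin.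
have : (l ^+ 2)%:C * dot (u - v) (e i) = (lam i)%:C * dot (u - v) (e i).
  rewrite -dotZl -Tw (adjoint_sym adjA) adjA (eig_eq ES) dotZr conjc_real.
  by [].
move/eqP; rewrite -subr_eq0 -mulrBl mulf_eq0 => /orP[|/eqP//].
by rewrite -rmorphB /= => /eqP/complexI/eqP; rewrite subr_eq0 lt_eqF.
Qed.

Lemma adjointE : adjoint dot A = As.
Proof.
have : [set B | forall u v, dot (A u) v = dot u (B v)] (adjoint dot A).
  by apply: xgetPex; exists As.
move=> /= H; apply/funext => v; apply: (dot_injr (dot := dot)) => w.
by rewrite -H adjA.
Qed.

Lemma singular_valueE n : nr_complete U ->
  singular_value dot A n.+1 = Num.sqrt (lam n).
Proof.
move=> cU; rewrite /singular_value /=.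
have [lB _ B0 BB] : [set B | [/\ linear B, continuous B,
    forall u, 0 <= dot (B u) u & B \o B = adjoint dot A \o A]] (operator_abs dot A).
  by apply: xgetPex; rewrite adjointE; exact: abs_exists.
rewrite adjointE in BB.
have sE := eigenvalue_sequence_abs lB B0 BB.
have : eigenvalue_sequence (operator_abs dot A) (xget (cst 0) (eigenvalue_sequence (operator_abs dot A))).
  by apply: xgetPex; exists s.
by move/eigenvalue_sequence_unique => /(_ _ sE) ->.
Qed.

End AbsoluteValue.

(** * Singular values of almost orthogonal sums *)

Section EigenCodimension.
Context {R : realType} {U : normedModType R[i]} (dot : {dot U for @Num.conj R[i]}).
Hypothesis normE : forall u : U, `|u| = sqrtC (dot u u).
Variables (A As : U -> U) (e : nat -> U) (lam : nat -> R).
Hypothesis lA : linear A.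
Hypothesis adjA : forall u v, dot (A u) v = dot u (As v).
Hypothesis ES : eigen_system dot A As e lam.

(** With [cod_eig] this is the min-max principle: for s >= 0, [cod A k s] holds exactly when lam k
    <= s^2. *)
Lemma eig_cod k s : 0 <= s -> lam k <= s ^+ 2 -> cod A k s.
Proof.
move=> s0 ls; exists 'I_k, (fun (i : 'I_k) u => dot u (e i)); split; first by rewrite card_ord.
  by move=> i a u v; rewrite dotDl dotZl.
move=> u ue; rewrite -ler_sqr ?nnegrE ?mulr_ge0 ?nr_ge0// exprMn.
apply: le_trans (eig_bound ES (n := k) _) _; last by rewrite ler_wpM2r ?sqr_ge0.
by move=> i ik; have := ue (Ordinal ik).
Qed.

Lemma nr_op_comb k (a : 'I_k -> R[i]) (s : R) : 0 < s ->
  (forall i : 'I_k, s ^+ 2 <= lam i) ->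
  s * nr (\sum_(i < k) a i *: e i) <= nr (A (\sum_(i < k) a i *: e i)).
Proof.
move=> s0 sl; have l0 (i : 'I_k) : 0 < lam i by rewrite (lt_le_trans _ (sl i))// exprn_gt0.
rewrite -ler_sqr ?nnegrE ?mulr_ge0 ?(ltW s0) ?nr_ge0// exprMn.
rewrite (nr_eig_comb normE ES)// (lin_sum lA) (nr_sum_sqr normE); last first.
  by move=> i j ij; rewrite !(linZ lA) dotZl dotZr (dot_op_eig adjA ES) ?mulr0.
rewrite mulr_sumr; apply: ler_sum => i _.
rewrite (linZ lA) nrZ exprMn (nr_op_eig normE adjA ES) (eig_unit ES)// expr1n mulr1 mulrC.
by rewrite ler_wpM2l ?sqr_ge0.
Qed.

(** k linear conditions leave a nonzero combination of e 0, ..., e k, and on it A is bounded below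
    by sqrt (lam k). *)
Lemma cod_eig k s : 0 <= s -> cod A k s -> lam k <= s ^+ 2.
Proof.
move=> s0 [J [f [Jk lf fA]]]; rewrite leNgt; apply/negP => sl.
have l0 (i : 'I_k.+1) : lam k <= lam i.
  by apply: (lam_nonincreasing normE adjA ES); rewrite -ltnS.
have lk0 : 0 < lam k by apply: le_lt_trans sl; rewrite sqr_ge0.
have [|a [[i ai] am]] := @exists_kernel_vector _ 'I_k.+1 J (fun i j => f j (e i)).
  by rewrite card_ord ltnS.
pose u := \sum_(i < k.+1) a i *: e i.
have fu j : f j u = 0 by rewrite /u scalar_sum.
have li (j : 'I_k.+1) : 0 < lam j by apply: lt_le_trans (l0 j).
have u0 : 0 < nr u.
  rewrite lt_def nr_ge0 andbT -sqrf_eq0 (nr_eig_comb normE ES)//.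
  rewrite psumr_neq0 => [|j _]; last exact: sqr_ge0.
  apply/hasP; exists i; rewrite ?mem_index_enum//= exprn_gt0// lt_def cm_ge0 andbT.
  by apply: contra ai => /eqP/cm_eq0 ->.
have := @nr_op_comb k.+1 a (Num.sqrt (lam k)); rewrite sqrtr_gt0 sqr_sqrtr ?(ltW lk0)//.
move=> /(_ lk0 l0); rewrite -/u => /le_trans/(_ (fA u fu)).
by rewrite ler_pM2r// leNgt -ltr_sqr ?nnegrE ?sqrtr_ge0// sqr_sqrtr ?(ltW lk0)// sl.
Qed.

(** x = As (A u) is still orthogonal to the first n eigenvectors, so |A x| <= s |x|; then use |x|^2
    = <A u, A x>. *)
Lemma nr_tail_adjoint n u s : 0 <= s -> lam n <= s ^+ 2 ->
  (forall i, (i < n)%N -> dot u (e i) = 0) -> nr (As (A u)) <= s * nr (A u).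
Proof.
move=> s0 ls ue; set x := As (A u).
have [->|n0] := eqVneq (nr x) 0; first by rewrite mulr_ge0 ?nr_ge0.
have n1 : 0 < nr x by rewrite lt_def n0 nr_ge0.
rewrite -(ler_pM2r n1) -expr2 (nr_sqrE normE) {1}/x (adjoint_sym adjA).
rewrite (le_trans (ler_norm _))// (le_trans (ler_Re_cm _))//.
apply: le_trans (dot_CS normE _ _) _; rewrite mulrAC mulrC ler_wpM2r ?nr_ge0//.
rewrite -ler_sqr ?nnegrE ?mulr_ge0 ?nr_ge0// exprMn.
apply: le_trans (eig_bound ES (n := n) _) _; last by rewrite ler_wpM2r ?sqr_ge0.
by move=> i ik; rewrite /x (adjoint_sym adjA) adjA (eig_eq ES) dotZr ue// mulr0.
Qed.

(** Smallness of B As can be exploited at a combination x of eigenvectors once x is written as As g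
    with |g| controlled by |x|. *)
Lemma eig_comb_preimage k (a : 'I_k -> R[i]) (s : R) : 0 < s ->
  (forall i : 'I_k, s ^+ 2 <= lam i) ->
  let g := \sum_(i < k) a i *: ((lam i)^-1%:C *: A (e i)) in
  As g = \sum_(i < k) a i *: e i /\ s * nr g <= nr (\sum_(i < k) a i *: e i).
Proof.
move=> s0 sl g; have l0 (i : 'I_k) : 0 < lam i by rewrite (lt_le_trans _ (sl i))// exprn_gt0.
have Asg : As g = \sum_(i < k) a i *: e i.
  rewrite /g (lin_sum (adjoint_linear adjA)); apply: eq_bigr => i _.
  rewrite !(linZ (adjoint_linear adjA)) (eig_eq ES); congr (_ *: _).
  by rewrite scalerA -rmorphM mulVf ?gt_eqF// scale1r.
split=> //; rewrite -ler_sqr ?nnegrE ?mulr_ge0 ?(ltW s0) ?nr_ge0// exprMn.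
rewrite (nr_eig_comb normE ES)// (nr_sum_sqr normE); last first.
  by move=> i j ij; rewrite !(dotZl, dotZr) (dot_op_eig adjA ES) ?mulr0.
rewrite mulr_sumr; apply: ler_sum => i _.
rewrite !nrZ !exprMn (nr_op_eig normE adjA ES) (eig_unit ES)// expr1n mulr1.
rewrite cm_real ger0_norm ?invr_ge0 ?(ltW (l0 i))//.
have -> : s ^+ 2 * (cm (a i) ^+ 2 * ((lam i)^-1 ^+ 2 * lam i)) = cm (a i) ^+ 2 * (s ^+ 2 / lam i).
  by field; rewrite gt_eqF.
by rewrite ler_piMr ?sqr_ge0// ler_pdivrMr// mul1r.
Qed.

End EigenCodimension.

Section TwoOperators.
Context {R : realType} {U : normedModType R[i]} (dot : {dot U for @Num.conj R[i]}).
Hypothesis normE : forall u : U, `|u| = sqrtC (dot u u).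
Variables (A As B Bs : U -> U) (e f : nat -> U) (lam kap : nat -> R).
Hypothesis (lA : linear A) (lB : linear B).
Hypothesis adjA : forall u v, dot (A u) v = dot u (As v).
Hypothesis adjB : forall u v, dot (B u) v = dot u (Bs v).
Hypothesis ESA : eigen_system dot A As e lam.
Hypothesis ESB : eigen_system dot B Bs f kap.

Let Re_dot_le u v x y : nr u <= x -> nr v <= y -> `|complex.Re (dot u v)| <= x * y.
Proof.
move=> ux vy; rewrite (le_trans (ler_Re_cm _))// (le_trans (dot_CS normE _ _))//.
by rewrite ler_pM ?nr_ge0.
Qed.

(* With q = As A u + Bs B u, the smallness of A Bs gives
   |q|^2 <= s^2 (|Au|^2 + |Bu|^2) + d^2 |u|^2 <= s^2 |q| |u| + d^2 |u|^2. *)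
Lemma cod_sum_upper (b s d d1 d2 s' : R) k l r1 r2 :
  0 <= s -> 0 <= d -> 0 <= s' ->
  lam k <= s ^+ 2 -> kap l <= s ^+ 2 -> opbound A b ->
  cod (fun u => As (B u)) r1 d1 -> cod (fun u => A (Bs (B u))) r2 d2 ->
  2 * b * d2 <= d ^+ 2 -> s ^+ 2 + d + 2 * d1 <= s' ^+ 2 ->
  cod (fun u => A u + B u) (k + l + (r1 + r2)) s'.
Proof.
move=> s0 d0 s'0 lk kl Ab [J1 [f1 [J1r lf1 f1P]]] [J2 [f2 [J2r lf2 f2P]]] bd sd.
exists ('I_k + 'I_l + (J1 + J2))%type, (fun (x : 'I_k + 'I_l + (J1 + J2)) u => match x with
  | inl (inl i) => dot u (e i) | inl (inr j) => dot u (f j)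
  | inr (inl i) => f1 i u | inr (inr j) => f2 j u end).
split; first by rewrite !card_sum !card_ord !leq_add.
  by move=> [[i|i]|[i|i]] a u v; rewrite ?lf1 ?lf2 ?dotDl ?dotZl.
move=> u H.
have ue i : (i < k)%N -> dot u (e i) = 0 by move=> ik; exact: (H (inl (inl (Ordinal ik)))).
have uf i : (i < l)%N -> dot u (f i) = 0 by move=> ik; exact: (H (inl (inr (Ordinal ik)))).
have k1 := f1P u (fun j => H (inr (inl j))).
have k2 := f2P u (fun j => H (inr (inr j))).
have x1 := nr_tail_adjoint normE adjA ESA s0 lk ue.
have y1 := nr_tail_adjoint normE adjB ESB s0 kl uf.
set n := nr u; have n0 : 0 <= n by exact: nr_ge0.
set X := nr (A u); set Y := nr (B u).
set x := As (A u) in x1; set y := Bs (B u) in y1 k2.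
set Q := nr (x + y); have Q0 : 0 <= Q by exact: nr_ge0.
have xy : `|complex.Re (dot x y)| <= (b * n) * (d2 * n).
  by rewrite /x (adjoint_sym adjA) Re_dot_le.
have QX : X ^+ 2 + Y ^+ 2 <= Q * n.
  have -> : X ^+ 2 + Y ^+ 2 = complex.Re (dot (x + y) u).
    by rewrite dotDl ReD /X /Y (nr_op_sqr normE adjA) (nr_op_sqr normE adjB).
  by apply: le_trans (ler_norm _) _; exact: Re_dot_le.
have Q2 : Q ^+ 2 <= s ^+ 2 * (Q * n) + d ^+ 2 * n ^+ 2.
  have -> : Q ^+ 2 = nr x ^+ 2 + nr y ^+ 2 + 2 * complex.Re (dot x y).
    exact: nrD_sqr.
  have hx : nr x ^+ 2 <= s ^+ 2 * X ^+ 2.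
    by rewrite -exprMn ler_sqr ?nnegrE ?nr_ge0// mulr_ge0 ?nr_ge0.
  have hy : nr y ^+ 2 <= s ^+ 2 * Y ^+ 2.
    by rewrite -exprMn ler_sqr ?nnegrE ?nr_ge0// mulr_ge0 ?nr_ge0.
  have h1 := ler_wpM2l (sqr_ge0 s) QX.
  have h2 := ler_wpM2r (sqr_ge0 n) bd.
  move: xy => /(le_trans (ler_norm _)) xy; lra.
(* Q > (s^2 + d) n would give Q^2 > s^2 Q n + d n Q >= s^2 Q n + d^2 n^2. *)
have Qn : Q <= (s ^+ 2 + d) * n.
  rewrite leNgt; apply/negP => Qn.
  have Qp : 0 < Q by apply: le_lt_trans Qn; rewrite mulr_ge0// addr_ge0 ?sqr_ge0.
  have : (s ^+ 2 + d) * n * Q < Q ^+ 2 by rewrite expr2 ltr_pM2r.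
  have h3 : d * n * ((s ^+ 2 + d) * n) <= d * n * Q.
    by rewrite ler_wpM2l ?mulr_ge0// ltW.
  have h4 : 0 <= d * n * (s ^+ 2 * n) by rewrite !mulr_ge0 ?sqr_ge0.
  move: Q2; lra.
rewrite -ler_sqr ?nnegrE ?mulr_ge0 ?nr_ge0// exprMn (nrD_sqr normE) -/X -/Y -/n.
have zz : `|complex.Re (dot (A u) (B u))| <= n * (d1 * n).
  by rewrite adjA Re_dot_le.
have h5 := ler_wpM2r n0 Qn.
have h6 := ler_wpM2r (sqr_ge0 n) sd.
move: zz => /(le_trans (ler_norm _)) zz; lra.
Qed.

(** Otherwise the span of the first k eigenvectors for A and l for B leaves room for x + y meeting
    all linear conditions. Then B x and A y are negligible, while x, y and also A x, B y are nearly
    orthogonal, so (A + B)(x + y) is too large. The product As B controls <A x, B y>, A Bs controls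
    A y, and B As controls B x. *)
Lemma cod_sum_lower (s t z : R) k l m r1 r2 r3 :
  0 < s -> 0 <= z -> 0 <= t ->
  (forall i, (i < k)%N -> s ^+ 2 <= lam i) -> (forall i, (i < l)%N -> s ^+ 2 <= kap i) ->
  cod (fun u => As (B u)) r1 (z * s ^+ 2) -> cod (fun u => A (Bs u)) r2 (z * s ^+ 2) ->
  cod (fun u => B (As u)) r3 (z * s ^+ 2) ->
  cod (fun u => A u + B u) m t -> t * (1 + z) < s * (1 - 3 * z) ->
  (k + l <= m + (r1 + r2 + r3))%N.
Proof.
move=> s0 z0 t0 sl sk [J1 [f1 [J1r lf1 f1P]]] [J2 [f2 [J2r lf2 f2P]]].
move=> [J3 [f3 [J3r lf3 f3P]]] [J [g [Jm lg gP]]] ts.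
rewrite leqNgt; apply/negP => mkl.
have sl' (i : 'I_k) : s ^+ 2 <= lam i by exact: sl.
have sk' (i : 'I_l) : s ^+ 2 <= kap i by exact: sk.
pose va (i : 'I_k) := (lam i)^-1%:C *: A (e i).
pose vb (i : 'I_l) := (kap i)^-1%:C *: B (f i).
(* Conditions [f1], [f2] concern only the B part and [f3] only the A part; [f2] and [f3] are imposed
   on the preimages of y under [Bs] and of x under [As]. *)
pose M (i : 'I_k + 'I_l) (j : J + (J1 + J2 + J3)) : R[i] := match i, j with
  | inl i, inl j => g j (e i) | inr i, inl j => g j (f i)
  | inl i, inr (inl (inl j)) => 0 | inr i, inr (inl (inl j)) => f1 j (f i)
  | inl i, inr (inl (inr j)) => 0 | inr i, inr (inl (inr j)) => f2 j (vb i)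
  | inl i, inr (inr j) => f3 j (va i) | inr i, inr (inr j) => 0 end.
have [|a [[i0 ai] aM]] := @exists_kernel_vector _ ('I_k + 'I_l)%type _ M.
  by rewrite !card_sum !card_ord (leq_ltn_trans _ mkl)// !leq_add.
pose aa (i : 'I_k) : R[i] := a (inl i); pose ab (i : 'I_l) : R[i] := a (inr i).
pose x := \sum_(i < k) aa i *: e i; pose y := \sum_(i < l) ab i *: f i.
have [xE xg] := eig_comb_preimage normE adjA ESA aa s0 sl'.
have [yE yg] := eig_comb_preimage normE adjB ESB ab s0 sk'.
set ga := \sum_i _ in xE xg; set gb := \sum_i _ in yE yg.
rewrite -/x in xE xg; rewrite -/y in yE yg.
have c0 : forall j, g j (x + y) = 0.
  move=> j; have := aM (inl j); rewrite big_sumType /= => <-.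
  by rewrite scalarD// /x /y scalar_sum// scalar_sum.
have c1 : forall j, f1 j y = 0.
  move=> j; have := aM (inr (inl (inl j))); rewrite big_sumType /= big1 ?add0r => [<-|i _].
    by rewrite /y scalar_sum.
  by rewrite mulr0.
have c2 : forall j, f2 j gb = 0.
  move=> j; have := aM (inr (inl (inr j))); rewrite big_sumType /= big1 ?add0r => [<-|i _].
    by rewrite /gb scalar_sum.
  by rewrite mulr0.
have c3 : forall j, f3 j ga = 0.
  move=> j; have := aM (inr (inr j)); rewrite big_sumType /= [X in _ + X]big1 ?addr0 => [<-|i _].
    by rewrite /ga scalar_sum.
  by rewrite mulr0.
have h0 := gP _ c0; have h1 := f1P _ c1; have h2 := f2P _ c2; have h3 := f3P _ c3.
rewrite yE in h2; rewrite xE in h3.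
set X := nr x in xg h3; set Y := nr y in yg h1.
have X0 : 0 <= X by exact: nr_ge0.
have Y0 : 0 <= Y by exact: nr_ge0.
have Bx : nr (B x) <= z * s * X.
  apply: le_trans h3 _; rewrite expr2 -!mulrA; apply: ler_wpM2l => //.
  by apply: ler_wpM2l => //; exact: ltW.
have Ay : nr (A y) <= z * s * Y.
  apply: le_trans h2 _; rewrite expr2 -!mulrA; apply: ler_wpM2l => //.
  by apply: ler_wpM2l => //; exact: ltW.
have Ax : s * X <= nr (A x) by apply: (nr_op_comb normE lA adjA ESA).
have By : s * Y <= nr (B y) by apply: (nr_op_comb normE lB adjB ESB).
(* x = As ga turns <x, y> into <ga, A y>, and A y is already known to be small. *)
have xy : `|complex.Re (dot x y)| <= z * (X * Y).
  rewrite -xE (adjoint_sym adjA).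
  have -> : z * (X * Y) = (X / s) * (z * s * Y) by field; rewrite gt_eqF.
  by apply: Re_dot_le => //; rewrite ler_pdivlMr// mulrC.
have AxBy : `|complex.Re (dot (A x) (B y))| <= z * s ^+ 2 * (X * Y).
  by rewrite adjA mulrCA Re_dot_le.
(* The e i and f j together are not known to be independent, so positivity is shown for |x|^2 +
   |y|^2, which depends only on the coefficients. *)
pose N2 := X ^+ 2 + Y ^+ 2.
have N2gt : 0 < N2.
  have lX (i : 'I_k) : 0 < lam i by rewrite (lt_le_trans _ (sl' i))// exprn_gt0.
  have lY (i : 'I_l) : 0 < kap i by rewrite (lt_le_trans _ (sk' i))// exprn_gt0.
  have cp i : a i != 0 -> 0 < cm (a i) ^+ 2.
    move=> ai0; rewrite exprn_gt0// lt_def cm_ge0 andbT.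
    by apply: contra ai0 => /eqP/cm_eq0 ->.
  rewrite /N2 /X /Y /x /y (nr_eig_comb normE ESA)// (nr_eig_comb normE ESB)//.
  case: i0 ai => i /cp ai.
    apply: ltr_wpDr; first by rewrite sumr_ge0// => j _; exact: sqr_ge0.
    by rewrite (bigD1 i)//= ltr_wpDr// sumr_ge0// => j _; exact: sqr_ge0.
  apply: ltr_wpDl; first by rewrite sumr_ge0// => j _; exact: sqr_ge0.
  by rewrite (bigD1 i)//= ltr_wpDr// sumr_ge0// => j _; exact: sqr_ge0.
pose N := Num.sqrt N2; have N0 : 0 < N by rewrite sqrtr_gt0.
have NN : N ^+ 2 = N2 by rewrite sqr_sqrtr// ltW.
have XY : 2 * (X * Y) <= N2 by have := sqr_ge0 (X - Y); rewrite sqrrB /N2; lra.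
have XN : X <= N by rewrite -ler_sqr ?nnegrE ?(ltW N0)// NN lerDl sqr_ge0.
have YN : Y <= N by rewrite -ler_sqr ?nnegrE ?(ltW N0)// NN lerDr sqr_ge0.
have XY0 : 0 <= X * Y by rewrite mulr_ge0.
have z3 : 3 * z < 1.
  rewrite -subr_gt0 -(pmulr_rgt0 _ s0); apply: le_lt_trans ts.
  by rewrite mulr_ge0// addr_ge0.
have z1 : 0 <= 1 - z.
  rewrite subr_ge0; apply: le_trans (ltW z3).
  by rewrite -{1}[z]mul1r ler_wpM2r ?ler1n.
have z2 : 1 - z <= 1 by rewrite gerBl.
have sum_lb : (1 - z) * s * N <= nr (A x + B y).
  rewrite -ler_sqr ?nnegrE ?nr_ge0 ?mulr_ge0 ?(ltW s0) ?(ltW N0)//.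
  rewrite !exprMn NN (nrD_sqr normE).
  have hx : s ^+ 2 * X ^+ 2 <= nr (A x) ^+ 2.
    by rewrite -exprMn ler_sqr ?nnegrE ?nr_ge0 ?mulr_ge0 ?(ltW s0).
  have hy : s ^+ 2 * Y ^+ 2 <= nr (B y) ^+ 2.
    by rewrite -exprMn ler_sqr ?nnegrE ?nr_ge0 ?mulr_ge0 ?(ltW s0).
  have zs0 : 0 <= z * s ^+ 2 by rewrite mulr_ge0// sqr_ge0.
  have hz := ler_wpM2l zs0 XY.
  have hn : - (z * s ^+ 2 * (X * Y)) <= complex.Re (dot (A x) (B y)).
    by rewrite lerNl; apply: le_trans (ler_norm _) _; rewrite normrN.
  have : (1 - z) ^+ 2 * s ^+ 2 * N2 <= (1 - z) * s ^+ 2 * N2.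
    by rewrite ler_pM2r// ler_pM2r ?exprn_gt0// expr2 ler_piMr.
  move: hx hy hz hn; rewrite /N2; lra.
have sum_ub : nr (x + y) <= (1 + z) * N.
  rewrite -ler_sqr ?nnegrE ?nr_ge0 ?mulr_ge0 ?(ltW N0) ?addr_ge0//.
  rewrite (nrD_sqr normE) exprMn NN -/X -/Y.
  have hz := ler_wpM2l z0 XY.
  move: xy => /(le_trans (ler_norm _)) xy.
  have : (1 + z) * N2 <= (1 + z) ^+ 2 * N2.
    by rewrite ler_pM2r// expr2 ler_peMr ?addr_ge0// lerDl.
  move: hz xy; rewrite /N2; lra.
have key : nr (A x + B y) <= nr (A (x + y) + B (x + y)) + nr (B x) + nr (A y).
  rewrite (linD lA) (linD lB).
  have -> : A x + B y = (A x + A y + (B x + B y)) - B x - A y.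
    by rewrite [B x + B y]addrC addrA addrK [A x + A y + _]addrAC addrK.
  apply: le_trans (nrB _ _) _; rewrite lerD2r; exact: nrB.
have hs := ler_wpM2l t0 sum_ub.
have zs : 0 <= z * s by rewrite mulr_ge0// ltW.
have hX := ler_wpM2l zs XN; have hY := ler_wpM2l zs YN.
have : s * (1 - 3 * z) * N <= t * (1 + z) * N.
  move: sum_lb key h0 hs Bx Ay hX hY; lra.
by rewrite ler_pM2r// leNgt ts.
Qed.

End TwoOperators.

(** * From counting estimates to bounds on n s_n^p *)

Section CountingAsymptotics.
Context {R : realType}.
Implicit Types (p s x : R) (a b c : nat -> R).

Lemma powR_invK p x : 0 < p -> 0 <= x -> (x `^ p^-1) `^ p = x.
Proof. by move=> p0 x0; rewrite -powRrM mulVf ?gt_eqF// powRr1. Qed.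

Lemma powR_lt_inv p x s : 0 < p -> 0 <= s -> s `^ p < x `^ p -> 0 <= x -> s < x.
Proof.
move=> p0 s0 sx x0; rewrite ltNge; apply: contraL sx => xs; rewrite -leNgt.
by rewrite ge0_ler_powR ?nnegrE ?(ltW p0).
Qed.

(** M of order s^(-4/q) brings M^-q down to the order of s^4, and a codimension of that order is
    o(s^-p) because 4/q < p. *)
Lemma small_count q (U V : normedModType R[i]) (K : U -> V) p :
  0 < p -> 4 < q%:R * p -> small q K ->
  forall z d, 0 < z -> 0 < d -> exists s0, 0 < s0 /\ forall s, 0 < s -> s < s0 ->
    exists r, cod K r (z * s ^+ 4) /\ r%:R * s `^ p <= d.
Proof.
move=> p0 qp [c cK] z d z0 d0.
have q0 : (0 < q)%N by case: q qp {cK} => //; rewrite mul0r ltrn0.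
have q0' : 0 < q%:R :> R by rewrite ltr0n.
(* With c <= z C and 1 <= C <= C^q one gets c / (C y)^q <= z s^4 for y = s^(-4/q). *)
pose C := c%:R / z + 1; have C1 : 1 <= C by rewrite lerDr divr_ge0// ltW.
have C0 : 0 < C by exact: lt_le_trans C1.
pose al : R := 4 / q%:R.
have al0 : 0 <= al by rewrite divr_ge0.
have alp : 0 < p - al by rewrite subr_gt0 ltr_pdivrMr// mulrC.
pose D := c%:R * (C + 1) + 1.
have D0 : 0 < D by rewrite ltr_wpDl// mulr_ge0// addr_ge0// ltW.
exists (Num.min 1 ((d / D) `^ (p - al)^-1)); split.
  by rewrite lt_min ltr01 powR_gt0// divr_gt0.
move=> s s0; rewrite lt_min => /andP[s1 sd].
have sd' : s `^ (p - al) <= d / D.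
  rewrite -[leRHS](powR_invK alp) ?divr_ge0 ?(ltW d0) ?(ltW D0)//.
  by rewrite ge0_ler_powR ?nnegrE ?powR_ge0 ?(ltW alp) ?(ltW s0) ?(ltW sd).
pose y := s `^ (- al); have y1 : 1 <= y.
  rewrite /y powRN invf_ge1 ?powR_gt0//.
  by have := ge0_ler_powR al0 (ltW s0 : s \in Num.nneg) (ler01 : 1 \in Num.nneg) (ltW s1); rewrite powR1.
have y0 : 0 < y by exact: lt_le_trans y1.
exists (c * (Num.truncn (C * y)).+1)%N; split.
  apply: cod_mono (cK _) (leqnn _) _.
  rewrite ler_pdivrMr ?exprn_gt0//.
  have xM : (C * y) ^+ q <= (Num.truncn (C * y)).+1%:R ^+ q.
    by rewrite lerXn2r ?nnegrE ?mulr_ge0 ?(ltW C0) ?(ltW y0)// ltW// truncnS_gt.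
  have yq : y ^+ q = (s ^+ 4)^-1.
    rewrite -powR_mulrn ?(ltW y0)// -powRrM mulNr divfK ?gt_eqF// powRN.
    by rewrite powR_mulrn// ltW.
  have Cq : C <= C ^+ q by rewrite ler_eXnr.
  apply: le_trans (ler_wpM2l _ xM); last by rewrite mulr_ge0 ?exprn_ge0 ?ltW.
  rewrite exprMn yq (_ : z * s ^+ 4 * _ = z * C ^+ q); last first.
    by field; rewrite gt_eqF.
  apply: le_trans (ler_wpM2l _ Cq); last exact: ltW.
  by rewrite /C mulrDr mulrCA mulfV ?gt_eqF// mulr1 lerDl mulr1 ltW.
rewrite natrM -mulrA.
have tr : (Num.truncn (C * y)).+1%:R <= (C + 1) * y.
  have -> : (C + 1) * y = C * y + y by ring.
  rewrite -natr1; apply: lerD => //.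
  by rewrite truncn_le mulr_ge0 ?(ltW C0) ?(ltW y0).
have sp : y * s `^ p = s `^ (p - al).
  rewrite addrC powRD ?(gt_eqF s0) ?implybT//.
apply: le_trans (_ : c%:R * ((C + 1) * (d / D)) <= _).
  rewrite ler_wpM2l//; apply: le_trans (ler_wpM2r (powR_ge0 _ _) tr) _.
  by rewrite -mulrA sp ler_wpM2l// addr_ge0// ltW.
rewrite mulrA mulrCA ler_piMr ?(ltW d0)// ler_pdivrMr// mul1r /D lerDl//.
Qed.

(** For a nonincreasing sequence, a k <= s says that at most k terms exceed s. In terms of counting
    functions n this is n(s (1 + d); c) <= n(s; a) + n(s; b) + o(s^-p). *)
Definition upper_count p a b c := forall d, 0 < d -> d < 1 ->
  exists s0, 0 < s0 /\ forall s, 0 < s -> s < s0 -> exists r : nat, r%:R * s `^ p <= d /\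
    forall k l, a k <= s -> b l <= s -> c (k + l + r)%N <= s * (1 + d).

(** The reverse estimate, with the loss factors of [cod_sum_lower]; d < 1/4 keeps 1 - 3 d
    positive. *)
Definition lower_count p a b c := forall d, 0 < d -> d < 4^-1 ->
  exists s0, 0 < s0 /\ forall s, 0 < s -> s < s0 -> exists r : nat, r%:R * s `^ p <= d /\
    forall k l m, (forall i, (i < k)%N -> s <= a i) -> (forall i, (i < l)%N -> s <= b i) ->
      c m * (1 + d) < s * (1 - 3 * d) -> (k + l <= m + r)%N.

(* Given N, the threshold s is determined by s^p = sig / (N + 1). *)
Let threshold p sig tau : 0 < p -> 0 < sig -> 0 < tau ->
  exists N0 : nat, forall N, (N0 <= N)%N ->
    exists s, [/\ 0 < s, s `^ p = sig / N.+1%:R & s `^ p < tau].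
Proof.
move=> p0 sig0 tau0; exists (Num.truncn (sig / tau)) => N NN.
have x0 : 0 < sig / N.+1%:R by rewrite divr_gt0.
exists ((sig / N.+1%:R) `^ p^-1); rewrite powR_invK ?(ltW x0)//; split => //.
  exact: powR_gt0.
rewrite ltr_pdivrMr// mulrC -ltr_pdivrMr//.
by apply: lt_le_trans (truncnS_gt _) _; rewrite ler_nat ltnS.
Qed.

Lemma upper_count_asymp p a b c al be ga : 0 < p -> nonincreasing_seq c ->
  (forall n, 0 <= a n) -> (forall n, 0 <= b n) -> (forall n, 0 <= c n) ->
  upper_count p a b c -> 0 <= al -> 0 <= be ->
  (exists n0, forall n, (n0 <= n)%N -> n.+1%:R * a n `^ p <= al) ->
  (exists n0, forall n, (n0 <= n)%N -> n.+1%:R * b n `^ p <= be) ->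
  al + be < ga ->
  exists n0, forall n, (n0 <= n)%N -> n.+1%:R * c n `^ p <= ga.
Proof.
move=> p0 ci a0 b0 c0 H al0 be0 [n0 an0] [n1 bn1] abg.
(* S gives (al + be + h)(1 + h) <= al + be + h S for 0 < h <= 1; the bound reached at the end is sig
   (1 + d)^p with sig <= al + be + h. *)
pose S := al + be + 2; have S0 : 0 < S by rewrite ltr_wpDl// addr_ge0.
pose h := Num.min 1 ((ga - (al + be)) / S).
have h0 : 0 < h by rewrite lt_min ltr01 divr_gt0// subr_gt0.
have h1 : h <= 1 by rewrite ge_min lexx.
have hS : h * S <= ga - (al + be) by rewrite -ler_pdivlMr// ge_min lexx orbT.
have hg : (al + be + h) * (1 + h) <= ga.
  have : h * h <= h by rewrite ler_piMr// ltW.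
  by move: hS; rewrite /S; lra.
pose w := (1 + h) `^ p^-1; have w1 : 1 < w.
  have := gt0_ltr_powR (r := p^-1) _ (x := 1) (y := 1 + h).
  rewrite powR1; apply; rewrite ?invr_gt0 ?nnegrE ?ltrDl//.
  by rewrite addr_ge0// ltW.
pose d := Num.min 2^-1 (Num.min (h / 4) (w - 1)).
have d0 : 0 < d by rewrite !lt_min !divr_gt0// subr_gt0 w1 invr_gt0 ltr0n.
have d1 : d < 1 by rewrite gt_min invf_lt1 ?ltr1n// ltr0n.
have d4 : 4 * d <= h by rewrite mulrC -ler_pdivlMr// !ge_min lexx orbT.
have dw : (1 + d) `^ p <= 1 + h.
  have dw : 1 + d <= w by rewrite -lerBrDl !ge_min lexx !orbT.
  rewrite -[leRHS](powR_invK p0) ?addr_ge0 ?(ltW h0)//.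
  by rewrite ge0_ler_powR ?nnegrE ?(ltW p0) ?powR_ge0 ?addr_ge0 ?(ltW d0).
have [s0 [s00 Hs]] := H d d0 d1.
pose sig := al + be + 4 * d.
have sig0 : 0 < sig by rewrite ltr_wpDl ?addr_ge0 ?mulr_gt0.
pose n2 := (n0 + n1 + 1)%N.
pose tau := Num.min (s0 `^ p) (d / n2%:R).
have n20 : 0 < n2%:R :> R by rewrite ltr0n /n2 addn1.
have tau0 : 0 < tau by rewrite lt_min powR_gt0// divr_gt0.
have [N0 N0P] := threshold p0 sig0 tau0; exists N0 => N NN.
have [s [sgt sP]] := N0P N NN; rewrite lt_min => /andP[ss0 sn2].
have {}ss0 : s < s0 by apply: powR_lt_inv ss0 _; rewrite ?(ltW sgt) ?(ltW s00).
have [r [rP Hr]] := Hs s sgt ss0.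
set P := s `^ p in sP sn2 rP; have P0 : 0 < P by exact: powR_gt0.
have n2P : n2%:R * P <= d by rewrite mulrC -ler_pdivlMr// ltW.
(* k is an index at which x has fallen to s. The estimate on x starts at m only, hence the extra m
   in k, which costs m P. *)
have pick (x : nat -> R) (A : R) (m : nat) : (forall n, 0 <= x n) -> 0 <= A ->
    (forall n, (m <= n)%N -> n.+1%:R * x n `^ p <= A) ->
    exists k : nat, x k <= s /\ k%:R * P <= A + m%:R * P.
  move=> x0 A0 xA; exists (Num.truncn (A / P) + m)%N; set k := (_ + m)%N; split.
    rewrite leNgt; apply/negP => sx.
    have := xA k (leq_addl _ _); apply/negP; rewrite -ltNge.
    have : A < k.+1%:R * P.
      rewrite -ltr_pdivrMr//; apply: lt_le_trans (truncnS_gt _) _.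
      by rewrite ler_nat ltnS leq_addr.
    move=> /lt_le_trans; apply; rewrite ler_wpM2l//.
    by rewrite ge0_ler_powR ?nnegrE ?(ltW p0) ?(ltW sgt) ?(ltW sx).
  rewrite /k natrD mulrDl lerD2r -ler_pdivlMr// truncn_le//.
  by rewrite divr_ge0// ltW.
have [k [ak kP]] := pick a al n0 a0 al0 an0.
have [l [bl lP]] := pick b be n1 b0 be0 bn1.
(* (N + 1) P = sig exceeds al + be by 4 d, which absorbs r P, n0 P and n1 P. *)
have klN : (k + l + r <= N)%N.
  rewrite -ltnS -(ltr_nat R) -(ltr_pM2r P0).
  have -> : N.+1%:R * P = sig by rewrite sP mulrCA mulfV ?mulr1// pnatr_eq0.
  move: n2P; rewrite /sig !natrD !mulrDl mul1r; lra.
have := Hr k l ak bl; move/(le_trans (ci _ _ klN)) => cN.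
have cp : c N `^ p <= P * (1 + d) `^ p.
  rewrite -powRM ?addr_ge0 ?(ltW d0) ?(ltW sgt)//.
  by rewrite ge0_ler_powR ?nnegrE ?(ltW p0)// mulr_ge0 ?addr_ge0 ?ltW.
apply: le_trans (ler_wpM2l _ cp) _ => //.
have -> : N.+1%:R * (P * (1 + d) `^ p) = sig * (1 + d) `^ p.
  by rewrite mulrA sP [N.+1%:R * _]mulrCA mulfV ?mulr1// pnatr_eq0.
apply: le_trans hg; apply: ler_pM => //; rewrite ?powR_ge0 ?(ltW sig0)//.
by rewrite /sig lerD2l.
Qed.

Lemma lower_count_asymp p a b c al be ga : 0 < p ->
  nonincreasing_seq a -> nonincreasing_seq b ->
  (forall n, 0 <= a n) -> (forall n, 0 <= b n) -> (forall n, 0 <= c n) ->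
  lower_count p a b c -> 0 <= al -> 0 <= be ->
  (exists n0, forall n, (n0 <= n)%N -> al <= n.+1%:R * a n `^ p) ->
  (exists n0, forall n, (n0 <= n)%N -> be <= n.+1%:R * b n `^ p) ->
  ga < al + be ->
  exists n0, forall n, (n0 <= n)%N -> ga <= n.+1%:R * c n `^ p.
Proof.
move=> p0 ai bi a0 b0 c0 H al0 be0 [n0 an0] [n1 bn1] abg.
have [g0|g0] := lerP ga 0.
  by exists 0%N => n _; rewrite (le_trans g0)// mulr_ge0 ?powR_ge0.
(* Part of the gap up to al + be pays for the ratio of levels (from ga to g'), the rest for the
   error in the count (from g' to sig and beyond). *)
pose g' := (ga + (al + be)) / 2.
have gg' : ga < g' by rewrite /g' midf_lt.
have g'0 : 0 < g' by exact: lt_trans gg'.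
pose w := (g' / ga) `^ p^-1; have w1 : 1 < w.
  have := gt0_ltr_powR (r := p^-1) _ (x := 1) (y := g' / ga).
  rewrite powR1; apply; rewrite ?invr_gt0 ?nnegrE//; last by rewrite ltr_pdivlMr ?mul1r.
  by rewrite divr_ge0// ltW.
(* The last term of the minimum yields 1 + d < w (1 - 3 d), the middle one sig >= g'. *)
pose d := Num.min 8^-1 (Num.min ((al + be - ga) / 8) ((w - 1) / (2 * (1 + 3 * w)))).
have w3 : 0 < 2 * (1 + 3 * w) by lra.
have d0 : 0 < d.
  by rewrite !lt_min !divr_gt0// ?subr_gt0// invr_gt0 ltr0n.
have d4 : d < 4^-1 by rewrite gt_min ltf_pV2 ?posrE ?ltr_nat ?ltr0n.
have d8 : 8 * d <= al + be - ga by rewrite mulrC -ler_pdivlMr// !ge_min lexx orbT.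
have dw : d * (2 * (1 + 3 * w)) <= w - 1 by rewrite -ler_pdivlMr// !ge_min lexx !orbT.
have [s0 [s00 Hs]] := H d d0 d4.
pose sig := al + be - 4 * d.
have sigg : g' <= sig by rewrite /sig /g'; lra.
have sig0 : 0 < sig by exact: lt_le_trans sigg.
pose n2 := (n0 + n1 + 1)%N.
pose tau := Num.min (s0 `^ p) (d / n2%:R).
have n20 : 0 < n2%:R :> R by rewrite ltr0n /n2 addn1.
have tau0 : 0 < tau by rewrite lt_min powR_gt0// divr_gt0.
have [N0 N0P] := threshold p0 sig0 tau0; exists N0 => N NN.
have [s [sgt sP]] := N0P N NN; rewrite lt_min => /andP[ss0 sn2].
have {}ss0 : s < s0 by apply: powR_lt_inv ss0 _; rewrite ?(ltW sgt) ?(ltW s00).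
have [r [rP Hr]] := Hs s sgt ss0.
set P := s `^ p in sP sn2 rP; have P0 : 0 < P by exact: powR_gt0.
have n2P : n2%:R * P <= d by rewrite mulrC -ler_pdivlMr// ltW.
rewrite leNgt; apply/negP => cg.
(* k is the largest integer with k P <= A, replaced by 0 when it is at most m, where the estimate on
   x may not apply. *)
have pick (x : nat -> R) (A : R) (m : nat) : nonincreasing_seq x ->
    (forall n, 0 <= x n) -> 0 <= A ->
    (forall n, (m <= n)%N -> A <= n.+1%:R * x n `^ p) ->
    exists k : nat, (forall i, (i < k)%N -> s <= x i) /\ A < (k + m + 1)%:R * P.
  move=> xi x0 A0 xA; have [mA|Am] := ltnP m (Num.truncn (A / P)); last first.
    exists 0%N; split => //; rewrite -ltr_pdivrMr//.
    by apply: lt_le_trans (truncnS_gt _) _; rewrite ler_nat addn1 add0n ltnS.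
  exists (Num.truncn (A / P)); split; last first.
    rewrite -ltr_pdivrMr//; apply: lt_le_trans (truncnS_gt _) _.
    by rewrite ler_nat addn1 ltnS leq_addr.
  move: mA; case E : (Num.truncn (A / P)) => [//|k] mk i ik.
  apply: le_trans (xi i k _); last by rewrite -ltnS.
  have kA : k.+1%:R * P <= A.
    by rewrite -ler_pdivlMr// -E truncn_le// divr_ge0// ltW.
  have := le_trans kA (xA k mk); rewrite ler_pM2l ?ltr0n// => Px.
  rewrite leNgt; apply/negP => xs; move: Px; apply/negP; rewrite -ltNge.
  by rewrite gt0_ltr_powR ?nnegrE// ltW.
have [k [ak kP]] := pick a al n0 ai a0 al0 an0.
have [l [bl lP]] := pick b be n1 bi b0 be0 bn1.
have NP : N.+1%:R * P = sig by rewrite sP mulrCA mulfV ?mulr1// pnatr_eq0.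
have : (k + l <= N + r)%N.
  apply: (Hr k l N ak bl).
  pose t := (ga / N.+1%:R) `^ p^-1; have t0 : 0 < t by rewrite powR_gt0 ?divr_gt0.
  have tp : t `^ p = ga / N.+1%:R by rewrite powR_invK// divr_ge0// ltW.
  have ct : c N <= t.
    apply/ltW/(powR_lt_inv p0); rewrite ?(ltW t0)// tp ltr_pdivlMr// mulrC //.
  have wt : t * w <= s.
    rewrite leNgt; apply/negP => stw.
    have := gt0_ltr_powR p0 (ltW sgt : s \in Num.nneg) (_ : t * w \in Num.nneg) stw.
    rewrite nnegrE mulr_ge0 ?powR_ge0// => /(_ isT); apply/negP; rewrite -leNgt.
    rewrite (_ : s `^ p = sig / N.+1%:R); last exact: sP.
    rewrite powRM ?powR_ge0// tp powR_invK//; last exact: divr_ge0 (ltW g'0) (ltW g0).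
    by rewrite mulrC mulrA divfK ?gt_eqF// ler_pM2r ?invr_gt0 ?ltr0n.
  have d3 : 0 < 1 - 3 * d by lra.
  have h1 : c N * (1 + d) <= t * (1 + d) by rewrite ler_wpM2r// addr_ge0// ltW.
  have h2 : t * (1 + d) < t * (w * (1 - 3 * d)).
    rewrite ltr_pM2l//; nra.
  have h3 : t * w * (1 - 3 * d) <= s * (1 - 3 * d) by rewrite ler_wpM2r// ltW.
  by move: h1 h2 h3; rewrite mulrA; lra.
(* Multiplied by P, k + l <= N + r gives al + be <= sig + 2 d, against sig = al + be - 4 d. *)
rewrite -(ler_nat R) -(ler_pM2r P0) => klN.
move: n2P klN kP lP NP; rewrite -[N.+1]addn1 /sig !natrD !mulrDl !mul1r; lra.
Qed.

End CountingAsymptotics.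

(** The sum of the two compact closures is compact, hence closed, and contains the image of the unit
    ball. *)
Lemma compact_operator_add (R : realType) (U : normedModType R[i]) (A B : U -> U) :
  compact_operator A -> compact_operator B -> compact_operator (fun u => A u + B u).
Proof.
move=> cA cB; pose KA := closure (A @` [set u : U | `|u| <= 1]).
pose KB := closure (B @` [set u : U | `|u| <= 1]).
pose K := (fun z : U * U => z.1 + z.2) @` (KA `*` KB).
have cK : compact K.
  apply: continuous_compact; last exact: compact_setX.
  by apply: continuous_subspaceT; exact: add_continuous.
apply: (subclosed_compact _ cK); first exact: closed_closure.
have clK : closed K by apply: compact_closed => //; exact: norm_hausdorff.
apply: (@subset_trans _ (closure K)); last by rewrite -((closure_id K).1 clK).
apply: closure_subset => _ [u u1 <-]; exists (A u, B u) => //.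
by split; apply: subset_closure; exists u.
Qed.

(** * Upper and lower limits in the extended reals *)

Section LimSupInf.
Context {R : realType}.
Implicit Types u : nat -> \bar R.
Local Open Scope ereal_scope.

Lemma limn_esup_lt u x : limn_esup u < x ->
  exists N : nat, forall n, (N <= n)%N -> u n < x.
Proof.
move=> /ereal_inf_lt[_ [V [N _ NV] <-] Vx]; exists N => n Nn.
by apply: le_lt_trans Vx; apply: ereal_sup_ubound; exists n => //; exact: NV.
Qed.

Lemma limn_esup_le u x : (exists N : nat, forall n, (N <= n)%N -> u n <= x) ->
  limn_esup u <= x.
Proof.
move=> [N Nu]; apply: ge_ereal_inf; exists (ereal_sup (u @` [set n | (N <= n)%N])).
  by exists [set n | (N <= n)%N] => //; exists N.
by apply: ge_ereal_sup => _ [n Nn <-]; exact: Nu.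
Qed.

Lemma limn_einf_gt u x : x < limn_einf u ->
  exists N : nat, forall n, (N <= n)%N -> x < u n.
Proof.
rewrite /limn_einf lteNr => /limn_esup_lt[N Nu]; exists N => n /Nu.
by rewrite lteN2.
Qed.

Lemma limn_einf_ge u x : (exists N : nat, forall n, (N <= n)%N -> x <= u n) ->
  x <= limn_einf u.
Proof.
move=> [N Nu]; rewrite /limn_einf leeNr; apply: limn_esup_le; exists N => n /Nu.
by rewrite leeN2.
Qed.

Lemma limn_esup_ge0 u : (forall n, 0 <= u n) -> 0 <= limn_esup u.
Proof.
by move=> u0; apply: limf_esup_ge0.
Qed.

Lemma limn_einf_ge0 u : (forall n, 0 <= u n) -> 0 <= limn_einf u.
Proof. by move=> u0; apply: limn_einf_ge; exists 0%N. Qed.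

End LimSupInf.

Section SequenceLimits.
Context {R : realType}.
Implicit Types a b c : nat -> R.

Definition scaled_seq (p : R) (a : nat -> R) (n : nat) : \bar R := (n%:R * a n `^ p)%:E.

Let scaled_ge0 p a n : (0 <= scaled_seq p a n)%E.
Proof. by rewrite lee_fin mulr_ge0 ?powR_ge0. Qed.

(** Singular values are indexed from 1, so the hypotheses concern the shifted sequences, and the
    weight n.+1 of the counting lemmas matches [scaled_seq]. *)
Lemma scaled_limsup p a b c : 0 < p ->
  nonincreasing_seq (fun n => c n.+1) ->
  (forall n, 0 <= a n) -> (forall n, 0 <= b n) -> (forall n, 0 <= c n) ->
  upper_count p (fun n => a n.+1) (fun n => b n.+1) (fun n => c n.+1) ->
  (limn_esup (scaled_seq p c) <= limn_esup (scaled_seq p a) + limn_esup (scaled_seq p b))%E.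
Proof.
move=> p0 ci a0 b0 c0 H.
have sa := limn_esup_ge0 (scaled_ge0 p a); have sb := limn_esup_ge0 (scaled_ge0 p b).
have ev x (e : R) (f : nat -> R) : 0 < e -> limn_esup (scaled_seq p f) = x%:E ->
    exists n0, forall n, (n0 <= n)%N -> n.+1%:R * f n.+1 `^ p <= x + e.
  move=> e0 fx; have [|N NP] := @limn_esup_lt _ (scaled_seq p f) (x + e)%:E.
    by rewrite fx lte_fin ltrDl.
  by exists N => n Nn; apply: ltW; rewrite -lte_fin; exact: NP n.+1 (leq_trans Nn _).
move: sa sb; case Ea : (limn_esup (scaled_seq p a)) => [x| |]//; last first.
  by move=> _; case: (limn_esup (scaled_seq p b)) => // *; rewrite leey.
case Eb : (limn_esup (scaled_seq p b)) => [y| |] //; last by move=> _ _; rewrite addey// leey.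
rewrite !lee_fin => x0 y0; apply/lee_addgt0Pr => e e0.
have e3 : 0 < e / 3 by rewrite divr_gt0.
have xe : 0 <= x + e / 3 by rewrite addr_ge0// ltW.
have ye : 0 <= y + e / 3 by rewrite addr_ge0// ltW.
have xye : x + e / 3 + (y + e / 3) < x + y + e by lra.
have [n0 NP] := upper_count_asymp p0 ci (fun n => a0 n.+1) (fun n => b0 n.+1)
  (fun n => c0 n.+1) H xe ye (ev _ _ _ e3 Ea) (ev _ _ _ e3 Eb) xye.
rewrite -!EFinD; apply: limn_esup_le; exists n0.+1 => -[//|n] nN.
by rewrite lee_fin; exact: NP.
Qed.

Lemma scaled_liminf p a b c : 0 < p ->
  nonincreasing_seq (fun n => a n.+1) -> nonincreasing_seq (fun n => b n.+1) ->
  (forall n, 0 <= a n) -> (forall n, 0 <= b n) -> (forall n, 0 <= c n) ->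
  lower_count p (fun n => a n.+1) (fun n => b n.+1) (fun n => c n.+1) ->
  (limn_einf (scaled_seq p a) + limn_einf (scaled_seq p b) <= limn_einf (scaled_seq p c))%E.
Proof.
move=> p0 ai bi a0 b0 c0 H.
have sa := limn_einf_ge0 (scaled_ge0 p a); have sb := limn_einf_ge0 (scaled_ge0 p b).
(* A usable lower bound is either strictly below the lower limit or 0: a vanishing lower limit has
   no smaller nonnegative number. *)
have ev x (f : nat -> R) : x = 0 \/ (x%:E < limn_einf (scaled_seq p f))%E ->
    exists n0, forall n, (n0 <= n)%N -> x <= n.+1%:R * f n.+1 `^ p.
  move=> [->|/limn_einf_gt[N NP]].
    by exists 0%N => n _; rewrite mulr_ge0 ?powR_ge0.
  by exists N => n Nn; apply: ltW; rewrite -lte_fin; exact: NP n.+1 (leq_trans Nn _).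
have main al be ga : 0 <= al -> 0 <= be ->
    al = 0 \/ (al%:E < limn_einf (scaled_seq p a))%E ->
    be = 0 \/ (be%:E < limn_einf (scaled_seq p b))%E -> ga < al + be ->
    (ga%:E <= limn_einf (scaled_seq p c))%E.
  move=> al0 be0 /ev ea /ev eb gab.
  have [n0 NP] := lower_count_asymp p0 ai bi (fun n => a0 n.+1) (fun n => b0 n.+1) (fun n => c0 n.+1) H al0 be0 ea eb gab.
  apply: limn_einf_ge; exists n0.+1 => -[//|n] nN.
  by rewrite lee_fin; exact: NP.
have sc := limn_einf_ge0 (scaled_ge0 p c).
move: main sc; case: (limn_einf (scaled_seq p c)) => [z| |] main sc //; last by rewrite leey.
move: sc.
rewrite lee_fin => z0.
have lez al be : 0 <= al -> 0 <= be ->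
    al = 0 \/ (al%:E < limn_einf (scaled_seq p a))%E ->
    be = 0 \/ (be%:E < limn_einf (scaled_seq p b))%E -> al + be <= z.
  move=> al0 be0 ha hb; rewrite leNgt; apply/negP => zab.
  have := main al be ((z + (al + be)) / 2) al0 be0 ha hb; rewrite midf_lt// lee_fin.
  by move/(_ isT); rewrite leNgt midf_lt.
(* An infinite lower limit on the left would make z + 1 an admissible bound, against [lez]. *)
move: sa sb lez; case: (limn_einf (scaled_seq p a)) => [x| |]//; last first.
  move=> _ _ /(_ (z + 1) 0 (addr_ge0 z0 ler01) (lexx _)).
  by rewrite ltry addr0 => /(_ (or_intror isT) (or_introl erefl)); rewrite leNgt ltrDl ltr01.
case: (limn_einf (scaled_seq p b)) => [y| |]//; last first.
  move=> _ _ /(_ 0 (z + 1) (lexx _) (addr_ge0 z0 ler01)).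
  by rewrite ltry add0r => /(_ (or_introl erefl) (or_intror isT)); rewrite leNgt ltrDl ltr01.
rewrite !lee_fin => x0 y0 lez; apply/ler_addgt0Pr => e e0.
have pick w : 0 <= w -> exists2 v, 0 <= v /\ (v = 0 \/ (v%:E < w%:E)%E) & w <= v + e / 2.
  move=> w0; have [we|ew] := lerP w (e / 2); first by exists 0; rewrite ?add0r//; split => //; left.
  exists (w - e / 2); last by rewrite subrK.
  split; first by rewrite subr_ge0 ltW.
  by right; rewrite lte_fin gtrBl divr_gt0.
have [v [v0 hv] wv] := pick x x0; have [v' [v'0 hv'] wv'] := pick y y0.
have := lez v v' v0 v'0 hv hv'; lra.
Qed.

End SequenceLimits.

Section CompactOperatorSums.
Context {R : realType} {U : normedModType R[i]} (dot : {dot U for @Num.conj R[i]}).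
Hypothesis normE : forall u : U, `|u| = sqrtC (dot u u).
Hypothesis cU : nr_complete U.
Implicit Types A B : U -> U.

Definition compact_adj A As :=
  [/\ linear A, forall u v, dot (A u) v = dot u (As v) & compact_operator A].

Lemma compact_adj_add A As B Bs : compact_adj A As -> compact_adj B Bs ->
  compact_adj (fun u => A u + B u) (fun u => As u + Bs u).
Proof.
move=> [lA aA cA] [lB aB cB]; split; last exact: compact_operator_add.
  by move=> a u v; rewrite lA lB scalerDr addrACA.
by move=> u v; rewrite dotDl dotDr aA aB.
Qed.

Lemma singular_value_eig A As : compact_adj A As -> exists e lam,
  eigen_system dot A As e lam /\ forall n, singular_value dot A n.+1 = Num.sqrt (lam n).
Proof.
move=> [lA aA cA]; have [e [lam ES]] := eigen_system_exists normE lA aA cA.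
by exists e, lam; split => // n; exact: (singular_valueE normE lA aA cA ES).
Qed.

Lemma singular_value_ge0 A As n : compact_adj A As -> 0 <= singular_value dot A n.
Proof.
move=> cA; have [e [lam [ES svE]]] := singular_value_eig cA.
have svE' k : singular_value dot A k.+1 = singular_value dot A k.+1 by [].
by case: n => [|n]; [rewrite -[singular_value _ _ _]/(singular_value dot A 1)|]; rewrite svE sqrtr_ge0.
Qed.

Lemma singular_value_nonincreasing A As : compact_adj A As ->
  nonincreasing_seq (fun n => singular_value dot A n.+1).
Proof.
move=> cA; have [e [lam [ES svE]]] := singular_value_eig cA; have [lA aA _] := cA.
move=> m n mn; rewrite !svE ler_wsqrtr//.
exact: (lam_nonincreasing normE aA ES).
Qed.

Variables (q : nat) (p : R).
Hypothesis p0 : 0 < p.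
Hypothesis qp : 4 < q%:R * p.

Let pow4_le2 (s : R) : 0 < s -> s < 1 -> s ^+ 4 <= s ^+ 2.
Proof.
move=> s0 s1; rewrite (_ : s ^+ 4 = s ^+ 2 * s ^+ 2); last by rewrite -exprD.
by rewrite ler_piMr ?sqr_ge0// expr_le1 ?ltW.
Qed.

Lemma singular_value_upper_count A As B Bs : compact_adj A As -> compact_adj B Bs ->
  small q (fun u => As (B u)) -> small q (fun u => A (Bs u)) ->
  upper_count p (fun n => singular_value dot A n.+1) (fun n => singular_value dot B n.+1)
    (fun n => singular_value dot (fun u => A u + B u) n.+1).
Proof.
move=> hA hB sAB sBA d d0 d1.
have [e [lam [ESA svA]]] := singular_value_eig hA.
have [f [kap [ESB svB]]] := singular_value_eig hB.
have hC := compact_adj_add hA hB.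
have [g [mu [ESC svC]]] := singular_value_eig hC.
have [lA aA cA] := hA; have [lB aB cB] := hB; have [lC aC _] := hC.
have [b b0 Ab] := compact_operator_bounded lA cA.
have [b' b'0 Bb] := compact_operator_bounded lB cB.
have sABB : small q (fun u => A (Bs (B u))) by exact: small_compr lB Bb sBA.
(* This z ensures 2 b z s^4 <= (d s^2)^2 and s^2 + d s^2 + 2 z s^4 <= (s (1 + d))^2, the two
   conditions of [cod_sum_upper] with its d equal to d s^2. *)
pose z := Num.min (d / 2) (d ^+ 2 / (2 * (b + 1))).
have b1 : 0 < 2 * (b + 1) by rewrite mulr_gt0// ltr_wpDl.
have z0 : 0 < z by rewrite lt_min !divr_gt0// exprn_gt0.
have zd : 2 * z <= d by rewrite mulrC -ler_pdivlMr// ge_min lexx.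
have zb : z * (2 * (b + 1)) <= d ^+ 2 by rewrite -ler_pdivlMr// ge_min lexx orbT.
have d20 : 0 < d / 2 by rewrite divr_gt0.
have [s1 [s10 H1]] := small_count p0 qp sAB z0 d20.
have [s2 [s20 H2]] := small_count p0 qp sABB z0 d20.
exists (Num.min 1 (Num.min s1 s2)); split; first by rewrite !lt_min ltr01 s10.
move=> s s0; rewrite !lt_min => /and3P[sl1 ss1 ss2].
have [r1 [c1 rp1]] := H1 s s0 ss1; have [r2 [c2 rp2]] := H2 s s0 ss2.
exists (r1 + r2)%N; split; first by rewrite natrD mulrDl; lra.
have s4 := pow4_le2 s0 sl1.
have s20' : 0 <= s ^+ 2 by exact: sqr_ge0.
have s40 : 0 <= s ^+ 4 by rewrite exprn_ge0// ltW.
have lekP (l : nat -> R) k : (forall n, 0 <= l n) -> Num.sqrt (l k) <= s -> l k <= s ^+ 2.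
  by move=> l0; rewrite -(@ler_sqr _ _ s) ?nnegrE ?sqrtr_ge0 ?(ltW s0)// sqr_sqrtr.
move=> k l; rewrite svA svB svC => /(lekP _ _ (lam_ge0 ESA)) ak /(lekP _ _ (lam_ge0 ESB)) bl.
have sd0 : 0 <= s * (1 + d) by rewrite mulr_ge0 ?addr_ge0 ?(ltW s0) ?(ltW d0).
have : mu (k + l + (r1 + r2))%N <= (s * (1 + d)) ^+ 2.
  apply: (cod_eig normE lC aC ESC) => //.
  apply: (cod_sum_upper normE aA aB ESA ESB (d := d * s ^+ 2) _ _ _ ak bl Ab c1 c2) => //.
  - exact: ltW.
  - by rewrite mulr_ge0// ltW.
  - rewrite exprMn -exprM.
    have := ler_wpM2r s40 zb; have : 0 <= z * s ^+ 4 by rewrite mulr_ge0// ltW.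
    by rewrite (_ : (2 * 2)%N = 4%N)//; lra.
  - have := ler_wpM2r s20' zd.
    have : z * s ^+ 4 <= z * s ^+ 2 by rewrite ler_wpM2l// ltW.
    have : 0 <= d ^+ 2 * s ^+ 2 by rewrite mulr_ge0 ?sqr_ge0.
    by rewrite exprMn; lra.
move=> mul; rewrite -ler_sqr ?nnegrE ?sqrtr_ge0// sqr_sqrtr//.
exact: (lam_ge0 ESC).
Qed.

Lemma singular_value_lower_count A As B Bs : compact_adj A As -> compact_adj B Bs ->
  small q (fun u => As (B u)) -> small q (fun u => A (Bs u)) -> small q (fun u => B (As u)) ->
  lower_count p (fun n => singular_value dot A n.+1) (fun n => singular_value dot B n.+1)
    (fun n => singular_value dot (fun u => A u + B u) n.+1).
Proof.
move=> hA hB sAB sBA sBA' d d0 d1.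
have [e [lam [ESA svA]]] := singular_value_eig hA.
have [f [kap [ESB svB]]] := singular_value_eig hB.
have hC := compact_adj_add hA hB.
have [g [mu [ESC svC]]] := singular_value_eig hC.
have [lA aA cA] := hA; have [lB aB cB] := hB; have [lC aC _] := hC.
have d30 : 0 < d / 3 by rewrite divr_gt0.
have [s1 [s10 H1]] := small_count p0 qp sAB d0 d30.
have [s2 [s20 H2]] := small_count p0 qp sBA d0 d30.
have [s3 [s30 H3]] := small_count p0 qp sBA' d0 d30.
exists (Num.min 1 (Num.min s1 (Num.min s2 s3))); split.
  by rewrite !lt_min ltr01 s10 s20.
move=> s s0; rewrite !lt_min => /and4P[sl1 ss1 ss2 ss3].
have [r1 [c1 rp1]] := H1 s s0 ss1; have [r2 [c2 rp2]] := H2 s s0 ss2.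
have [r3 [c3 rp3]] := H3 s s0 ss3.
exists (r1 + r2 + r3)%N; split; first by rewrite !natrD !mulrDl; lra.
have s4 : d * s ^+ 4 <= d * s ^+ 2 by rewrite ler_wpM2l ?(ltW d0)// pow4_le2.
have gesP (l : nat -> R) k : (forall n, 0 <= l n) -> s <= Num.sqrt (l k) -> s ^+ 2 <= l k.
  by move=> l0; rewrite -(@ler_sqr _ s) ?nnegrE ?sqrtr_ge0 ?(ltW s0)// sqr_sqrtr.
move=> k l m ak bl; rewrite svC => ts.
apply: (cod_sum_lower normE lA lB aA aB ESA ESB s0 (ltW d0) (sqrtr_ge0 (mu m)) _ _
  (cod_mono c1 (leqnn _) s4) (cod_mono c2 (leqnn _) s4) (cod_mono c3 (leqnn _) s4) _ ts).
- by move=> i /ak; rewrite svA; apply: gesP; exact: lam_ge0 ESA.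
- by move=> i /bl; rewrite svB; apply: gesP; exact: lam_ge0 ESB.
- by apply: (eig_cod ESC); rewrite ?sqrtr_ge0// sqr_sqrtr// (lam_ge0 ESC).
Qed.

(** Induction with the last operator split off: smallness is stable under finite sums, so the
    partial sum is almost orthogonal to the next operator. *)
Lemma singular_value_sum n (A As : 'I_n.+1 -> U -> U) :
  (forall l, compact_adj (A l) (As l)) ->
  (forall l j, l != j -> small q (fun u => As l (A j u)) /\ small q (fun u => A l (As j u))) ->
  let S u := \sum_l A l u in
  [/\ compact_adj S (fun u => \sum_l As l u),
    (limn_esup (scaled_seq p (singular_value dot S)) <=
     \sum_l limn_esup (scaled_seq p (singular_value dot (A l))))%E &
    (\sum_l limn_einf (scaled_seq p (singular_value dot (A l))) <=
     limn_einf (scaled_seq p (singular_value dot S)))%E].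
Proof.
elim: n A As => [|n IH] A As hA sA S.
  have SE : S = A ord0 by apply/funext => u; rewrite /S big_ord1.
  rewrite SE !big_ord1; split => //.
  by rewrite (_ : (fun u => _) = As ord0)//; apply/funext => u; rewrite big_ord1.
pose w (i : 'I_n.+1) : 'I_n.+2 := widen_ord (leqnSn n.+1) i.
have wm i : w i != ord_max by rewrite -val_eqE /= neq_ltn ltn_ord.
have [||hS Sup Sinf] := IH (fun i => A (w i)) (fun i => As (w i)).
- by move=> l; exact: hA.
- by move=> l j lj; apply: sA; apply: contra lj => /eqP/(congr1 val)/= /val_inj ->.
set S' := fun u => _ in hS Sup Sinf.
have SE : S = (fun u => S' u + A ord_max u).
  by apply/funext => u; rewrite /S big_ord_recr.
have s1 : small q (fun u => (\sum_l As (w l) (A ord_max u))).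
  by apply: small_sum => l; exact: (sA _ _ (wm l)).1.
have [lm am _] := hA ord_max.
have lms := adjoint_linear am.
have s2 : small q (fun u => S' (As ord_max u)).
  by apply: (@small_sum R q U U _ (index_enum _) (fun l u => A (w l) (As ord_max u))) => l; exact: (sA _ _ (wm l)).2.
have s3 : small q (fun u => A ord_max (\sum_l As (w l) u)).
  apply: small_ext (@small_sum R q U U _ (index_enum _) (fun l u => A ord_max (As (w l) u)) _) => [u|l].
    by rewrite (lin_sum lm).
  by apply: (sA _ _ _).2; rewrite eq_sym.
have hm := hA ord_max; split.
- have := compact_adj_add hS hm; rewrite SE.
  rewrite (_ : (fun u => \sum_l As l u) = (fun u => \sum_l As (w l) u + As ord_max u))//.
  by apply/funext => u; rewrite big_ord_recr.
- rewrite big_ord_recr SE /=; apply: le_trans (leeD Sup (lexx _)).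
  apply: scaled_limsup => //.
  + exact: singular_value_nonincreasing (compact_adj_add hS hm).
  + by move=> k; exact: singular_value_ge0 hS.
  + by move=> k; exact: singular_value_ge0 hm.
  + by move=> k; exact: singular_value_ge0 (compact_adj_add hS hm).
  + exact: singular_value_upper_count hS hm s1 s2.
- rewrite big_ord_recr SE /=; apply: le_trans (leeD Sinf (lexx _)) _.
  apply: scaled_liminf => //.
  + exact: singular_value_nonincreasing hS.
  + exact: singular_value_nonincreasing hm.
  + by move=> k; exact: singular_value_ge0 hS.
  + by move=> k; exact: singular_value_ge0 hm.
  + by move=> k; exact: singular_value_ge0 (compact_adj_add hS hm).
  + exact: singular_value_lower_count hS hm s1 s2 s3.
Qed.

End CompactOperatorSums.

(** * Completeness of L2 *)

Section RealL2.
Context d (T : measurableType d) (R : realType) (P : probability T R).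
Implicit Types f g h : T -> R.

Lemma measurable_sqr f : measurable_fun [set: T] f ->
  measurable_fun [set: T] (fun x => (f x ^+ 2)%:E : \bar R).
Proof. by move=> mf; apply/measurable_EFinP; exact: measurable_funX. Qed.

Lemma Lfun2P f : f \in Lfun P 2%:E <->
  measurable_fun [set: T] f /\ (\int[P]_x (f x ^+ 2)%:E < +oo)%E.
Proof.
split=> [fL|[mf fi]].
  have /set_mem/= mf := sub_Lfun_mfun fL; split => //.
  have /integrableP[_] := Lfun2_integrable_sqr fL.
  by under eq_integral do rewrite /= ger0_norm ?sqr_ge0//.
apply/andP; split; apply/mem_set => //=.
rewrite /finite_norm unlock; apply: poweR_lty.
by under eq_integral do rewrite /= powR_mulrn// real_normK ?num_real//.
Qed.

Let mD f g : measurable_fun [set: T] f -> measurable_fun [set: T] g ->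
  measurable_fun [set: T] (fun x => f x - g x).
Proof. by move=> mf mg; exact: measurable_funB. Qed.

Let sqr_split f g : measurable_fun [set: T] f -> measurable_fun [set: T] g ->
  (\int[P]_x ((f x + g x) ^+ 2)%:E <=
   2%:E * \int[P]_x (f x ^+ 2)%:E + 2%:E * \int[P]_x (g x ^+ 2)%:E)%E.
Proof.
move=> mf mg.
rewrite -!ge0_integralZl ?lee_fin//; try exact: measurable_sqr; try by move=> x _; rewrite lee_fin sqr_ge0.
rewrite -ge0_integralD//.
- apply: ge0_le_integral => //.
  + by move=> x _; rewrite lee_fin sqr_ge0.
  + by apply: measurable_sqr; exact: measurable_funD.
  + by apply: emeasurable_funD; apply: measurable_funeM; exact: measurable_sqr.
  + move=> x _; rewrite -!EFinM -EFinD lee_fin.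
    by have := sqr_ge0 (f x - g x); rewrite sqrrB sqrrD; lra.
- by move=> x _; rewrite -EFinM lee_fin mulr_ge0// sqr_ge0.
- by apply: measurable_funeM; exact: measurable_sqr.
- by move=> x _; rewrite -EFinM lee_fin mulr_ge0// sqr_ge0.
- by apply: measurable_funeM; exact: measurable_sqr.
Qed.

(** Integrate |f| <= f^2 / (2 k) + k / 2. *)
Lemma integral_abs_le_sqr f (k : R) : 0 < k -> measurable_fun [set: T] f ->
  (\int[P]_x (f x ^+ 2)%:E <= (k ^+ 2)%:E -> \int[P]_x `|f x|%:E <= k%:E)%E.
Proof.
move=> k0 mf fk.
have m1 : measurable_fun [set: T] (fun x => ((2 * k)^-1 * f x ^+ 2)%:E).
  by apply/measurable_EFinP; apply: measurable_funM => //; exact: measurable_funX.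
apply: (@le_trans _ _ (\int[P]_x (((2 * k)^-1 * f x ^+ 2)%:E + (k / 2)%:E))%E).
  apply: ge0_le_integral => //.
  - by apply/measurable_EFinP; exact: measurableT_comp.
  - exact: emeasurable_funD.
  - move=> x _; rewrite -EFinD lee_fin.
    rewrite -subr_ge0 (_ : _ - _ = (2 * k)^-1 * (`|f x| - k) ^+ 2).
      by rewrite mulr_ge0 ?sqr_ge0// invr_ge0 mulr_ge0// ltW.
    rewrite sqrrB real_normK ?num_real//; field.
    by rewrite gt_eqF.
rewrite ge0_integralD//; last first.
- by move=> x _; rewrite lee_fin mulr_ge0// ltW.
- by move=> x _; rewrite lee_fin mulr_ge0 ?sqr_ge0 ?invr_ge0 ?mulr_ge0// ltW.
under eq_integral do rewrite EFinM.
rewrite ge0_integralZl//; last 3 first.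
- exact: measurable_sqr.
- by move=> x _; rewrite lee_fin sqr_ge0.
- by rewrite lee_fin invr_ge0 mulr_ge0// ltW.
rewrite integral_cst//= probability_setT mule1.
apply: (@le_trans _ _ (((2 * k)^-1)%:E * (k ^+ 2)%:E + (k / 2)%:E)%E).
  by rewrite leeD2r// lee_wpmul2l// lee_fin invr_ge0 mulr_ge0// ltW.
rewrite -EFinM -EFinD lee_fin le_eqVlt; apply/orP; left; apply/eqP.
by field; rewrite gt_eqF.
Qed.

(** The increments have L^1 norm at most 2^-k, so the sum of their absolute values is integrable,
    hence finite almost everywhere. *)
Lemma ae_cvg_fast (g : nat -> T -> R) : (forall n, measurable_fun [set: T] (g n)) ->
  (forall k, \int[P]_x ((g k.+1 x - g k x) ^+ 2)%:E <= ((2^-1 ^+ k) ^+ 2)%:E)%E ->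
  {ae P, forall x, cvgn (fun k => g k x)}.
Proof.
move=> mg gk.
pose D k x := `|g k.+1 x - g k x|.
have mD' k : measurable_fun [set: T] (EFin \o D k).
  by apply/measurable_EFinP; apply: measurableT_comp => //; exact: mD.
have iD k : (\int[P]_x (D k x)%:E <= (2^-1 ^+ k)%:E)%E.
  have k0 : 0 < (2^-1 : R) ^+ k by rewrite exprn_gt0// invr_gt0.
  exact: (integral_abs_le_sqr k0 (mD (mg k.+1) (mg k))).
have sD : (\int[P]_x (\sum_(0 <= k <oo) (D k x)%:E) < +oo)%E.
  rewrite integral_nneseries//; last by move=> k x _; rewrite lee_fin /D.
  apply: (@le_lt_trans _ _ (\sum_(0 <= k <oo) (2^-1 ^+ k)%:E)%E).
    apply: lee_nneseries => [k _ _|k _]; last exact: iD.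
    by apply: integral_ge0 => x _; rewrite lee_fin /D.
  have -> : (\sum_(0 <= k <oo) (2^-1 ^+ k)%:E = 2%:E :> \bar R)%E.
    apply/cvg_lim => //.
    have : (fun n => \sum_(0 <= k < n) (2^-1 ^+ k : R)) @ \oo --> (2 : R).
      have := @cvg_geometric_series R 1 2^-1; rewrite ger0_norm ?invr_ge0// invf_lt1// ltr1n.
      move=> /(_ isT); rewrite (_ : 1 / (1 - 2^-1) = 2); last by field.
      rewrite (_ : series _ = fun n => \sum_(0 <= k < n) (2^-1 ^+ k : R))//.
      by apply/funext => n; apply: eq_bigr => k _; rewrite /geometric /= mul1r.
    move=> H; under eq_fun do rewrite sumEFin.
    by apply: cvg_EFin => //; exact: nearW.
  exact: ltry.
have : {ae P, forall x, [set: T] x -> (\sum_(0 <= k <oo) (D k x)%:E)%E \is a fin_num}.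
  apply: (@integrable_ae _ _ _ P setT _ _) => //.
  apply/integrableP; split.
    apply: (@ge0_emeasurable_sum _ _ _ _ (fun k x => (D k x)%:E) xpredT) => [k x _ _|k _].
      by rewrite lee_fin /D.
    exact: mD'.
  rewrite (eq_integral (fun x => \sum_(0 <= k <oo) (D k x)%:E)%E)// => x _.
  by rewrite gee0_abs//; apply: nneseries_ge0 => k _ _; rewrite lee_fin /D.
apply: filterS => x /(_ I) fx.
have cD : cvgn (series (fun k => D k x)).
  apply: nondecreasing_is_cvgn.
    by apply: (homo_leq (r := fun x y => x <= y)) => [//|y u z|n]; [exact: le_trans|rewrite !seriesEnat /= big_nat_recr//= lerDl /D].
  exists (fine (\sum_(0 <= k <oo) (D k x)%:E)%E) => _ [n _ <-].
  rewrite -lee_fin fineK// /series/= -sumEFin.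
  by apply: nneseries_lim_ge => k _ _; rewrite lee_fin /D.
have : cvgn (series (telescope (fun k => g k x))) by exact: normed_cvg.
rewrite telescopeK => H.
rewrite (_ : (fun k => g k x) = (fun k => (g k x - g 0%N x) + g 0%N x)).
  by apply: is_cvgD => //; exact: is_cvg_cst.
by apply/funext => k; rewrite subrK.
Qed.

Lemma L2_real_complete (f : nat -> T -> R) : (forall n, f n \in Lfun P 2%:E) ->
  (forall e : R, 0 < e -> exists N, forall m n, (N <= m)%N -> (N <= n)%N ->
     (\int[P]_x ((f m x - f n x) ^+ 2)%:E <= e%:E)%E) ->
  exists2 g, g \in Lfun P 2%:E &
    forall e : R, 0 < e -> exists N, forall n, (N <= n)%N ->
     (\int[P]_x ((f n x - g x) ^+ 2)%:E <= e%:E)%E.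
Proof.
move=> fL fC.
have mf n : measurable_fun [set: T] (f n) by have /Lfun2P[] := fL n.
have /choice[N0 N0P] (k : nat) : exists N, forall m n, (N <= m)%N -> (N <= n)%N ->
    (\int[P]_x ((f m x - f n x) ^+ 2)%:E <= ((2^-1 ^+ k) ^+ 2)%:E)%E.
  by apply: fC; rewrite !exprn_gt0// invr_gt0.
pose phi k := (\max_(j < k.+1) N0 j)%N.
have phi_ge j k : (j <= k)%N -> (N0 j <= phi k)%N.
  by move=> jk; exact: (@leq_bigmax _ (fun i : 'I_k.+1 => N0 i) (Ordinal (jk : (j < k.+1)%N))).
pose g k := f (phi k).
have mg k : measurable_fun [set: T] (g k) by exact: mf.
have gk k : (\int[P]_x ((g k.+1 x - g k x) ^+ 2)%:E <= ((2^-1 ^+ k) ^+ 2)%:E)%E.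
  by apply: N0P; apply: phi_ge.
have gcv := ae_cvg_fast mg gk.
(* An upper limit is measurable whether or not the sequence converges; [fine] gives 0 at infinite
   values, which occur on a null set only. *)
pose G x := fine (limn_esup (fun k => (g k x)%:E)).
have mG : measurable_fun [set: T] G.
  apply: measurableT_comp => //; apply: measurable_fun_limn_esup => n.
  exact/measurable_EFinP.
have GE : {ae P, forall x, (fun k => g k x) @ \oo --> G x}.
  apply: filterS gcv => x gx.
  suff -> : G x = limn (fun k => g k x) by [].
  rewrite /G.
  have e : (fun k => (g k x)%:E) @ \oo --> (limn (fun k => g k x))%:E.
    by apply: cvg_EFin => //; exact: nearW.
  rewrite is_cvg_limn_esupE; last by apply/cvg_ex; exists (limn (fun k => g k x))%:E.
  by rewrite (cvg_lim _ e).
(* Fatou: the distance from f n to G is at most the lower limit of its distances to the g k. *)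
have key j n : (phi j <= n)%N ->
    (\int[P]_x ((f n x - G x) ^+ 2)%:E <= ((2^-1 ^+ j) ^+ 2)%:E)%E.
  move=> jn.
  have h : ae_eq P setT (fun x => ((f n x - G x) ^+ 2)%:E)
     (fun x => limn_einf (fun k => ((f n x - g k x) ^+ 2)%:E)).
    apply: filterS GE => x gx _.
    have e : (fun k => ((f n x - g k x) ^+ 2)%:E) @ \oo --> ((f n x - G x) ^+ 2)%:E.
      apply: cvg_EFin; first by apply: nearW.
      apply: (@cvg_comp _ _ _ (fun k => f n x - g k x) (fun y : R => y ^+ 2) _ (nbhs (f n x - G x))).
        by apply: cvgB => //; exact: cvg_cst.
      exact: exprn_continuous.
    rewrite is_cvg_limn_einfE; last by apply/cvg_ex; exists ((f n x - G x) ^+ 2)%:E.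
    by rewrite (cvg_lim _ e).
  have ms k : measurable_fun [set: T] (fun x => ((f n x - g k x) ^+ 2)%:E).
    by apply: measurable_sqr; exact: mD.
  rewrite (ge0_ae_eq_integral _ _ _ _ _ h)//; last 4 first.
  - by apply: measurable_sqr; exact: mD.
  - rewrite (_ : (fun x => _) = (fun x => (- limn_esup (fun k => - ((f n x - g k x) ^+ 2)%:E))%E))//.
    apply: measurableT_comp => //; apply: measurable_fun_limn_esup => k.
    exact: measurableT_comp.
  - by move=> x _; rewrite lee_fin sqr_ge0.
  - by move=> x _; apply: limn_einf_ge0 => k; rewrite lee_fin sqr_ge0.
  apply: le_trans (fatou P measurableT ms _) _.
    by move=> k x _; rewrite lee_fin sqr_ge0.
  apply: le_trans (limn_einf_sup _) _.
  apply: limn_esup_le; exists j => k jk.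
  apply: N0P; first exact: leq_trans (phi_ge j j _) jn.
  exact: phi_ge.
exists G.
  apply/Lfun2P; split => //.
  have [mf0 fi] := (Lfun2P _).1 (fL (phi 0%N)).
  rewrite (_ : (fun x => _) = (fun x => ((f (phi 0%N) x + - (f (phi 0%N) x - G x)) ^+ 2)%:E)); last first.
    by apply/funext => x; rewrite subKr.
  apply: le_lt_trans (sqr_split _ _) _ => //.
    by apply: measurableT_comp => //; exact: mD.
  under [X in (_ + 2%:E * X)%E]eq_integral do rewrite sqrrN.
  rewrite lte_add_pinfty// ?lte_mul_pinfty ?lee_fin//.
  by apply: le_lt_trans (key 0%N _ (leqnn _)) _; rewrite ltry.
move=> e e0.
have [j je] : exists j : nat, (2^-1 ^+ j) ^+ 2 <= e.
  have [j ej] := nat_ubound e^-1; exists j.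
  have j2 : (j%:R : R) <= 2 ^+ j by rewrite -natrX ler_nat ltnW// ltn_expl.
  rewrite -exprM exprVn -[leRHS]invrK lef_pV2 ?posrE ?exprn_gt0 ?invr_gt0//.
  apply: le_trans ej (le_trans j2 _).
  by rewrite ler_eXn2l ?ltr1n// muln2 -addnn leq_addr.
exists (phi j) => n jn; apply: le_trans (key j n jn) _.
by rewrite lee_fin.
Qed.

End RealL2.

Section ComplexL2.
Context d (T : measurableType d) (R : realType) (P : probability T R).
Implicit Types (f g w : T -> R[i]) (u v : L2 P).

Definition mC f := measurable_fun [set: T] (fun x => complex.Re (f x)) /\
  measurable_fun [set: T] (fun x => complex.Im (f x)).

Lemma mCD f g : mC f -> mC g -> mC (fun x => f x + g x).
Proof.
move=> [fr fi] [gr gi]; split.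
  by under eq_fun do rewrite ReD; exact: measurable_funD.
by under eq_fun do rewrite ImD; exact: measurable_funD.
Qed.

Lemma mCM f g : mC f -> mC g -> mC (fun x => f x * g x).
Proof.
move=> [fr fi] [gr gi]; split.
  by under eq_fun do rewrite Defs.ReM; apply: measurable_funB; exact: measurable_funM.
by under eq_fun do rewrite Defs.ImM; apply: measurable_funD; exact: measurable_funM.
Qed.

Lemma mC_cst c : mC (fun=> c).
Proof. by split; exact: measurable_cst. Qed.

Lemma mC_conj f : mC f -> mC (fun x => conjc (f x)).
Proof.
move=> [fr fi]; split; first by under eq_fun do rewrite ReJ.
by under eq_fun do rewrite ImJ; exact: measurableT_comp.
Qed.

Lemma measurable_cm_sqr f : mC f -> measurable_fun [set: T] (fun x => (cm (f x) ^+ 2)%:E : \bar R).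
Proof.
move=> [fr fi]; apply/measurable_EFinP; under eq_fun do rewrite cm_sqr.
by apply: measurable_funD; exact: measurable_funX.
Qed.

Lemma integral_cm_sqr f : mC f ->
  (\int[P]_x (cm (f x) ^+ 2)%:E =
   \int[P]_x (complex.Re (f x) ^+ 2)%:E + \int[P]_x (complex.Im (f x) ^+ 2)%:E)%E.
Proof.
move=> [fr fi]; under eq_integral do rewrite cm_sqr EFinD.
rewrite ge0_integralD//; try exact: measurable_sqr.
- by move=> x _; rewrite lee_fin sqr_ge0.
- by move=> x _; rewrite lee_fin sqr_ge0.
Qed.

Lemma CLfun2P f : f \in CLfun P 2%:E <->
  mC f /\ (\int[P]_x (cm (f x) ^+ 2)%:E < +oo)%E.
Proof.
split=> [/andP[/Lfun2P[mr ir] /Lfun2P[mi ii]]|[mf]].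
  by split; [split|rewrite integral_cm_sqr// lte_add_pinfty].
rewrite integral_cm_sqr// => fi; have [mr mi] := mf.
apply/andP; split; apply/Lfun2P; split => //; apply: le_lt_trans fi.
  by rewrite leeDl// integral_ge0// => x _; rewrite lee_fin sqr_ge0.
by rewrite leeDr// integral_ge0// => x _; rewrite lee_fin sqr_ge0.
Qed.

Lemma L2_mC u : mC u.
Proof. by have /CLfun2P[] := L2_funP u. Qed.

Lemma L2_normE u : `|u| = sqrtC (L2_dot u u).
Proof. by []. Qed.

Lemma L2_nr_sqr u : (nr u ^+ 2)%:E = (\int[P]_x (cm (u x) ^+ 2)%:E)%E.
Proof.
rewrite (nr_sqrE L2_normE) /= /L2_dot /Cintegral /= /Rintegral.
have h : (\int[P]_x (complex.Re (u x * conjc (u x)))%:E = \int[P]_x (cm (u x) ^+ 2)%:E)%E.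
  by apply: eq_integral => x _; rewrite mulcJ.
rewrite h fineK// ge0_fin_numE; last by apply: integral_ge0 => x _; rewrite lee_fin sqr_ge0.
by have /CLfun2P[] := L2_funP u.
Qed.

Lemma toL2E f : f \in CLfun P 2%:E -> {ae P, forall x, toL2 P f x = f x}.
Proof.
move=> fL; apply: filterS (L2_piE (insubd 0 f)) => x.
by rewrite /toL2 => ->; rewrite -[L2fun_val _]/(val _) val_insubd fL.
Qed.

Lemma L2_subE u v : {ae P, forall x, (u - v : L2 P) x = u x - v x}.
Proof.
have h := L2_addE (u - v) v; rewrite subrK in h.
by apply: filterS h => x ->; rewrite addrK.
Qed.

Lemma L2_linE (a : R[i]) u v : {ae P, forall x, (a *: u + v : L2 P) x = a * u x + v x}.
Proof. by apply: filterS2 (L2_addE (a *: u) v) (L2_scaleE a u) => x -> ->. Qed.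

Lemma L2_nr_le u v (c : R) : 0 <= c -> {ae P, forall x, cm (u x) <= c * cm (v x)} ->
  nr u <= c * nr v.
Proof.
move=> c0 H; rewrite -ler_sqr ?nnegrE ?mulr_ge0 ?nr_ge0// exprMn.
rewrite -lee_fin (EFinM (c ^+ 2)) !L2_nr_sqr -ge0_integralZl//; last 3 first.
- exact/measurable_cm_sqr/L2_mC.
- by move=> x _; rewrite lee_fin sqr_ge0.
- by rewrite lee_fin sqr_ge0.
apply: ae_ge0_le_integral => //.
- by move=> x _; rewrite lee_fin sqr_ge0.
- exact/measurable_cm_sqr/L2_mC.
- by move=> x _; rewrite -EFinM lee_fin mulr_ge0 ?sqr_ge0.
- by apply: measurable_funeM; exact/measurable_cm_sqr/L2_mC.
apply: filterS H => x ux _; rewrite -EFinM lee_fin -exprMn.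
by rewrite ler_sqr ?nnegrE ?mulr_ge0 ?cm_ge0.
Qed.

Definition ae_bounded (c : R) w := mC w /\ {ae P, forall x, cm (w x) <= c}.

Lemma CLfun2_mul c w f : 0 <= c -> ae_bounded c w -> f \in CLfun P 2%:E ->
  (fun x => w x * f x) \in CLfun P 2%:E.
Proof.
move=> c0 [mw wc] /CLfun2P[mf fi]; apply/CLfun2P; split; first exact: mCM.
apply: (@le_lt_trans _ _ ((c ^+ 2)%:E * \int[P]_x (cm (f x) ^+ 2)%:E)%E); last first.
  by rewrite lte_mul_pinfty ?lee_fin ?sqr_ge0.
rewrite -ge0_integralZl//; last 3 first.
- exact/measurable_cm_sqr.
- by move=> x _; rewrite lee_fin sqr_ge0.
- by rewrite lee_fin sqr_ge0.
apply: ae_ge0_le_integral => //.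
- by move=> x _; rewrite lee_fin sqr_ge0.
- exact/measurable_cm_sqr/mCM.
- by move=> x _; rewrite -EFinM lee_fin mulr_ge0 ?sqr_ge0.
- by apply: measurable_funeM; exact/measurable_cm_sqr.
apply: filterS wc => x wx _; rewrite -EFinM lee_fin -exprMn cmM.
by rewrite ler_sqr ?nnegrE ?mulr_ge0 ?cm_ge0// ler_wpM2r ?cm_ge0.
Qed.

Lemma ae_bounded_L2 c w : 0 <= c -> ae_bounded c w -> w \in CLfun P 2%:E.
Proof.
move=> c0 wc; rewrite (_ : w = fun x => w x * 1); last by apply/funext => x; rewrite mulr1.
apply: CLfun2_mul c0 wc _; apply/CLfun2P; split; first exact: mC_cst.
rewrite cm1 expr1n integral_cst//= probability_setT mul1e; exact: ltry.
Qed.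

Lemma Linfty_bounded w : w \in CLfun P +oo%E -> exists2 c, 0 <= c & ae_bounded c w.
Proof.
move=> /andP[wr wi].
have H (f : T -> R) : f \in Lfun P +oo%E -> measurable_fun [set: T] f /\
    exists c : R, 0 <= c /\ {ae P, forall x, `|f x| <= c}.
  move=> /andP[/set_mem/= mf /set_mem/=]; rewrite /finite_norm unlock /= probability_setT lte01.
  move=> fo; split => //.
  have fae := ess_sup_inf.ess_sup_ge P (abse \o (EFin \o f)).
  move: fo fae; case: (ess_sup_inf.ess_sup P _) => [c _ H|//|_ H].
    exists (Num.max 0 c); split; first by rewrite le_max lexx.
    by apply: filterS H => x; rewrite lee_fin le_max => ->; rewrite orbT.
  by exists 0; split => //; apply: filterS H => x; rewrite leeNy_eq.
have [mr [cr [cr0 crP]]] := H _ wr; have [mi [ci [ci0 ciP]]] := H _ wi.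
exists (cr + ci); first exact: addr_ge0.
split; first by split.
apply: filterS2 crP ciP => x /= hr hi.
rewrite -ler_sqr ?nnegrE ?cm_ge0 ?addr_ge0// cm_sqr.
rewrite -(real_normK (num_real (complex.Re (w x)))) -(real_normK (num_real (complex.Im (w x)))).
have := normr_ge0 (complex.Re (w x)); have := normr_ge0 (complex.Im (w x)).
move: hr hi; set a := `| _ |; set b := `| _ |; rewrite sqrrD => hr hi b0 a0.
have : a ^+ 2 <= cr ^+ 2 by rewrite ler_sqr.
have : b ^+ 2 <= ci ^+ 2 by rewrite ler_sqr.
have : 0 <= cr * ci by rewrite mulr_ge0.
lra.
Qed.

Lemma L2_complete : nr_complete (L2 P).
Proof.
suff H (u : nat -> L2 P) : (forall e, 0 < e -> exists N, forall m n, (N <= m)%N ->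
    (N <= n)%N -> nr (u m - u n) < e) -> exists w : L2 P, u @ \oo --> w by exact: H.
move=> uC.
have C1 (p : R[i] -> R) : (forall z, p z ^+ 2 <= cm z ^+ 2) -> (forall z z', p (z - z') = p z - p z') ->
    (forall v, (fun x => p (v x)) \in Lfun P 2%:E) ->
    exists2 g, g \in Lfun P 2%:E & forall e : R, 0 < e -> exists N, forall n, (N <= n)%N ->
     (\int[P]_x ((p (u n x) - g x) ^+ 2)%:E <= e%:E)%E.
  move=> pc pB pL; apply: (L2_real_complete (f := fun n x => p (u n x))) => // e e0.
  have [|N NP] := uC (Num.sqrt e); first by rewrite sqrtr_gt0.
  exists N => m n Nm Nn.
  have : ((nr (u m - u n) ^+ 2)%:E <= e%:E)%E.
    by rewrite lee_fin -[leRHS](sqr_sqrtr (ltW e0)) ler_sqr ?nnegrE ?nr_ge0 ?sqrtr_ge0// ltW// NP.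
  apply: le_trans; rewrite L2_nr_sqr; apply: ae_ge0_le_integral => //.
  - by move=> x _; rewrite lee_fin sqr_ge0.
  - have /Lfun2P[mm _] := pL (u m); have /Lfun2P[mn _] := pL (u n).
    by apply: measurable_sqr; exact: measurable_funB.
  - by move=> x _; rewrite lee_fin sqr_ge0.
  - exact/measurable_cm_sqr/L2_mC.
  apply: filterS (L2_subE (u m) (u n)) => x -> _.
  by rewrite lee_fin -pB.
have [|||g gL gP] := C1 (@complex.Re R).
- by move=> z; rewrite cm_sqr lerDl sqr_ge0.
- by move=> [a b] [c e].
- by move=> v; have /andP[] := L2_funP v.
have [|||h hL hP] := C1 (@complex.Im R).
- by move=> z; rewrite cm_sqr lerDr sqr_ge0.
- by move=> [a b] [c e].
- by move=> v; have /andP[] := L2_funP v.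
pose F x : R[i] := g x +i* h x.
have FL : F \in CLfun P 2%:E by apply/andP; split.
exists (toL2 P F); apply/cvg_nrP => e e0.
have e2 : 0 < e ^+ 2 / 4 by rewrite divr_gt0// exprn_gt0.
have [N1 N1P] := gP _ e2; have [N2 N2P] := hP _ e2.
exists (maxn N1 N2) => // n /=; rewrite geq_max => /andP[n1 n2].
rewrite nrBC -ltr_sqr ?nnegrE ?nr_ge0 ?(ltW e0)// -lte_fin.
apply: (@le_lt_trans _ _ ((e ^+ 2 / 4)%:E + (e ^+ 2 / 4)%:E)%E); last first.
  have e20 : 0 < e ^+ 2 by rewrite exprn_gt0.
  by rewrite -EFinD lte_fin; lra.
apply: le_trans (leeD (N1P _ n1) (N2P _ n2)).
have mu := L2_mC (u n); have [mF _] := (CLfun2P _).1 FL.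
rewrite L2_nr_sqr.
have -> : (\int[P]_x (cm ((u n - toL2 P F : L2 P) x) ^+ 2)%:E = \int[P]_x (cm (u n x - F x) ^+ 2)%:E)%E.
  apply: ge0_ae_eq_integral => //.
  - exact/measurable_cm_sqr/L2_mC.
  - apply: measurable_cm_sqr; rewrite (_ : (fun x => u n x - F x) = (fun x => u n x + (-1) * F x)).
      by apply: mCD => //; apply: mCM => //; exact: mC_cst.
    by apply/funext => x; rewrite mulN1r.
  - by move=> x _; rewrite lee_fin sqr_ge0.
  - by move=> x _; rewrite lee_fin sqr_ge0.
  by apply: filterS2 (L2_subE (u n) (toL2 P F)) (toL2E FL) => x -> -> _.
rewrite integral_cm_sqr.
  by rewrite le_eqVlt; apply/orP; left; apply/eqP; congr (_ + _)%E; apply: eq_integral => x _; case: (u n x).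
rewrite (_ : (fun x => u n x - F x) = (fun x => u n x + (-1) * F x)).
  by apply: mCD => //; apply: mCM => //; exact: mC_cst.
by apply/funext => x; rewrite mulN1r.
Qed.

End ComplexL2.

Lemma nr_lipschitz_real (R : realType) (U : normedModType R[i]) (f : U -> R) :
  (forall u v, `|f u - f v| <= nr (u - v)) -> continuous f.
Proof.
move=> fl u; apply/cvgrPdist_lt => e e0.
have : \forall v \near u, nr (u - v) < e by apply/nbhs_nrP; exists e.
by apply: filterS => v; apply: le_lt_trans.
Qed.

Lemma nr_lipschitz (R : realType) (U V : normedModType R[i]) (f : U -> V) :
  (forall u v, nr (f u - f v) <= nr (u - v)) -> continuous f.
Proof.
move=> fl u; apply/cvg_nrP => e e0.
have : \forall v \near u, nr (u - v) < e by apply/nbhs_nrP; exists e.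
by apply: filterS => v; apply: le_lt_trans.
Qed.

(** * The circle *)

Section Circle.
Context (R : realType).
Local Notation m := (circle_measure R).
Local Notation mu := (@lebesgue_measure R).
Implicit Types (z : circle R) (t : R).

Lemma circle_val_inj : injective (@circle_val R).
Proof. exact: val_inj. Qed.

Lemma circle_val_conj z : circle_val (circle_conj z) = conjc (circle_val z).
Proof. by rewrite -conjC_conjc. Qed.

Lemma circle_val_cis t : circle_val (cis t) = cos t +i* sin t.
Proof. by []. Qed.

Lemma circle_conjK : involutive (@circle_conj R).
Proof. by move=> z; apply: circle_val_inj; rewrite !circle_val_conj conjcK. Qed.

Lemma circle_conj_cis t : circle_conj (cis t) = cis (- t).
Proof.
by apply: circle_val_inj; rewrite circle_val_conj !circle_val_cis cosN sinN.
Qed.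

Lemma cisD2pi t : cis (t + 2 * pi) = cis t.
Proof.
apply: circle_val_inj; rewrite !circle_val_cis.
by rewrite mulrC mulr_natr cosD2pi sinD2pi.
Qed.

Lemma cm_circle z : cm (circle_val z) = 1.
Proof. by rewrite /cm circle_valP. Qed.

Lemma circle_val_neq0 z : circle_val z != 0.
Proof. by rewrite -normr_eq0 circle_valP oner_eq0. Qed.

Lemma circle_val_inv z : (circle_val z)^-1 = conjc (circle_val z).
Proof.
apply: (mulfI (circle_val_neq0 z)).
by rewrite divff ?circle_val_neq0// mulcJ cm_circle expr1n.
Qed.

Lemma cis_surj z : exists2 t, 0 <= t <= 2 * pi & z = cis t.
Proof.
pose x := complex.Re (circle_val z); pose y := complex.Im (circle_val z).
have xy : x ^+ 2 + y ^+ 2 = 1 by rewrite -cm_sqr cm_circle expr1n.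
have x1 : -1 <= x <= 1.
  by rewrite -ler_norml -(ler_sqr _ _) ?nnegrE// real_normK ?num_real// expr1n -xy lerDl sqr_ge0.
have y2 : 1 - x ^+ 2 = y ^+ 2 by rewrite -xy addrAC subrr add0r.
have [y0|y0] := lerP 0 y.
  exists (acos x).
    by rewrite acos_ge0//= (le_trans (acos_lepi x1))// mulrC ler_peMr ?pi_ge0// ler1n.
  apply: circle_val_inj; rewrite circle_val_cis acosK// sin_acos// y2 sqrtr_sqr ger0_norm//.
  exact: Defs.eqC.
exists (2 * pi - acos x).
  rewrite subr_ge0 lerBlDr lerDl acos_ge0// andbT.
  by rewrite (le_trans (acos_lepi x1))// mulrC ler_peMr ?pi_ge0// ler1n.
apply: circle_val_inj; rewrite -[_ - _]addrC cisD2pi circle_val_cis cosN sinN acosK//.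
rewrite sin_acos// y2 sqrtr_sqr ltr0_norm// opprK /x /y.
exact: Defs.eqC.
Qed.

Lemma continuous_circle_measurable (f : circle R -> R) : continuous f ->
  measurable_fun [set: circle R] f.
Proof.
move=> /continuousP cf; apply: (measurability _ (RGenOpens.measurableE R)).
move=> _ [_ [a [b ->] <-]]; rewrite setTI; apply: sub_sigma_algebra.
exact/cf/interval_open.
Qed.

Lemma circle_val_continuous : continuous (@circle_val R).
Proof. exact: initial_continuous. Qed.

Lemma continuous_Re : continuous (@complex.Re R : R[i] -> R).
Proof.
apply: nr_lipschitz_real => z w.
by apply: le_trans (ler_Re_cm (z - w)); case: z => a b; case: w.
Qed.

Lemma continuous_Im : continuous (@complex.Im R : R[i] -> R).
Proof.
apply: nr_lipschitz_real => z w.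
by apply: le_trans (ler_Im_cm (z - w)); case: z => a b; case: w.
Qed.

Lemma continuous_conjc : continuous (@conjc R : R[i] -> R[i]).
Proof.
apply: nr_lipschitz => z w.
by rewrite -rmorphB -[nr _]/(cm _) cmJ.
Qed.

Lemma mC_circle_val : mC (@circle_val R).
Proof.
split; apply: continuous_circle_measurable => z.
  by apply: continuous_comp; [exact: circle_val_continuous|exact: continuous_Re].
by apply: continuous_comp; [exact: circle_val_continuous|exact: continuous_Im].
Qed.

Lemma circle_conj_continuous : continuous (@circle_conj R).
Proof.
apply: continuous_comp_initial => z.
rewrite (_ : _ \o _ = @conjc R \o @circle_val R); last first.
  by apply/funext => w /=; exact: circle_val_conj.
by apply: continuous_comp; [exact: circle_val_continuous|exact: continuous_conjc].
Qed.

Lemma measurable_circle_conj : measurable_fun [set: circle R] (@circle_conj R).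
Proof.
apply: (@measurability _ _ _ _ _ (@circle_conj R) (@open (circle R))) => //.
move=> _ [B oB <-]; rewrite setTI; apply: sub_sigma_algebra.
by move/continuousP : circle_conj_continuous => /(_ B oB).
Qed.

Lemma ge0_circle_integral (F : circle R -> \bar R) : measurable_fun [set: circle R] F ->
  (forall z, (0 <= F z)%E) ->
  (\int[m]_z F z = (2 * pi)^-1%:E * \int[mu]_(t in `[0%R, (2 * pi)%R]) F (cis t))%E.
Proof.
move=> mF F0; rewrite ge0_integral_distribution//= integral_uniform//.
  by rewrite subr0.
by apply: measurableT_comp => //; exact: measurable_cis.
Qed.

Definition flip (c t : R) : measurableTypeR R := c - t.

Lemma measurable_flip c : measurable_fun [set: measurableTypeR R] (flip c).
Proof. by apply: measurable_funB => //; exact: measurable_cst. Qed.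

HB.instance Definition _ c := isMeasurableFun.Build _ _ _ _
  (flip c : measurableTypeR R -> measurableTypeR R) (measurable_flip c).

Lemma lebesgue_measure_flip c (A : set R) : measurable A ->
  pushforward mu (flip c : measurableTypeR R -> measurableTypeR R) A = mu A.
Proof.
move=> mA; apply/esym/lebesgue_measure_unique => //= _ [[a b]] _ <-.
rewrite /pushforward (_ : flip c @^-1` `]a, b] = `[c - b, c - a[%classic); last first.
  apply/seteqP; split=> t /=; rewrite !in_itv /= /flip => /andP[h1 h2]; apply/andP; split; lra.
rewrite !lebesgue_measure_itv/= !lte_fin.
rewrite ltrD2l ltrN2; case: ifPn => // _.
by rewrite -!EFinB; congr (_%:E); lra.
Qed.

(** In the angle, conjugation is t -> 2 pi - t, which preserves the interval and Lebesgue
    measure. *)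
Lemma ge0_circle_integral_conj (F : circle R -> \bar R) : measurable_fun [set: circle R] F ->
  (forall z, (0 <= F z)%E) -> (\int[m]_z F (circle_conj z) = \int[m]_z F z)%E.
Proof.
move=> mF F0; rewrite !ge0_circle_integral//; last first.
  by apply: measurableT_comp => //; exact: measurable_circle_conj.
congr (_ * _)%E.
have mFc : measurable_fun [set: R] (fun t : R => F (cis t)).
  by apply: measurableT_comp => //; exact: measurable_cis.
transitivity (\int[pushforward mu (flip (2 * pi) : measurableTypeR R -> measurableTypeR R)]_(t in `[0%R, (2 * pi)%R]) F (cis t))%E.
  rewrite ge0_integral_pushforward//=; last exact: measurable_funS mFc.
  have -> : flip (2 * pi) @^-1` `[0, 2 * pi] = `[0, 2 * pi]%classic.
    apply/seteqP; split=> t /=; rewrite !in_itv /= /flip => /andP[h1 h2]; apply/andP; split; lra.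
  apply: eq_integral => t _ /=.
  by rewrite circle_conj_cis /flip addrC cisD2pi.
by apply: eq_measure_integral => A mA _; exact: lebesgue_measure_flip.
Qed.

(** Invariance of the integral, applied to an indicator, shows that the preimage of a null set is
    null. *)
Lemma ae_circle_conj (Q : circle R -> Prop) :
  {ae m, forall z, Q z} -> {ae m, forall z, Q (circle_conj z)}.
Proof.
move=> [N [mN N0 QN]]; exists (@circle_conj R @^-1` N); split.
- by rewrite -[_ @^-1` _]setTI; exact: measurable_circle_conj.
- have mN' : measurable (@circle_conj R @^-1` N).
    by rewrite -[_ @^-1` _]setTI; exact: measurable_circle_conj.
  have h : (\int[m]_z (\1_N (circle_conj z))%:E = \int[m]_z (\1_N z)%:E)%E.
    apply: (ge0_circle_integral_conj (F := fun z => (\1_N z)%:E)) => //.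
    exact/measurable_EFinP/measurable_indic.
  have h0 : (\int[m]_z (\1_N z)%:E = 0)%E.
    by rewrite integral_indic// setIT; exact: N0.
  have h1 : (\int[m]_z (\1_(@circle_conj R @^-1` N) z)%:E = 0)%E by exact: etrans h h0.
  by rewrite integral_indic// setIT in h1; exact: h1.
- by move=> z /= nQ; apply: QN.
Qed.

End Circle.

Section OrthonormalSeries.
Context {R : realType} {U : normedModType R[i]} (dot : {dot U for @Num.conj R[i]}).
Hypothesis normE : forall u : U, `|u| = sqrtC (dot u u).
Variable e : nat -> U.
Hypothesis orth_e : forall i j, dot (e i) (e j) = (i == j)%:R.

Definition fourier_sum N (u : U) := \sum_(k < N) dot u (e k) *: e k.

Lemma nr_orth_comb n (a : 'I_n -> R[i]) (f : 'I_n -> nat) : injective f ->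
  nr (\sum_(i < n) a i *: e (f i)) ^+ 2 = \sum_(i < n) cm (a i) ^+ 2.
Proof.
move=> fi; rewrite (nr_sum_sqr normE) => [|i j ij].
  apply: eq_bigr => i _; rewrite nrZ exprMn (nr_sqrE normE) orth_e eqxx /=.
  by rewrite mulr1.
by rewrite dotZl dotZr orth_e (inj_eq fi) (negbTE ij) !mulr0.
Qed.

Lemma dot_fourier_sum N u k : dot (fourier_sum N u) (e k) = if (k < N)%N then dot u (e k) else 0.
Proof.
rewrite dot_suml; case: ifP => kN.
  rewrite (bigD1 (Ordinal kN))//= dotZl orth_e eqxx mulr1 big1 ?addr0// => i ik.
  by rewrite dotZl orth_e (_ : (i == k :> nat) = false) ?mulr0//; apply/negbTE.
apply: big1 => i _; rewrite dotZl orth_e (_ : (i == k :> nat) = false) ?mulr0//.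
by apply/negbTE; rewrite neq_ltn (leq_trans (ltn_ord i))// leqNgt kN.
Qed.

Lemma bessel N u : \sum_(k < N) cm (dot u (e k)) ^+ 2 <= nr u ^+ 2.
Proof.
rewrite -(nr_orth_comb (fun k => dot u (e k)) (f := fun i : 'I_N => i))//; last exact: ord_inj.
rewrite -/(fourier_sum N u) -[u in leRHS](subrK (fourier_sum N u)).
rewrite (nr_pythagoras normE) ?lerDr ?sqr_ge0//.
rewrite dot_sumr big1// => i _.
by rewrite dotZr dotBl dot_fourier_sum ltn_ord subrr mulr0.
Qed.

(** The Bessel inequality makes the sums Cauchy. By [fourier_limit_orth] the limit is the projection
    of u on the closed span of e. *)
Lemma fourier_sum_cvg u : nr_complete U -> exists w : U, (fourier_sum^~ u) @ \oo --> w.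
Proof.
move=> cU; apply: cU => d d0.
pose sg N := \sum_(k < N) cm (dot u (e k)) ^+ 2.
have sg_nd : nondecreasing_seq sg.
  apply: (homo_leq (r := fun x y => x <= y)) => [//|x y z|n]; first exact: le_trans.
  by rewrite /sg big_ord_recr /= lerDl sqr_ge0.
have cs : cvgn sg.
  by apply: nondecreasing_is_cvgn => //; exists (nr u ^+ 2) => _ [n _ <-]; exact: bessel.
have dist M N : (N <= M)%N -> nr (fourier_sum M u - fourier_sum N u) ^+ 2 = sg M - sg N.
  move=> NM; rewrite -(subnKC NM) /fourier_sum /sg !big_split_ord /=.
  rewrite addrAC subrr add0r [in RHS]addrAC subrr add0r.
  by rewrite (nr_orth_comb (fun i : 'I_(M - N) => dot u (e (N + i)%N)) (f := fun i => (N + i)%N))// => i j /addnI/val_inj.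
have /cvgrPdist_lt/(_ (d ^+ 2 / 2))[|N _ NP] := cs; first by rewrite divr_gt0// exprn_gt0.
have key M n : (N <= n)%N -> (n <= M)%N -> nr (fourier_sum M u - fourier_sum n u) < d.
  move=> Nn nM; rewrite -ltr_sqr ?nnegrE ?nr_ge0 ?(ltW d0)// dist//.
  have := NP n Nn; have := NP M (leq_trans Nn nM); rewrite !ltr_norml.
  by move=> /andP[h1 h2] /andP[h3 h4]; lra.
exists N => M n NM Nn; have [Mn|nM] := leqP n M; first exact: key.
by rewrite nrBC; apply: key => //; exact: ltnW.
Qed.

Lemma fourier_limit_orth u w k : (fourier_sum^~ u) @ \oo --> w -> dot (u - w) (e k) = 0.
Proof.
move=> /cvg_nrP uw; apply: cm_eq0; apply/eqP; rewrite eq_le cm_ge0 andbT.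
apply/ler_addgt0Pr => d d0; rewrite add0r; have [N _ NP] := uw d d0.
pose n := maxn N k.+1.
have -> : dot (u - w) (e k) = dot (fourier_sum n u - w) (e k).
  by rewrite !dotBl dot_fourier_sum leq_max ltnSn orbT.
apply: le_trans (dot_CS normE _ _) _.
have -> : nr (e k) = 1.
  apply/eqP; rewrite -(eqrXn2 (n := 2)) ?nr_ge0// (nr_sqrE normE) orth_e eqxx.
  by rewrite expr1n.
by rewrite mulr1 nrBC ltW// NP//= leq_maxl.
Qed.

End OrthonormalSeries.

(** * Reflection and multiplication operators *)

Section CircleOperators.
Context (R : realType).
Local Notation m := (circle_measure R).
Implicit Types (z : circle R) (u v : L2 m) (w f g : circle R -> R[i]).

Lemma mC_comp_conj f : mC f -> mC (f \o @circle_conj R).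
Proof.
by move=> [fr fi]; split; [exact: (measurableT_comp fr (@measurable_circle_conj R))|exact: (measurableT_comp fi (@measurable_circle_conj R))].
Qed.

Lemma CLfun2_comp_conj f : f \in CLfun m 2%:E -> (f \o @circle_conj R) \in CLfun m 2%:E.
Proof.
move=> /CLfun2P[mf fi]; apply/CLfun2P; split; first exact: mC_comp_conj.
rewrite (ge0_circle_integral_conj (F := fun z => (cm (f z) ^+ 2)%:E))//.
- exact: measurable_cm_sqr.
- by move=> z; rewrite lee_fin sqr_ge0.
Qed.

Lemma reflectionE u : {ae m, forall z, reflection u z = u (circle_conj z)}.
Proof. exact: (toL2E (CLfun2_comp_conj (L2_funP u))). Qed.

Lemma reflection_linear : linear (@reflection R).
Proof.
move=> a u v; apply: L2_eq.
apply: filterS3 (reflectionE (a *: u + v)) (ae_circle_conj (L2_linE a u v))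
  (filterI (L2_linE a (reflection u) (reflection v)) (filterI (reflectionE u) (reflectionE v))).
by move=> z -> -> [-> [-> ->]].
Qed.

Lemma nr_reflection u : nr (reflection u) = nr u.
Proof.
apply/eqP; rewrite -(eqrXn2 (n := 2)) ?nr_ge0//; apply/eqP/EFin_inj; rewrite !L2_nr_sqr.
transitivity (\int[m]_z (cm (u (circle_conj z)) ^+ 2)%:E)%E.
  apply: ge0_ae_eq_integral => //.
  - exact/measurable_cm_sqr/L2_mC.
  - by apply/measurable_cm_sqr/(mC_comp_conj (L2_mC u)).
  - by move=> z _; rewrite lee_fin sqr_ge0.
  - by move=> z _; rewrite lee_fin sqr_ge0.
  by apply: filterS (reflectionE u) => z -> _.
rewrite (ge0_circle_integral_conj (F := fun z => (cm (u z) ^+ 2)%:E))//.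
- exact/measurable_cm_sqr/L2_mC.
- by move=> z; rewrite lee_fin sqr_ge0.
Qed.

Lemma circle_Rintegral_conj (F : circle R -> R) : measurable_fun [set: circle R] F ->
  (\int[m]_z F (circle_conj z) = \int[m]_z F z)%R.
Proof.
move=> mF; rewrite /Rintegral; congr fine; rewrite [LHS]integralE [RHS]integralE.
have mF' : measurable_fun [set: circle R] (EFin \o F) by exact/measurable_EFinP.
congr (_ - _)%E.
  rewrite -(ge0_circle_integral_conj (F := (EFin \o F)^\+%E))//; last first.
    exact: measurable_funepos.
  by apply: eq_integral => z _; rewrite !funeposE.
rewrite -(ge0_circle_integral_conj (F := (EFin \o F)^\-%E))//; last first.
  exact: measurable_funeneg.
by apply: eq_integral => z _; rewrite !funenegE.
Qed.

Lemma Cintegral_conj f : mC f -> Cintegral m (fun z => f (circle_conj z)) = Cintegral m f.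
Proof.
move=> [mr mi]; apply: Defs.eqC => /=.
  exact: (circle_Rintegral_conj (F := fun z => complex.Re (f z))).
exact: (circle_Rintegral_conj (F := fun z => complex.Im (f z))).
Qed.

Lemma L2_dot_ae u v f g : {ae m, forall z, u z = f z} -> {ae m, forall z, v z = g z} ->
  f \in CLfun m 2%:E -> g \in CLfun m 2%:E ->
  L2_dot u v = Cintegral m (fun z => f z * conjc (g z)).
Proof.
move=> uf vg fL gL; apply: ae_eq_Cintegral; try by apply: CLfun2_mulJ => //; exact: L2_funP.
by apply: filterS2 uf vg => z -> ->.
Qed.

Lemma dot_reflection u v : L2_dot (reflection u) v = L2_dot u (reflection v).
Proof.
rewrite (L2_dot_ae (reflectionE u) (aeW _ (fun z => erefl (v z))))//; last first.
- exact: L2_funP.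
- exact: CLfun2_comp_conj (L2_funP u).
rewrite (L2_dot_ae (aeW _ (fun z => erefl (u z))) (reflectionE v))//; last first.
- exact: CLfun2_comp_conj (L2_funP v).
- exact: L2_funP.
rewrite -Cintegral_conj; last first.
  by apply: mCM; [exact: (mC_comp_conj (L2_mC u))|apply: mC_conj; exact: L2_mC].
by congr Cintegral; apply/funext => z; rewrite /= circle_conjK.
Qed.

Definition bounded_symbol w := exists2 c, 0 <= c & ae_bounded m c w.

Lemma bounded_symbolM w f : bounded_symbol w -> bounded_symbol f ->
  bounded_symbol (fun z => w z * f z).
Proof.
move=> [c c0 [mw wc]] [b b0 [mf fb]]; exists (c * b); first exact: mulr_ge0.
split; first exact: mCM.
by apply: filterS2 wc fb => z h1 h2; rewrite cmM ler_pM ?cm_ge0.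
Qed.

Lemma bounded_symbolD w f : bounded_symbol w -> bounded_symbol f ->
  bounded_symbol (fun z => w z + f z).
Proof.
move=> [c c0 [mw wc]] [b b0 [mf fb]]; exists (c + b); first exact: addr_ge0.
split; first exact: mCD.
by apply: filterS2 wc fb => z h1 h2; rewrite (le_trans (cmD _ _))// lerD.
Qed.

Lemma bounded_symbol_cst c : bounded_symbol (fun=> c).
Proof. by exists (cm c); [exact: cm_ge0|split; [exact: mC_cst|exact: aeW]]. Qed.

Lemma bounded_symbol_conj w : bounded_symbol w -> bounded_symbol (fun z => conjc (w z)).
Proof.
move=> [c c0 [mw wc]]; exists c => //; split; first exact: mC_conj.
by apply: filterS wc => z; rewrite cmJ.
Qed.

Lemma bounded_symbol_refl w : bounded_symbol w -> bounded_symbol (fun z => w (circle_conj z)).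
Proof.
move=> [c c0 [mw wc]]; exists c => //; split; first exact: mC_comp_conj.
exact: (ae_circle_conj (Q := fun z => cm (w z) <= c)).
Qed.

Lemma bounded_symbol_L2 w : bounded_symbol w -> w \in CLfun m 2%:E.
Proof. by move=> [c c0 wc]; exact: ae_bounded_L2 c0 wc. Qed.

Lemma multiplicationE w u : bounded_symbol w ->
  {ae m, forall z, multiplication w u z = w z * u z}.
Proof. by move=> [c c0 wc]; exact: (toL2E (CLfun2_mul c0 wc (L2_funP u))). Qed.

Lemma multiplication_linear w : bounded_symbol w -> linear (multiplication w).
Proof.
move=> bw a u v; apply: L2_eq.
apply: filterS3 (multiplicationE (a *: u + v) bw) (L2_linE a u v)
  (filterI (L2_linE a (multiplication w u) (multiplication w v))
    (filterI (multiplicationE u bw) (multiplicationE v bw))).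
by move=> z -> -> [-> [-> ->]]; rewrite mulrDr mulrCA.
Qed.

Lemma multiplication_bound c w : 0 <= c -> ae_bounded m c w ->
  opbound (multiplication w : L2 m -> L2 m) c.
Proof.
move=> c0 wc u; apply: L2_nr_le => //.
have bw : bounded_symbol w by exists c.
apply: filterS2 (multiplicationE u bw) wc.2 => z -> wz.
by rewrite cmM ler_wpM2r ?cm_ge0.
Qed.

Lemma dot_multiplication w u v : bounded_symbol w ->
  L2_dot (multiplication w u) v = L2_dot u (multiplication (fun z => conjc (w z)) v).
Proof.
move=> bw; have bw' := bounded_symbol_conj bw.
have [c c0 wc] := bw; have [c' c'0 wc'] := bw'.
rewrite (L2_dot_ae (multiplicationE u bw) (aeW _ (fun z => erefl (v z))))//; last first.
- exact: L2_funP.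
- exact: CLfun2_mul c0 wc (L2_funP u).
rewrite (L2_dot_ae (aeW _ (fun z => erefl (u z))) (multiplicationE v bw'))//; last first.
- exact: CLfun2_mul c'0 wc' (L2_funP v).
- exact: L2_funP.
by congr Cintegral; apply/funext => z; rewrite rmorphM /= conjcK mulrCA mulrA.
Qed.

Lemma multiplicationA w f u : bounded_symbol w -> bounded_symbol f ->
  multiplication w (multiplication f u) = multiplication (fun z => w z * f z) u.
Proof.
move=> bw bf; apply: L2_eq.
apply: filterS3 (multiplicationE (multiplication f u) bw) (multiplicationE u bf)
  (multiplicationE u (bounded_symbolM bw bf)) => z -> -> ->.
by rewrite mulrA.
Qed.

Lemma reflection_multiplication w u : bounded_symbol w ->
  reflection (multiplication w u) = multiplication (fun z => w (circle_conj z)) (reflection u).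
Proof.
move=> bw; apply: L2_eq.
apply: filterS3 (reflectionE (multiplication w u)) (ae_circle_conj (multiplicationE u bw))
  (filterI (multiplicationE (reflection u) (bounded_symbol_refl bw)) (reflectionE u)).
by move=> z -> -> [-> ->].
Qed.

Lemma multiplicationD w f u : bounded_symbol w -> bounded_symbol f ->
  multiplication (fun z => w z + f z) u = multiplication w u + multiplication f u.
Proof.
move=> bw bf; apply: L2_eq.
apply: filterS3 (multiplicationE u (bounded_symbolD bw bf))
  (L2_addE (multiplication w u) (multiplication f u))
  (filterI (multiplicationE u bw) (multiplicationE u bf)) => z -> -> [-> ->].
by rewrite mulrDl.
Qed.

End CircleOperators.

(** * Integration in the angle and the exponentials z^n *)

Section CircleIntegrals.
Context (R : realType).
Local Notation m := (circle_measure R).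
Local Notation mu := (@lebesgue_measure R).

Lemma integral_derive_eq0 (G g : R -> R) : (forall t : R, is_derive t (1 : R) G (g t)) ->
  continuous g -> G (2 * pi) = G 0 ->
  (\int[mu]_(t in `[0%R, (2 * pi)%R]) (g t)%:E = 0)%E.
Proof.
move=> dG cg GG.
have cG : continuous G.
  by move=> t; apply: differentiable_continuous; apply/derivable1_diffP; have [] := dG t.
rewrite (@continuous_FTC2 R g G 0 (2 * pi)).
- by rewrite GG -EFinB subrr.
- exact: twopi_gt0.
- exact: continuous_subspaceT.
- split.
  + by move=> t _; have [] := dG t.
  + exact/cvg_at_right_filter/cG.
  + exact/cvg_at_left_filter/cG.
- by move=> t _; rewrite derive1E; have [_ ->] := dG t.
Qed.

(** Positive and negative parts are treated separately; boundedness makes both integrals finite, so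
    the factor 1 / (2 pi) distributes over their difference. *)
Lemma circle_integral (F : circle R -> R) (c : R) : measurable_fun [set: circle R] F ->
  (forall z, `|F z| <= c) ->
  (\int[m]_z (F z)%:E = (2 * pi)^-1%:E * \int[mu]_(t in `[0%R, (2 * pi)%R]) (F (cis t))%:E)%E.
Proof.
move=> mF Fc; have mF' : measurable_fun [set: circle R] (EFin \o F) by exact/measurable_EFinP.
have c0 : 0 <= c by apply: le_trans (Fc (cis 0)).
rewrite [LHS]integralE [in RHS]integralE.
have p0 : 0 < (2 * pi)^-1 :> R by rewrite invr_gt0 twopi_gt0.
have fin (G : circle R -> \bar R) : measurable_fun [set: circle R] G -> (forall z, 0 <= G z <= c%:E)%E ->
    (\int[m]_z G z = (2 * pi)^-1%:E * \int[mu]_(t in `[0%R, (2 * pi)%R]) G (cis t))%E /\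
    (\int[mu]_(t in `[0%R, (2 * pi)%R]) G (cis t))%E \is a fin_num.
  move=> mG Gc; have G0 z : (0 <= G z)%E by have /andP[] := Gc z.
  have h := ge0_circle_integral mG G0; split => //.
  rewrite ge0_fin_numE ?integral_ge0//.
  have : (\int[m]_z G z < +oo)%E.
    apply: (@le_lt_trans _ _ (\int[m]_z (cst c%:E z))%E); last first.
      by rewrite integral_cst//= probability_setT mule1 ltry.
    by apply: ge0_le_integral => // z _; have /andP[] := Gc z.
  rewrite h; case: (\int[mu]_(_ in _) _)%E => [r _||]; first exact: ltry.
    by rewrite gt0_muley ?lte_fin// ltxx.
  by [].
have bd (f : circle R -> \bar R) z : (`|f z| <= c%:E -> 0 <= maxe (f z) 0 <= c%:E)%E.
  move=> fz; rewrite le_max lexx orbT /= ge_max lee_fin c0 andbT.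
  by apply: le_trans fz; exact: lee_abs.
have [|z|h1 f1] := fin (EFin \o F)^\+%E.
- exact: measurable_funepos.
- by rewrite funeposE; apply: (bd (EFin \o F)); rewrite lee_fin.
have [|z|h2 f2] := fin (EFin \o F)^\-%E.
- exact: measurable_funeneg.
- by rewrite funenegE; apply: (bd (fun z => - (F z)%:E)%E); rewrite abseN lee_fin.
have e1 : (\int[mu]_(t in `[0%R, (2 * pi)%R]) (fun t => (F (cis t))%:E)^\+ t =
    \int[mu]_(t in `[0%R, (2 * pi)%R]) (EFin \o F)^\+ (cis t))%E.
  by apply: eq_integral => t _; rewrite !funeposE.
have e2 : (\int[mu]_(t in `[0%R, (2 * pi)%R]) (fun t => (F (cis t))%:E)^\- t =
    \int[mu]_(t in `[0%R, (2 * pi)%R]) (EFin \o F)^\- (cis t))%E.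
  by apply: eq_integral => t _; rewrite !funenegE.
rewrite e1 e2 h1 h2; apply/esym/muleBr => //.
by rewrite fin_num_adde_defl// fin_numN.
Qed.

Lemma circle_Rintegral_derive (F : circle R -> R) (c : R) (G : R -> R) :
  measurable_fun [set: circle R] F -> (forall z, `|F z| <= c) ->
  (forall t : R, is_derive t (1 : R) G (F (cis t))) -> continuous (fun t => F (cis t)) ->
  G (2 * pi) = G 0 -> (\int[m]_z F z = 0)%R.
Proof.
move=> mF Fc dG cF GG; rewrite /Rintegral (circle_integral mF Fc).
by rewrite (integral_derive_eq0 dG)// mule0.
Qed.

Definition ez (n : int) (z : circle R) : R[i] := circle_val z ^ n.

Lemma ezD n k z : ez (n + k) z = ez n z * ez k z.
Proof. by rewrite /ez expfzDr ?circle_val_neq0. Qed.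

Lemma ez0 z : ez 0 z = 1. Proof. exact: expr0z. Qed.

Lemma ez_conj n z : conjc (ez n z) = ez (- n) z.
Proof.
have nat_case (k : nat) : conjc (ez k z) = ez (- k%:Z) z.
  by rewrite /ez -exprnP rmorphXn /= -circle_val_inv exprnP exprz_inv.
by case: n => n; [exact: nat_case|rewrite NegzE -nat_case conjcK opprK].
Qed.

Lemma cm_ez n z : cm (ez n z) = 1.
Proof.
have nat_case (k : nat) : cm (ez k z) = 1 by rewrite /ez -exprnP cmX cm_circle expr1n.
by case: n => n; [exact: nat_case|rewrite NegzE -ez_conj cmJ].
Qed.

Lemma ez_circle_conj n z : ez n (circle_conj z) = ez (- n) z.
Proof. by rewrite /ez circle_val_conj -circle_val_inv exprz_inv. Qed.

Lemma ez_cis n t : ez n (cis t) = cos (n%:~R * t) +i* sin (n%:~R * t).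
Proof.
have nat_case (k : nat) : ez k (cis t) = cos (k%:R * t) +i* sin (k%:R * t).
  elim: k => [|k IH]; first by rewrite ez0 mul0r cos0 sin0.
  rewrite -addn1 PoszD ezD IH natrD mulrDl mul1r cosD sinD.
  by apply: Defs.eqC; rewrite ?Defs.ReM ?Defs.ImM /ez expr1z circle_val_cis /=; ring.
case: n => n; first exact: nat_case.
rewrite NegzE -ez_conj nat_case rmorphN /= mulNr cosN sinN.
by [].
Qed.

Lemma mC_ez n : mC (ez n).
Proof.
have nat_case (k : nat) : mC (ez k).
  elim: k => [|k IH].
    by rewrite (_ : ez 0 = fun=> 1); [exact: mC_cst|apply/funext => z; exact: ez0].
  rewrite (_ : ez k.+1 = fun z => circle_val z * ez k z).
    by apply: mCM => //; exact: mC_circle_val.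
  by apply/funext => z; rewrite /ez -!exprnP exprS.
case: n => n; first exact: nat_case.
rewrite NegzE (_ : ez _ = fun z => conjc (ez n.+1 z)); first exact: mC_conj.
by apply/funext => z; rewrite ez_conj.
Qed.

Lemma bounded_ez n : bounded_symbol (ez n).
Proof.
by exists 1 => //; split; [exact: mC_ez|apply: aeW => z; rewrite cm_ez].
Qed.

(** For n <> 0 the parts cos (n t) and sin (n t) have the 2 pi-periodic primitives sin (n t) / n and
    - cos (n t) / n. *)
Lemma Cintegral_ez n : Cintegral m (ez n) = (n == 0)%:R.
Proof.
have [->|n0] := eqVneq n 0.
  apply: Defs.eqC => /=.
    have m1 : m setT = 1%E by exact: probability_setT.
    by rewrite Rintegral_cst//= mul1r; exact: (congr1 fine m1).
  by rewrite Rintegral_cst// mul0r.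
have [mr mi] := mC_ez n.
have nz : n%:~R != 0 :> R by rewrite intr_eq0.
have dlin (t : R) : is_derive t (1 : R) (fun t : R => n%:~R * t) n%:~R.
  by apply: is_derive_eq (is_deriveZ n%:~R (is_derive_id t 1)) _; rewrite /GRing.scale /= mulr1.
have clin : continuous (fun t : R => n%:~R * t).
  by move=> t; apply: cvgM; [exact: cvg_cst|exact: cvg_id].
have per : ez n (cis (2 * pi)) = ez n (cis 0) by rewrite -[2 * pi]add0r cisD2pi.
rewrite !ez_cis mulr0 cos0 sin0 in per; case: per => percos persin.
have dsc (f f' : R -> R) (t : R) : (forall t : R, is_derive t (1 : R) f (f' t)) ->
    is_derive t (1 : R) (fun t => n%:~R^-1 * f (n%:~R * t)) (f' (n%:~R * t)).
  move=> df; have d1 := @is_derive1_comp _ f (fun t : R => n%:~R * t) t _ _ (df _) (dlin t).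
  by apply: is_derive_eq (is_deriveZ n%:~R^-1 d1) _; rewrite /GRing.scale /= mulrCA mulVf ?mulr1.
apply: Defs.eqC => /=.
  apply: (circle_Rintegral_derive (c := 1) (G := fun t => n%:~R^-1 * sin (n%:~R * t))) => //.
  - by move=> z; rewrite (le_trans (ler_Re_cm _))// cm_ez.
  - by move=> t; rewrite ez_cis /=; exact: (dsc sin cos).
  - rewrite (_ : (fun t => _) = cos \o (fun t : R => n%:~R * t)).
      by move=> t; apply: continuous_comp; [exact: clin|exact: continuous_cos].
    by apply/funext => t /=; rewrite ez_cis.
  - by rewrite persin !mulr0 sin0 mulr0.
apply: (circle_Rintegral_derive (c := 1) (G := fun t => n%:~R^-1 * - cos (n%:~R * t))) => //.
- by move=> z; rewrite (le_trans (ler_Im_cm _))// cm_ez.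
- move=> t; rewrite ez_cis /=; apply: (dsc (fun t => - cos t) sin) => u.
  by apply: is_derive_eq (is_deriveN (is_derive_cos u)) _; rewrite opprK.
- rewrite (_ : (fun t => _) = sin \o (fun t : R => n%:~R * t)).
    by move=> t; apply: continuous_comp; [exact: clin|exact: continuous_sin].
  by apply/funext => t /=; rewrite ez_cis.
- by rewrite percos mulr0 cos0.
Qed.

End CircleIntegrals.

Section L2Dot.
Context d (T : measurableType d) (R : realType) (mu : probability T R).
Local Notation ldot := (@L2_dot _ _ R mu).
Implicit Types (u v w : L2 mu) (a : R[i]).

Lemma L2_dotDl u v w : L2_dot (u + v) w = L2_dot u w + L2_dot v w.
Proof. exact: (dotDl ldot). Qed.

Lemma L2_dotBl u v w : L2_dot (u - v) w = L2_dot u w - L2_dot v w.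
Proof. exact: (dotBl ldot). Qed.

Lemma L2_dotBr u v w : L2_dot u (v - w) = L2_dot u v - L2_dot u w.
Proof. exact: (dotBr ldot). Qed.

Lemma L2_dotZl a u v : L2_dot (a *: u) v = a * L2_dot u v.
Proof. exact: (dotZl ldot). Qed.

Lemma L2_dotZr a u v : L2_dot u (a *: v) = conjc a * L2_dot u v.
Proof. exact: (dotZr ldot). Qed.

Lemma L2_dot0l v : L2_dot 0 v = 0 :> R[i].
Proof. exact: (dot0l ldot). Qed.

Lemma L2_dot_sumr I (r : seq I) (F : I -> L2 mu) v :
  L2_dot v (\sum_(i <- r) F i) = \sum_(i <- r) L2_dot v (F i).
Proof. exact: (dot_sumr ldot). Qed.

Lemma L2_dot_conj u v : L2_dot u v = conjc (L2_dot v u).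
Proof. exact: (dotC ldot). Qed.

Lemma L2_pythagoras u v : L2_dot u v = 0 -> nr (u + v) ^+ 2 = nr u ^+ 2 + nr v ^+ 2.
Proof. exact: (nr_pythagoras (dot := ldot) (@L2_normE _ _ _ _)). Qed.

Lemma L2_dot_CS u v : cm (L2_dot u v) <= nr u * nr v.
Proof. exact: (dot_CS (dot := ldot) (@L2_normE _ _ _ _)). Qed.

End L2Dot.

(** * Hardy space and Hankel operators *)

Section HardySpace.
Context (R : realType).
Local Notation m := (circle_measure R).
Implicit Types (z : circle R) (u v : L2 m) (w f g : circle R -> R[i]) (h : H2 R) (n k : int).
Local Notation ldot := (@L2_dot _ _ R m).

Definition ezL2 n : L2 m := toL2 m (ez n).

Lemma E_ae n : {ae m, forall z, ezL2 n z = ez n z}.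
Proof. exact: (toL2E (bounded_symbol_L2 (bounded_ez R n))). Qed.

Lemma dot_E n k : L2_dot (ezL2 n) (ezL2 k) = (n == k)%:R.
Proof.
rewrite (L2_dot_ae (E_ae n) (E_ae k)); try exact: bounded_symbol_L2 (bounded_ez R _).
rewrite (_ : (fun z => _) = ez (n - k)); last first.
  by apply/funext => z; rewrite ez_conj ezD.
by rewrite Cintegral_ez subr_eq0.
Qed.

Lemma multiplication_E n k : multiplication (ez n) (ezL2 k) = ezL2 (n + k).
Proof.
apply: L2_eq; apply: filterS3 (multiplicationE (ezL2 k) (bounded_ez R n)) (E_ae k) (E_ae (n + k)).
by move=> z -> -> ->; rewrite ezD.
Qed.

Lemma reflection_E n : reflection (ezL2 n) = ezL2 (- n).
Proof.
apply: L2_eq; apply: filterS3 (reflectionE (ezL2 n)) (ae_circle_conj (E_ae n)) (E_ae (- n)).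
by move=> z -> -> ->; rewrite ez_circle_conj.
Qed.

Lemma monomialE (k : nat) : monomial R k = ezL2 k. Proof. by []. Qed.

Lemma dot_multiplication_ez n u v :
  L2_dot (multiplication (ez n) u) v = L2_dot u (multiplication (ez (- n)) v).
Proof.
rewrite [LHS](dot_multiplication u v (bounded_ez R n)).
by congr (L2_dot u (multiplication _ v)); apply/funext => z; exact: ez_conj.
Qed.

Lemma dot_continuous_eq0 (S : set (L2 m)) u v : (forall s, S s -> L2_dot u s = 0) ->
  closure S v -> L2_dot u v = 0.
Proof.
move=> uS Sv; apply: cm_eq0; apply/eqP; rewrite eq_le cm_ge0 andbT.
apply/ler_addgt0Pr => d d0; rewrite add0r.
have u1 : 0 < nr u + 1 by rewrite ltr_wpDl ?nr_ge0.
have [|s [Ss sd]] := Sv [set s | nr (v - s) < d / (nr u + 1)].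
  by apply/nbhs_nrP; exists (d / (nr u + 1)) => //; rewrite divr_gt0.
have -> : L2_dot u v = L2_dot u (v - s) by rewrite L2_dotBr (uS s Ss) subr0.
rewrite (le_trans (L2_dot_CS _ _))//.
rewrite (@le_trans _ _ ((nr u + 1) * (d / (nr u + 1))))//.
  by rewrite ler_pM ?nr_ge0// ?ltW// ltrDl.
by rewrite mulrC divfK ?gt_eqF.
Qed.

Lemma hardy_orth u : (forall k : nat, L2_dot u (ezL2 k) = 0) -> forall h, L2_dot u (\val h) = 0.
Proof.
move=> uE h; apply: dot_continuous_eq0 (set_mem (valP h)) => _ [N [c ->]].
by rewrite L2_dot_sumr big1// => k _; rewrite L2_dotZr monomialE uE mulr0.
Qed.

Lemma hardy_closed (v : nat -> L2 m) u : (forall N, v N \in @hardy R) -> v @ \oo --> u ->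
  u \in @hardy R.
Proof.
move=> vh vu; apply/mem_set; rewrite [X in X u](closure_id _).1; last exact: closed_closure.
move=> B nB; have : \forall N \near \oo, B (v N) by exact: vu.
case=> N _ NB; exists (v N); split; last exact: (NB N (leqnn N)).
exact: set_mem (vh N).
Qed.

Lemma E_hardy (k : nat) : ezL2 k \in @hardy R.
Proof.
apply/mem_set/subset_closure; exists k.+1, (fun i => (i == k :> nat)%:R).
rewrite (bigD1 ord_max)//= eqxx scale1r big1 ?addr0// => i ik.
by rewrite (_ : (i == k :> nat) = false) ?scale0r//; apply: contraNF ik => /eqP ik; apply/eqP/val_inj.
Qed.

Lemma hardy_dot_E_neg h (k : nat) : L2_dot (\val h) (ezL2 (Negz k)) = 0.
Proof.
rewrite L2_dot_conj hardy_orth ?conjc0// => j; rewrite dot_E.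
by rewrite (_ : (_ == _) = false)//.
Qed.

Lemma orth_E_nat i j : ldot (ezL2 (Posz i)) (ezL2 (Posz j)) = (i == j)%:R.
Proof. by rewrite dot_E eqz_nat. Qed.

Local Notation fs := (fourier_sum ldot (fun k : nat => ezL2 k)).

Lemma fourier_sum_hardy N u : fs N u \in @hardy R.
Proof. by apply: rpred_sum => k _; apply: rpredZ; exact: E_hardy. Qed.

(** The projection is the limit of the Fourier sums over nonnegative frequencies; hence the
    selection in [riesz_proj] never falls back on its default. *)
Lemma riesz_exists u : exists h, forall h', L2_dot (u - \val h) (\val h') = 0.
Proof.
have [w uw] := fourier_sum_cvg (dot := ldot) (@L2_normE _ _ _ _) orth_E_nat u (@L2_complete _ _ _ _).
have wh : w \in @hardy R by apply: hardy_closed uw => N; exact: fourier_sum_hardy.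
exists (MkH2 wh); apply: hardy_orth => k.
exact: (fourier_limit_orth (@L2_normE _ _ _ _) orth_E_nat k uw).
Qed.

Lemma riesz_projP u h : L2_dot (u - \val (riesz_proj u)) (\val h) = 0.
Proof. by rewrite /riesz_proj; case: xgetP => [g _|no]; [exact|have [g /no] := riesz_exists u]. Qed.

Lemma dot_riesz_proj u h : L2_dot (\val (riesz_proj u)) (\val h) = L2_dot u (\val h).
Proof. by apply/esym/eqP; rewrite -subr_eq0 -L2_dotBl riesz_projP. Qed.

Lemma dot_riesz_projr u h : L2_dot (\val h) (\val (riesz_proj u)) = L2_dot (\val h) u.
Proof. by rewrite L2_dot_conj dot_riesz_proj -L2_dot_conj. Qed.

Lemma H2_normE h : `|h| = sqrtC (H2_dot h h). Proof. by []. Qed.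

Lemma nr_H2 h : nr h = nr (\val h). Proof. by []. Qed.

Lemma riesz_proj_uniq u h : (forall k : nat, L2_dot (u - \val h) (ezL2 k) = 0) ->
  riesz_proj u = h.
Proof.
move=> uE; apply: (dot_inj (dot := @H2_dot R)) => h'.
rewrite [LHS]dot_riesz_proj; apply/eqP; rewrite -subr_eq0 -L2_dotBl.
by rewrite hardy_orth.
Qed.

Lemma riesz_proj_linear : linear (@riesz_proj R).
Proof.
move=> a u v; apply: (dot_inj (dot := @H2_dot R)) => h.
rewrite [LHS]dot_riesz_proj L2_dotDl L2_dotZl [RHS](dotDl (@H2_dot R)).
congr (_ + _); last exact/esym/dot_riesz_proj.
by rewrite [RHS](dotZl (@H2_dot R)); congr (_ * _); exact/esym/dot_riesz_proj.
Qed.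

Lemma riesz_proj_bound : opbound (@riesz_proj R) 1.
Proof.
move=> u; rewrite mul1r nr_H2 -ler_sqr ?nnegrE ?nr_ge0//.
have h := L2_pythagoras (riesz_projP u (riesz_proj u)); rewrite subrK in h.
by rewrite h lerDr sqr_ge0.
Qed.

Lemma riesz_proj_id h : riesz_proj (\val h) = h.
Proof. by apply: riesz_proj_uniq => k; rewrite subrr L2_dot0l. Qed.

(** The limit of the partial sums lies in H^2 and has the nonnegative coefficients of h, so both are
    the projection of h. *)
Lemma hardy_fourier_cvg h : (fs^~ (\val h)) @ \oo --> \val h.
Proof.
have [w uw] := fourier_sum_cvg (dot := ldot) (@L2_normE _ _ _ _) orth_E_nat (\val h) (@L2_complete _ _ _ _).
have wh : w \in @hardy R by apply: hardy_closed uw => N; exact: fourier_sum_hardy.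
suff e : h = MkH2 wh by rewrite [X in _ --> X](congr1 val e); exact: uw.
rewrite -[LHS]riesz_proj_id; apply: riesz_proj_uniq => k.
exact: (fourier_limit_orth (@L2_normE _ _ _ _) orth_E_nat k uw).
Qed.

Lemma H2_complete : nr_complete (H2 R).
Proof.
move=> x xC; have [|w xw] := @L2_complete _ _ _ m (fun N => \val (x N)).
  by move=> e e0; have [N NP] := xC e e0; exists N => i j iN jN; have := NP i j iN jN; rewrite nr_H2 raddfB.
have wh : w \in @hardy R by apply: hardy_closed xw => N; exact: valP.
exists (MkH2 wh); apply/cvg_nrP => e e0; have /cvg_nrP/(_ e e0) := xw.
by apply: filterS => N; rewrite nr_H2 raddfB.
Qed.

End HardySpace.

Section Hankel.
Context (R : realType).
Local Notation m := (circle_measure R).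
Implicit Types (z : circle R) (u v : L2 m) (w f g : circle R -> R[i]) (h : H2 R) (n k : int).
Local Notation ldot := (@L2_dot _ _ R m).

Lemma multiplication_opbound w : bounded_symbol w ->
  exists2 b, 0 <= b & opbound (multiplication w : L2 m -> L2 m) b.
Proof. by move=> [c c0 wc]; exists c => //; exact: multiplication_bound. Qed.

Lemma hankel_linear w : bounded_symbol w -> linear (hankel w).
Proof.
move=> bw a h h'; rewrite /hankel.
rewrite -[H2_val (_ + _)]/(\val (a *: h + h')) linearP.
by rewrite reflection_linear multiplication_linear// riesz_proj_linear.
Qed.

Lemma hankel_opbound w : bounded_symbol w -> exists2 b, 0 <= b & opbound (hankel w) b.
Proof.
move=> /multiplication_opbound[b b0 wb]; exists b => // h.
rewrite (le_trans (riesz_proj_bound _))// mul1r (le_trans (wb _))//.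
by rewrite nr_reflection nr_H2.
Qed.

Definition symbol_adj w z := conjc (w (circle_conj z)).

Lemma symbol_adj_bounded w : bounded_symbol w -> bounded_symbol (symbol_adj w).
Proof. by move=> bw; exact: (bounded_symbol_conj (bounded_symbol_refl bw)). Qed.

(** W is self-adjoint and W w = (w o conj) W for multiplication operators, so the adjoint of P_+ w W
    on H^2 is P_+ W conj(w), again of Hankel form. *)
Lemma hankel_adj w h h' : bounded_symbol w ->
  H2_dot (hankel w h) h' = H2_dot h (hankel (symbol_adj w) h').
Proof.
move=> bw; rewrite [LHS]dot_riesz_proj dot_multiplication// dot_reflection.
rewrite reflection_multiplication; last exact: bounded_symbol_conj.
by rewrite [RHS]dot_riesz_projr.
Qed.

Lemma hankelD w f h : bounded_symbol w -> bounded_symbol f ->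
  hankel (fun z => w z + f z) h = hankel w h + hankel f h.
Proof. by move=> bw bf; rewrite /hankel multiplicationD// (linD (@riesz_proj_linear R)). Qed.

Lemma hankel0 h : hankel (fun=> 0) h = 0.
Proof.
have b0 := bounded_symbol_cst (0 : R[i]).
have e := hankelD h b0 b0.
rewrite (_ : (fun=> _) = fun=> 0) in e; last by apply/funext => z; rewrite addr0.
apply: (addIr (hankel (fun=> 0) h)); exact: etrans (esym e) (esym (add0r _)).
Qed.

Lemma bounded_symbol_sum (n : nat) (w : 'I_n -> circle R -> R[i]) : (forall l, bounded_symbol (w l)) ->
  bounded_symbol (fun z => \sum_(l < n) w l z).
Proof.
elim: n w => [|n IH] w bw.
  by under [X in bounded_symbol X]funext do rewrite big_ord0; exact: bounded_symbol_cst.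
under [X in bounded_symbol X]funext do rewrite big_ord_recl.
by apply: bounded_symbolD => //; exact: IH.
Qed.

Lemma hankel_sum (n : nat) (w : 'I_n -> circle R -> R[i]) h : (forall l, bounded_symbol (w l)) ->
  hankel (fun z => \sum_(l < n) w l z) h = \sum_(l < n) hankel (w l) h.
Proof.
elim: n w => [|n IH] w bw.
  rewrite big_ord0 (_ : (fun z => _) = fun=> 0) ?hankel0//.
  by apply/funext => z; rewrite big_ord0.
have bw' (l : 'I_n) := bw (lift ord0 l); have bs := bounded_symbol_sum bw'.
rewrite [RHS]big_ord_recl -(IH _ bw') -[RHS](hankelD h (bw ord0) bs).
apply: (congr1 (fun f => hankel f h)); apply/funext => z; exact: big_ord_recl.
Qed.

End Hankel.

(** * Products of Hankel operators *)

Section TrigonometricApproximation.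
Context (R : realType).
Local Notation m := (circle_measure R).
Implicit Types (z : circle R) (v : L2 m) (w f g : circle R -> R[i]) (h : H2 R) (n k : int) (M N q : nat).

(** Trigonometric polynomials of degree at most M; the inductive form allows proofs one exponential
    at a time. *)
Inductive trig M : (circle R -> R[i]) -> Prop :=
| trig_zero : trig M (fun=> 0)
| trig_add c n f : (`|n| <= M)%N -> trig M f -> trig M (fun z => c * ez n z + f z).

Lemma trig_mono M N f : (M <= N)%N -> trig M f -> trig N f.
Proof.
move=> MN; elim=> [|c n {}f nM _ IH]; first exact: trig_zero.
by apply: trig_add => //; exact: leq_trans MN.
Qed.

Lemma trigD M f g : trig M f -> trig M g -> trig M (fun z => f z + g z).
Proof.
move=> tf tg; elim: tf => [|c n {}f nM _ IH].
  by under [X in trig _ X]funext do rewrite add0r.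
by under [X in trig _ X]funext do rewrite -addrA; exact: trig_add.
Qed.

Lemma trig_ez M c n : (`|n| <= M)%N -> trig M (fun z => c * ez n z).
Proof.
move=> nM; rewrite (_ : (fun z => _) = fun z => c * ez n z + 0).
  by apply: trig_add => //; exact: trig_zero.
by apply/funext => z; rewrite addr0.
Qed.

Lemma trig_cst M c : trig M (fun=> c).
Proof.
rewrite (_ : (fun=> c) = fun z : circle R => c * ez 0 z); first exact: trig_ez.
by apply/funext => z; rewrite ez0 mulr1.
Qed.

Lemma trigM M N f g : trig M f -> trig N g -> trig (M + N) (fun z => f z * g z).
Proof.
move=> tf tg; elim: tf => [|c n {}f nM _ IH].
  by under [X in trig _ X]funext do rewrite mul0r; exact: trig_zero.
under [X in trig _ X]funext do rewrite mulrDl.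
apply: trigD IH => {f}; elim: tg => [|d k {}g kN _ IH].
  by under [X in trig _ X]funext do rewrite mulr0; exact: trig_zero.
rewrite (_ : (fun z => _) = fun z => (c * d) * ez (n + k) z + c * ez n z * g z).
  by apply: trig_add => //; lia.
by apply/funext => z; rewrite ezD; ring.
Qed.

Lemma trig_conj M f : trig M f -> trig M (fun z => conjc (f z)).
Proof.
elim=> [|c n {}f nM _ IH].
  by under [X in trig _ X]funext do rewrite conjc0; exact: trig_zero.
under [X in trig _ X]funext do rewrite rmorphD rmorphM /= ez_conj.
by apply: trig_add => //; rewrite abszN.
Qed.

Lemma trig_refl M f : trig M f -> trig M (fun z => f (circle_conj z)).
Proof.
elim=> [|c n {}f nM _ IH]; first exact: trig_zero.
under [X in trig _ X]funext do rewrite ez_circle_conj.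
by apply: trig_add => //; rewrite abszN.
Qed.

Lemma bounded_symbolZ (c : R[i]) f : bounded_symbol f -> bounded_symbol (fun z => c * f z).
Proof. by apply: bounded_symbolM; exact: bounded_symbol_cst. Qed.

Lemma bounded_symbolB w f : bounded_symbol w -> bounded_symbol f ->
  bounded_symbol (fun z => w z - f z).
Proof.
move=> bw bf; under [X in bounded_symbol X]funext do rewrite -[- f _]mulN1r.
by apply: bounded_symbolD => //; exact: bounded_symbolZ.
Qed.

Lemma trig_bounded M f : trig M f -> bounded_symbol f.
Proof.
elim=> [|c n {}f nM _ IH]; first exact: bounded_symbol_cst.
by apply: bounded_symbolD => //; apply: bounded_symbolZ; exact: bounded_ez.
Qed.

(** Smoothness reaches the operator estimates through this rate alone. The bound is almost
    everywhere, so it survives changes of the symbol on null sets. *)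
Definition trig_approx q f := exists2 C : R, 0 <= C &
  forall M, exists2 t, trig M t & {ae m, forall z, cm (f z - t z) <= C / M.+1%:R ^+ q}.

Lemma pow_gt0 M q : 0 < M.+1%:R ^+ q :> R. Proof. by rewrite exprn_gt0. Qed.

Lemma trig_approx_cst q c : trig_approx q (fun=> c).
Proof.
exists 0 => // M; exists (fun=> c); first exact: trig_cst.
by apply: aeW => z; rewrite subrr cm0 mul0r.
Qed.

Lemma trig_approx_D q f g : trig_approx q f -> trig_approx q g -> trig_approx q (fun z => f z + g z).
Proof.
move=> [C C0 fC] [D D0 gD]; exists (C + D) => [|M]; first exact: addr_ge0.
have [t tM ft] := fC M; have [s sM gs] := gD M.
exists (fun z => t z + s z); first exact: trigD.
apply: filterS2 ft gs => z hf hg; rewrite opprD addrACA mulrDl.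
by rewrite (le_trans (cmD _ _))// lerD.
Qed.

Lemma ltn_double_half M : (M < 2 * M./2.+1)%N.
Proof. by rewrite mul2n doubleS -[M in leqLHS]odd_double_half !ltnS -add1n leq_add2r leq_b1. Qed.

Lemma trig_approx_M q f g : bounded_symbol f -> bounded_symbol g -> trig_approx q f -> trig_approx q g ->
  trig_approx q (fun z => f z * g z).
Proof.
move=> [a a0 [_ fa]] [b b0 [_ gb]] [C C0 fC] [D D0 gD].
(* Approximants of degree M/2 keep the product within degree M. Halving the degree costs 2^q, and b
   + D bounds the approximant s of g. *)
exists (2 ^+ q * (a * D + (b + D) * C)) => [|M].
  by rewrite mulr_ge0 ?exprn_ge0// addr_ge0 ?mulr_ge0// addr_ge0.
have [t tM ft] := fC M./2; have [s sM gs] := gD M./2.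
exists (fun z => t z * s z).
  by apply: trig_mono (trigM tM sM); rewrite addnn -[leqRHS]odd_double_half leq_addl.
apply: filterS2 (filterI ft gs) (filterI fa gb) => z [hf hg] [ha hb].
set e := (M./2).+1%:R ^+ q in hf hg; have e0 : 0 < e by exact: pow_gt0.
have e1 : 1 <= e by rewrite /e exprn_ege1// ler1n.
have -> : f z * g z - t z * s z = f z * (g z - s z) + s z * (f z - t z) by ring.
have hs : cm (s z) <= b + D.
  have -> : s z = g z - (g z - s z) by rewrite opprB addrC subrK.
  rewrite (le_trans (cmD _ _))// cmN lerD// (le_trans hg)//.
  by rewrite ler_pdivrMr// ler_peMr.
have h1 : cm (f z * (g z - s z) + s z * (f z - t z)) <= (a * D + (b + D) * C) / e.
  rewrite (le_trans (cmD _ _))// !cmM mulrDl -!mulrA lerD// ler_pM ?cm_ge0//.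
rewrite (le_trans h1)//.
have X0 : 0 <= a * D + (b + D) * C by rewrite addr_ge0 ?mulr_ge0// addr_ge0.
rewrite ler_pdivrMr// mulrAC ler_pdivlMr ?pow_gt0// [2 ^+ q * _]mulrC -mulrA ler_wpM2l//.
rewrite /e -exprMn lerXn2r ?nnegrE ?mulr_ge0// -natrM ler_nat.
exact: ltn_double_half.
Qed.

Lemma trig_approx_conj q f : trig_approx q f -> trig_approx q (fun z => conjc (f z)).
Proof.
move=> [C C0 fC]; exists C => // M; have [t tM ft] := fC M.
exists (fun z => conjc (t z)); first exact: trig_conj.
by apply: filterS ft => z; rewrite -rmorphB cmJ.
Qed.

Lemma trig_approx_refl q f : trig_approx q f -> trig_approx q (fun z => f (circle_conj z)).
Proof.
move=> [C C0 fC]; exists C => // M; have [t tM ft] := fC M.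
exists (fun z => t (circle_conj z)); first exact: trig_refl.
exact: (ae_circle_conj (Q := fun z => cm (f z - t z) <= C / M.+1%:R ^+ q)).
Qed.

Lemma trig_approx_ae q f g : {ae m, forall z, f z = g z} -> trig_approx q f -> trig_approx q g.
Proof.
move=> fg [C C0 fC]; exists C => // M; have [t tM ft] := fC M.
by exists t => //; apply: filterS2 fg ft => z ->.
Qed.

End TrigonometricApproximation.

(** * Small Hankel operators, commutators and products *)

Section SmallProducts.
Context (R : realType).
Local Notation m := (circle_measure R).
Implicit Types (z : circle R) (v : L2 m) (w f g : circle R -> R[i]) (h : H2 R) (n k : int) (M N q : nat).

Lemma H2_val0 : \val (0 : H2 R) = 0.
Proof. exact: raddf0. Qed.

Lemma H2_valD h h' : \val (h + h') = \val h + \val h'.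
Proof. exact: raddfD. Qed.

Lemma H2_valP (a : R[i]) h h' : \val (a *: h + h') = a *: \val h + \val h'.
Proof. exact: linearP. Qed.

Lemma multiplication0 v : multiplication (fun=> 0) v = 0.
Proof.
apply: L2_eq; apply: filterS2 (multiplicationE v (bounded_symbol_cst 0)) (L2_zero m) => z -> ->.
exact: mul0r.
Qed.

Lemma multiplicationN w v : bounded_symbol w ->
  multiplication (fun z => -1 * w z) v = - multiplication w v.
Proof.
move=> bw; have bN := bounded_symbolZ (-1) bw; apply: (addIr (multiplication w v)).
apply: etrans (esym (multiplicationD v bN bw)) (etrans _ (esym (addNr _))).
rewrite (_ : (fun z => _) = fun=> 0); first exact: multiplication0.
by apply/funext => z; rewrite mulN1r addNr.
Qed.

Lemma multiplication_trig_add c n f v : bounded_symbol f ->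
  multiplication (fun z => c * ez n z + f z) v = c *: multiplication (ez n) v + multiplication f v.
Proof.
move=> bf; have bn := bounded_ez R n; have bcn := bounded_symbolZ c bn.
apply: L2_eq; apply: filterS3 (multiplicationE v (bounded_symbolD bcn bf))
  (L2_linE c (multiplication (ez n) v) (multiplication f v))
  (filterI (multiplicationE v bn) (multiplicationE v bf)).
by move=> z -> -> [-> ->]; rewrite mulrDl mulrA.
Qed.

Lemma multiplication_split w f v : bounded_symbol w -> bounded_symbol f ->
  multiplication w v = multiplication (fun z => w z - f z) v + multiplication f v.
Proof.
move=> bw bf; rewrite -[RHS](multiplicationD v (bounded_symbolB bw bf) bf).
by congr multiplication; apply/funext => z; rewrite subrK.
Qed.

(** W sends the frequencies of h, all above M, below -M, and a factor of degree M cannot bring them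
    back to nonnegative ones. *)
Lemma riesz_trig_reflection0 M f h : trig M f ->
  (forall k : nat, (k <= M)%N -> L2_dot (\val h) (ezL2 R k) = 0) ->
  riesz_proj (multiplication f (reflection (\val h))) = 0.
Proof.
move=> tf hM; elim: tf => [|c n {}f nM tf IH].
  by rewrite multiplication0; exact: (lin0 (@riesz_proj_linear R)).
rewrite (multiplication_trig_add _ _ _ (trig_bounded tf)) riesz_proj_linear IH addr0.
suff -> : riesz_proj (multiplication (ez n) (reflection (\val h))) = 0 by rewrite scaler0.
apply: riesz_proj_uniq => k; rewrite H2_val0 subr0 dot_multiplication_ez multiplication_E dot_reflection reflection_E.
have : (`|n| <= M)%N by [].
case e : (- (- n + k)) => [j|j] _; last exact: hardy_dot_E_neg.
apply: hM; lia.
Qed.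

Lemma multiplication_nr w v (b : R) : 0 <= b -> bounded_symbol w ->
  {ae m, forall z, cm (w z) <= b} -> nr (multiplication w v) <= b * nr v.
Proof. by move=> b0 [c c0 [mw _]] wb; apply: multiplication_bound. Qed.

Lemma small_hankel q f : bounded_symbol f -> trig_approx q f -> small q (hankel f).
Proof.
move=> bf [C C0 fC]; apply: (@small_le _ _ _ _ _ C 1) => M.
exists 'I_M.+1, (fun (j : 'I_M.+1) (h : H2 R) => L2_dot (\val h) (ezL2 R j)).
split; first by rewrite card_ord mul1n.
  by move=> j a h h'; rewrite H2_valP L2_dotDl L2_dotZl.
move=> h h0; have [t tM ft] := fC M; have bt := trig_bounded tM.
rewrite /hankel (multiplication_split _ bf bt) (linD (@riesz_proj_linear R)).
rewrite (riesz_trig_reflection0 tM) ?addr0; last first.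
  by move=> k kM; exact: (h0 (Ordinal (kM : (k < M.+1)%N))).
rewrite (le_trans (riesz_proj_bound _))// mul1r.
have e0 : 0 <= C / M.+1%:R ^+ q by rewrite divr_ge0// exprn_ge0.
rewrite (le_trans (multiplication_nr _ e0 (bounded_symbolB bf bt) ft))//.
by rewrite nr_reflection.
Qed.

Lemma dot_riesz_E v (k : nat) : L2_dot (\val (riesz_proj v)) (ezL2 R k) = L2_dot v (ezL2 R k).
Proof. exact: (dot_riesz_proj v (MkH2 (E_hardy R k))). Qed.

Lemma multiplication_ez_nr n v : nr (multiplication (ez n) v) <= nr v.
Proof.
rewrite -[leRHS]mul1r; apply: multiplication_nr => //; first exact: bounded_ez.
by apply: aeW => z; rewrite cm_ez.
Qed.

(* If v has no Fourier coefficients of index |k| <= M, multiplication by z^n with |n| <= M moves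
   no frequency across the gap, hence commutes with P_+. *)
Lemma riesz_ez_comm M n v : (`|n| <= M)%N ->
  (forall k, (`|k| <= M)%N -> L2_dot v (ezL2 R k) = 0) ->
  \val (riesz_proj (multiplication (ez n) v)) = multiplication (ez n) (\val (riesz_proj v)).
Proof.
move=> nM v0; pose p := \val (riesz_proj v); have lz := multiplication_linear (bounded_ez R n).
have ph : multiplication (ez n) p \in @hardy R.
  have cv := @hardy_fourier_cvg R (riesz_proj v).
  apply: (@hardy_closed _ (fun N => multiplication (ez n) (fourier_sum (@L2_dot _ _ R m) (fun k : nat => ezL2 R k) N p))).
    move=> N; rewrite (lin_sum lz); apply: rpred_sum => k _; rewrite (linZ lz) multiplication_E.
    have [kM|Mk] := leqP k M.
      have e0 : L2_dot p (ezL2 R k) = 0 by rewrite /p dot_riesz_E v0.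
      by rewrite [X in X *: _](_ : _ = 0) ?scale0r ?rpred0//; exact: e0.
    apply: rpredZ; have : (`|n| <= M)%N by [].
    case e : (n + k) => [j|j] _; first exact: E_hardy.
    by exfalso; lia.
  apply/cvg_nrP => e e0; have /cvg_nrP/(_ e e0) := cv; apply: filterS => N.
  by apply: le_lt_trans; rewrite -(linB lz) multiplication_ez_nr.
suff -> : riesz_proj (multiplication (ez n) v) = MkH2 ph by [].
apply: riesz_proj_uniq => k.
rewrite -[\val (MkH2 ph)]/(multiplication (ez n) p) -(linB lz) dot_multiplication_ez multiplication_E L2_dotBl.
case e : (- n + k) => [j|j]; first by rewrite dot_riesz_E subrr.
by rewrite hardy_dot_E_neg subr0; apply: v0; lia.
Qed.

Definition riesz_commutator w v : L2 m :=
  \val (riesz_proj (multiplication w v)) - multiplication w (\val (riesz_proj v)).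

Lemma riesz_commutator_trig M f v : trig M f ->
  (forall k, (`|k| <= M)%N -> L2_dot v (ezL2 R k) = 0) -> riesz_commutator f v = 0.
Proof.
move=> tf v0; rewrite /riesz_commutator; apply/eqP; rewrite subr_eq0; apply/eqP.
elim: tf => [|c n {}f nM tf IH].
  by rewrite !multiplication0 (lin0 (@riesz_proj_linear R)) H2_val0.
have bf := trig_bounded tf.
apply: etrans (congr1 (fun x => \val (riesz_proj x)) (multiplication_trig_add c n v bf)) _.
apply: etrans (congr1 val (riesz_proj_linear _ _ _)) _; apply: etrans (H2_valP _ _ _) _.
apply: etrans _ (esym (multiplication_trig_add c n _ bf)).
exact: (congr2 (fun x y : L2 m => c *: x + y) (riesz_ez_comm nM v0) IH).
Qed.

Lemma riesz_commutator_nr w v (b : R) : 0 <= b -> bounded_symbol w ->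
  {ae m, forall z, cm (w z) <= b} -> nr (riesz_commutator w v) <= 2 * b * nr v.
Proof.
move=> b0 bw wb; rewrite /riesz_commutator (le_trans (nrB _ _))//.
have h1 : nr (\val (riesz_proj (multiplication w v))) <= b * nr v.
  have := riesz_proj_bound (multiplication w v); rewrite mul1r nr_H2 => /le_trans; apply.
  exact: multiplication_nr.
have h2 : nr (multiplication w (\val (riesz_proj v))) <= b * nr v.
  rewrite (le_trans (multiplication_nr _ b0 bw wb))// ler_wpM2l//.
  by have := riesz_proj_bound v; rewrite mul1r nr_H2.
by rewrite (le_trans (lerD h1 h2))// -mulrA mulrDl !mul1r.
Qed.

Lemma small_riesz_commutator q f w : bounded_symbol f -> trig_approx q f -> bounded_symbol w ->
  small q (fun h : H2 R => riesz_commutator f (multiplication w (reflection (\val h)))).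
Proof.
move=> bf [C C0 fC] bw; have [b b0 wb] := multiplication_opbound bw.
have lw := multiplication_linear bw.
apply: (@small_le _ _ _ _ _ (2 * C * b) 2) => M.
(* The 2 (M + 1) conditions remove from the vector w W h the frequencies j and -j for 0 <= j <=
   M. *)
exists (bool * 'I_M.+1)%type, (fun (x : bool * 'I_M.+1) (h : H2 R) =>
  L2_dot (multiplication w (reflection (\val h))) (ezL2 R (if x.1 then Posz x.2 else - Posz x.2))).
split; first by rewrite card_prod card_bool card_ord.
  by move=> j a h h'; rewrite H2_valP reflection_linear lw L2_dotDl L2_dotZl.
move=> h h0; have [t tM ft] := fC M; have bt := trig_bounded tM.
set v := multiplication w _.
have v0 k : (`|k| <= M)%N -> L2_dot v (ezL2 R k) = 0.
  case: k => k kM; first exact: (h0 (true, Ordinal (kM : (k < M.+1)%N))).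
  by have := h0 (false, Ordinal (kM : (k.+1 < M.+1)%N)); rewrite NegzE.
have -> : riesz_commutator f v = riesz_commutator (fun z => f z - t z) v + riesz_commutator t v.
  rewrite /riesz_commutator !(multiplication_split _ bf bt) (linD (@riesz_proj_linear R)) H2_valD.
  by rewrite opprD addrACA.
rewrite (riesz_commutator_trig tM v0) addr0.
have e0 : 0 <= C / M.+1%:R ^+ q by rewrite divr_ge0// exprn_ge0.
rewrite (le_trans (riesz_commutator_nr _ e0 (bounded_symbolB bf bt) ft))//.
have vh : nr v <= b * nr h by rewrite (le_trans (wb _))// nr_reflection.
rewrite (le_trans (ler_wpM2l _ vh)) ?mulr_ge0//.
rewrite le_eqVlt; apply/orP; left; apply/eqP; ring.
Qed.

(** The Hankel operator is extended to L^2 because commutators of P_+ need not take values in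
    H^2. *)
Definition big_hankel w v : H2 R := riesz_proj (multiplication w (reflection v)).

Lemma big_hankel_linear w : bounded_symbol w -> linear (big_hankel w).
Proof.
by move=> bw a u v; rewrite /big_hankel reflection_linear (multiplication_linear bw) riesz_proj_linear.
Qed.

Lemma big_hankel_opbound w : bounded_symbol w -> exists2 b, 0 <= b & opbound (big_hankel w) b.
Proof.
move=> /multiplication_opbound[b b0 wb]; exists b => // v.
by rewrite (le_trans (riesz_proj_bound _))// mul1r (le_trans (wb _))// nr_reflection.
Qed.

(** With w' = w o conj one has w' W = W w, and w P_+ = P_+ w - [P_+, w]. Hence H(f) H(g) = H(f) H(w
    g) - P_+ f W [P_+, w] g W + H(f (1 - w')) H(g), and each term has a small factor. *)
Lemma small_hankel_comp q f g w : bounded_symbol f -> bounded_symbol g -> bounded_symbol w ->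
  trig_approx q w -> trig_approx q (fun z => w z * g z) -> trig_approx q (fun z => f z * (1 - w (circle_conj z))) ->
  small q (fun h => hankel f (hankel g h)).
Proof.
move=> bf bg bw rw rwg rfw.
have bwg := bounded_symbolM bw bg.
have bw' := bounded_symbol_refl bw.
have bfw' : bounded_symbol (fun z => f z * (1 - w (circle_conj z))).
  by apply: bounded_symbolM => //; apply: bounded_symbolB => //; exact: bounded_symbol_cst.
have bfw := bounded_symbolM bf bw'.
have [b b0 fb] := hankel_opbound bf; have [c c0 gc] := hankel_opbound bg.
have [d d0 fd] := big_hankel_opbound (bounded_symbolZ (-1) bf).
have s1 := small_compl b0 fb (small_hankel bwg rwg).
have s2 := small_compl d0 fd (small_riesz_commutator bw rw bg).
have s3 := small_compr (hankel_linear bg) gc (small_hankel bfw' rfw).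
apply: small_ext (small_add (small_add s1 s2) s3) => h.
set p := hankel g h; set v := multiplication g (reflection (\val h)).
have pE : \val p = \val (riesz_proj v) by [].
clearbody p.
have e1 := hankelD p bfw bfw'.
have e2 : hankel (fun z => f z * w (circle_conj z) + f z * (1 - w (circle_conj z))) p = hankel f p.
  apply: (congr1 (fun g => hankel g p)).
  by apply/funext => z; rewrite -mulrDr addrC subrK mulr1.
suff e3 : hankel f (hankel (fun z => w z * g z) h) +
    big_hankel (fun z => -1 * f z) (riesz_commutator w v) = hankel (fun z => f z * w (circle_conj z)) p.
  exact: etrans (congr1 (fun x : H2 R => x + _) e3) (etrans (esym e1) e2).
have -> : hankel (fun z => f z * w (circle_conj z)) p = big_hankel f (multiplication w (\val p)).
  rewrite /big_hankel [reflection _](reflection_multiplication (\val p) bw).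
  exact: esym (congr1 (@riesz_proj R) (multiplicationA (reflection (\val p)) bf bw')).
have -> : multiplication w (\val p) = \val (hankel (fun z => w z * g z) h) - riesz_commutator w v.
  have -> : hankel (fun z => w z * g z) h = riesz_proj (multiplication w v).
    exact: esym (congr1 (@riesz_proj R) (multiplicationA (reflection (\val h)) bw bg)).
  by rewrite /riesz_commutator pE opprB addrC subrK.
rewrite (linB (big_hankel_linear bf)); congr (_ + _).
rewrite /big_hankel -(linN (@riesz_proj_linear R)); congr riesz_proj.
exact: multiplicationN.
Qed.

(* w plays the role of the cutoff chi. *)
Definition separated q f g := exists w, [/\ bounded_symbol w, (forall z, conjc (w z) = w z),
  trig_approx q w, trig_approx q (fun z => w z * f z) & trig_approx q (fun z => (1 - w z) * g z)].

(** w is real, so it passes through the conjugation in [symbol_adj]. In the second product the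
    symbol next to the cutoff is a reflected one, so the cutoff is reflected too. *)
Lemma small_separated q f g : bounded_symbol f -> bounded_symbol g -> separated q f g ->
  small q (fun h => hankel (symbol_adj g) (hankel f h)) /\
  small q (fun h => hankel g (hankel (symbol_adj f) h)).
Proof.
move=> bf bg [w [bw wr rw rwf rwg]].
have [bf' bg'] := (symbol_adj_bounded bf, symbol_adj_bounded bg).
split; first apply: (small_hankel_comp bg' bf bw) => //.
  rewrite (_ : (fun z => _) = fun z => conjc ((1 - w (circle_conj z)) * g (circle_conj z))).
    exact: (trig_approx_conj (trig_approx_refl rwg)).
  by apply/funext => z; rewrite rmorphM rmorphB rmorph1 /= wr mulrC.
apply: (small_hankel_comp bg bf' (bounded_symbol_refl bw)).
- exact: trig_approx_refl.
- rewrite (_ : (fun z => _) = fun z => conjc (w (circle_conj z) * f (circle_conj z))).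
    exact: (trig_approx_conj (trig_approx_refl rwf)).
  by apply/funext => z; rewrite rmorphM /= wr.
- under [X in trig_approx _ X]funext do rewrite circle_conjK mulrC.
  exact: rwg.
Qed.

End SmallProducts.

(** * Fourier series of smooth functions *)

Section SmoothAtPoint.
Context (R : realType).
Implicit Types (F G : R -> R) (s t : R) (k n : nat).

Fixpoint Ck k F t : Prop :=
  if k is k'.+1 then derivable F t 1 /\ Ck k' (derive1 F) t else {for t, continuous F}.

Lemma derivable_continuous F t : derivable F t 1 -> {for t, continuous F}.
Proof. by move=> /derivable1_diffP; exact: differentiable_continuous. Qed.

Lemma near_eq_derive1 F G t : (\forall s \near t, F s = G s) ->
  \forall s \near t, (derive1 F) s = (derive1 G) s.
Proof.
move=> /near_join; apply: filterS => s FG.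
by rewrite !derive1E; exact: near_eq_derive.
Qed.

Lemma Ck_ext k F G t : (\forall s \near t, F s = G s) -> Ck k F t -> Ck k G t.
Proof.
elim: k F G => [|k IH] F G FG /=.
  move=> cF; rewrite /prop_for /continuous_at -(nbhs_singleton FG).
  by apply: cvg_trans cF; exact: near_eq_cvg.
move=> [dF CF]; split; first exact: near_eq_derivable FG dF.
by apply: IH CF; exact: near_eq_derive1.
Qed.

Lemma Ck_continuous k F t : Ck k F t -> {for t, continuous F}.
Proof. by case: k => [//|k] [/derivable_continuous]. Qed.

Lemma Ck_pred k F t : Ck k.+1 F t -> Ck k F t.
Proof.
elim: k F => [F [/derivable_continuous]//|k IH] F [dF CF].
by split => //; exact: IH.
Qed.

Lemma Ck_derive1n k F t : (forall n, derivable (derive1n n F) t 1) -> Ck k F t.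
Proof.
elim: k F => [|k IH] F H; first exact: (derivable_continuous (H 0%N)).
by split; [exact: (H 0%N)|apply: IH => n; rewrite -derive1Sn].
Qed.

(** The rules for [derive1] of a product or a composite hold where the factors are differentiable,
    so iterating them requires a neighbourhood of t. *)
Definition Ck_near k F t := \forall s \near t, Ck k F s.

Lemma Ck_near_ext k F G t : (\forall s \near t, F s = G s) -> Ck_near k F t -> Ck_near k G t.
Proof. by move=> /near_join FG CF; apply: filterS2 FG CF => s; exact: Ck_ext. Qed.

(** An explicit derivative G replaces [derive1 F], so closure properties follow by induction from
    the differentiation rules. *)
Lemma Ck_nearS k F G t : (\forall s \near t, is_derive s (1 : R) F (G s)) -> Ck_near k G t ->
  Ck_near k.+1 F t.
Proof.
move=> dF CG; have GF : \forall s \near t, G s = (derive1 F) s.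
  by apply: filterS dF => s [_ <-]; rewrite derive1E.
by apply: filterS2 dF (Ck_near_ext GF CG) => s [].
Qed.

Lemma Ck_near_derive1 k F t : Ck_near k.+1 F t ->
  (\forall s \near t, is_derive s (1 : R) F ((derive1 F) s)) /\ Ck_near k (derive1 F) t.
Proof.
move=> CF; split; apply: filterS CF => s [dF CF] //.
by rewrite derive1E; exact: DeriveDef.
Qed.

Lemma Ck_near_pred k F t : Ck_near k.+1 F t -> Ck_near k F t.
Proof. by apply: filterS => s; exact: Ck_pred. Qed.

Lemma Ck_near_cst k c t : Ck_near k (cst c) t.
Proof.
elim: k c => [|k IH] c; first by apply: (@filterE _ (nbhs t)) => s; exact: cvg_cst.
apply: (@Ck_nearS k _ (cst 0)) => //.
by apply: (@filterE _ (nbhs t)) => s; exact: is_derive_cst.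
Qed.

Lemma Ck_nearD k F G t : Ck_near k F t -> Ck_near k G t -> Ck_near k (fun s => F s + G s) t.
Proof.
elim: k F G => [|k IH] F G; first by apply: filterS2 => s cF cG; exact: cvgD.
move=> /Ck_near_derive1[dF CF] /Ck_near_derive1[dG CG].
apply: Ck_nearS (IH _ _ CF CG); apply: filterS2 dF dG => s dF dG.
exact: is_deriveD.
Qed.

Lemma Ck_nearM k F G t : Ck_near k F t -> Ck_near k G t -> Ck_near k (fun s => F s * G s) t.
Proof.
elim: k F G => [|k IH] F G; first by apply: filterS2 => s cF cG; exact: cvgM.
move=> F1 G1; have [dF CF] := Ck_near_derive1 F1; have [dG CG] := Ck_near_derive1 G1.
have F0 := Ck_near_pred F1; have G0 := Ck_near_pred G1.
apply: Ck_nearS (Ck_nearD (IH _ _ F0 CG) (IH _ _ G0 CF)).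
by apply: filterS2 dF dG => s dF dG; exact: is_deriveM.
Qed.

Lemma Ck_nearN k F t : Ck_near k F t -> Ck_near k (fun s => - F s) t.
Proof.
move=> CF; apply: Ck_near_ext (Ck_nearM (Ck_near_cst k (-1) t) CF).
by apply: (@filterE _ (nbhs t)) => s; rewrite /= mulN1r.
Qed.

Lemma Ck_nearX k F n t : Ck_near k F t -> Ck_near k (fun s => F s ^+ n) t.
Proof.
move=> CF; elim: n => [|n IH]; first exact: (Ck_near_cst k 1 t).
by under [X in Ck_near _ X]funext do rewrite exprS; exact: Ck_nearM.
Qed.

Lemma Ck_near_sum k I (r : seq I) (F : I -> R -> R) t : (forall i, Ck_near k (F i) t) ->
  Ck_near k (fun s => \sum_(i <- r) F i s) t.
Proof.
move=> CF; elim: r => [|i r IH].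
  by under [X in Ck_near _ X]funext do rewrite big_nil; exact: Ck_near_cst.
by under [X in Ck_near _ X]funext do rewrite big_cons; exact: Ck_nearD.
Qed.

Lemma Ck_nearV k F t : (\forall s \near t, F s != 0) -> Ck_near k F t ->
  Ck_near k (fun s => (F s)^-1) t.
Proof.
move=> F0; elim: k => [|k IH]; first by apply: filterS2 F0 => s ? cF; exact: cvgV.
move=> F1; have [dF CF] := Ck_near_derive1 F1.
have CV := IH (Ck_near_pred F1).
apply: Ck_nearS (Ck_nearM (Ck_nearN (Ck_nearX 2 CV)) CF).
apply: filterS2 F0 dF => s Fs dF.
by apply: is_derive_eq (is_deriveV Fs dF) _; rewrite exprVn.
Qed.

(** x_+^(k+1) has k continuous derivatives. Such powers supply the cutoffs, a finite order of
    smoothness being enough for a fixed q. *)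
Definition pospart (x : R) := Num.max x 0.

Lemma is_derive_pospart n (x : R) :
  is_derive x (1 : R) (fun y => pospart y ^+ n.+2) (n.+2%:R * pospart x ^+ n.+1).
Proof.
have [x0|x0|->] := ltgtP x 0.
- have -> : n.+2%:R * pospart x ^+ n.+1 = 0 by rewrite /pospart (max_idPr (ltW x0)) expr0n mulr0.
  apply: near_eq_is_derive (is_derive_cst (0 : R) x 1).
  near=> y; rewrite /pospart /= (max_idPr _) ?expr0n//.
  by apply: ltW; near: y; exact: lt_nbhsl.
- have -> : n.+2%:R * pospart x ^+ n.+1 = n.+2%:R * x ^+ n.+1 by rewrite /pospart (max_idPl (ltW x0)).
  apply: near_eq_is_derive (is_derive_eq (is_deriveX n.+2 (is_derive_id x 1)) _); last first.
    by rewrite /GRing.scale /= mulr1.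
  near=> y; have y0 : 0 <= y by apply: ltW; near: y; exact: lt_nbhsr.
  by rewrite /pospart (max_idPl y0) exprfctE.
- rewrite {2}/pospart maxxx expr0n mulr0.
  (* At 0 the difference quotient is at most |h|^(n+1), hence at most |h| once |h| < 1. *)
  have H : (fun h => h^-1 *: ((fun y => pospart y ^+ n.+2) (h *: (1 : R) + 0) - pospart 0 ^+ n.+2)) @ 0^' --> (0 : R).
    apply/cvgr0Pnorm_lt => e e0; near=> h.
    have h0 : h != 0 by near: h; exact: nbhs_dnbhs_neq.
    have h1 : `|h| < Num.min 1 e.
      near: h; apply: dnbhs0_lt; by rewrite lt_min ltr01.
    move: h1; rewrite lt_min => /andP[h1 he].
    rewrite /GRing.scale /= mulr1 addr0 {2}/pospart maxxx expr0n subr0 normrM normfV.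
    apply: le_lt_trans he; rewrite ler_pdivrMl ?normr_gt0// normrX.
    have hp : `|pospart h| <= `|h|.
      by rewrite /pospart; case: (lerP h 0) => _; rewrite ?normr0.
    rewrite (@le_trans _ _ (`|h| ^+ n.+2))//; first by rewrite lerXn2r ?nnegrE.
    by rewrite !exprS mulrA ler_piMr ?mulr_ge0// exprn_ile1// ltW.
  apply: DeriveDef; first by apply/cvg_ex; exists 0.
  exact: cvg_lim H.
Unshelve. all: by end_near. Qed.

Lemma Ck_near_pospart k n F t : (k <= n)%N -> Ck_near k F t ->
  Ck_near k (fun s => pospart (F s) ^+ n.+1) t.
Proof.
elim: k n F => [|k IH] n F kn CF.
  apply: filterS CF => s cF.
  have c : {for s, continuous (fun s => pospart (F s))}.
    by apply: continuous_max => //; exact: cvg_cst.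
  exact: (@continuous_comp _ _ _ (fun s => pospart (F s)) (fun y => y ^+ n.+1) s c (@exprn_continuous _ _ _)).
case: n kn => [//|n] kn.
have [dF C'] := Ck_near_derive1 CF.
apply: Ck_nearS (Ck_nearM (Ck_nearM (Ck_near_cst k n.+2%:R t) (IH n F _ (Ck_near_pred CF))) C') => //.
apply: filterS dF => s dF.
have h := @is_derive1_comp _ (fun y => pospart y ^+ n.+2) F s _ _ (is_derive_pospart n (F s)) dF.
by apply: is_derive_eq h _; rewrite mulrC.
Qed.

End SmoothAtPoint.

(** * Regularity on the circle from regularity in the angle *)

Section CircleFunctions.
Context (R : realType).
Local Notation m := (circle_measure R).
Implicit Types (z : circle R) (t : R) (f : circle R -> R).

(* z / z0 *)
Definition rel_pos (z0 z : circle R) : R[i] := circle_val z * conjc (circle_val z0).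

Lemma cm_rel_pos z0 z : cm (rel_pos z0 z) = 1.
Proof. by rewrite cmM cmJ !cm_circle mulr1. Qed.

Lemma rel_pos_self z0 : rel_pos z0 z0 = 1.
Proof. by rewrite /rel_pos mulcJ cm_circle expr1n. Qed.

Lemma asin0 : asin 0 = 0 :> R.
Proof. by rewrite -[X in asin X]sin0 sinK// in_itv /= oppr_le0 divr_ge0// pi_ge0. Qed.

(** On the half circle centred at cis t0, asin of the imaginary part gives a local inverse of
    [cis]. *)
Lemma cis_asin_rel_pos t0 z : 0 < complex.Re (rel_pos (cis t0) z) ->
  z = cis (t0 + asin (complex.Im (rel_pos (cis t0) z))).
Proof.
move=> x0; set w := rel_pos _ _ in x0 *.
have y1 : -1 <= complex.Im w <= 1.
  by rewrite -ler_norml (le_trans (ler_Im_cm _))// cm_rel_pos.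
have wE : w = cos (asin (complex.Im w)) +i* sin (asin (complex.Im w)).
  rewrite cos_asin// asinK//; apply: Defs.eqC => //=.
  have -> : 1 - complex.Im w ^+ 2 = complex.Re w ^+ 2.
    by have := cm_sqr w; rewrite cm_rel_pos expr1n => ->; rewrite addrK.
  by rewrite sqrtr_sqr gtr0_norm.
have zE : circle_val z = circle_val (cis t0) * w.
  by rewrite /w /rel_pos mulrCA mulcJ cm_circle expr1n mulr1.
apply: circle_val_inj; rewrite zE {1}wE !circle_val_cis cosD sinD.
by apply: Defs.eqC; rewrite ?Defs.ReM ?Defs.ImM /= 1?addrC.
Qed.

Lemma rel_pos_continuous z0 : continuous (rel_pos z0).
Proof.
have cM : continuous (fun w : R[i] => w * conjc (circle_val z0)).
  by apply: nr_lipschitz => w w'; rewrite -mulrBl -[nr _]/(cm _) cmM cmJ cm_circle mulr1.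
move=> z; exact: (continuous_comp (@circle_val_continuous R z) (cM _)).
Qed.

(** Near z0, f is s -> f (cis s) composed with the local inverse of [cis]. *)
Lemma circle_continuous f : (forall t, {for t, continuous (fun s => f (cis s))}) -> continuous f.
Proof.
move=> cf z0; have [t0 _ z0E] := cis_surj z0.
pose y z := complex.Im (rel_pos z0 z).
have cy : {for z0, continuous y}.
  by apply: continuous_comp; [exact: rel_pos_continuous|exact: continuous_Im].
have y0 : y z0 = 0 by rewrite /y rel_pos_self.
have ca : {for z0, continuous (fun z => t0 + asin (y z))}.
  have cD : continuous (fun s : R => t0 + s) by move=> s; apply: cvgD; [exact: cvg_cst|exact: cvg_id].
  apply: (@continuous_comp _ _ _ (fun z => asin (y z)) (fun s : R => t0 + s)); last exact: cD.
  apply: (@continuous_comp _ _ _ y asin) => //; apply: continuous_asin.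
  by rewrite y0 ltrN10 ltr01.
have c : {for z0, continuous (fun z => f (cis (t0 + asin (y z))))}.
  exact: (@continuous_comp _ _ _ (fun z => t0 + asin (y z)) (fun s => f (cis s)) z0 ca (cf _)).
have E0 : f (cis (t0 + asin (y z0))) = f z0 by rewrite y0 asin0 addr0 -z0E.
have xz : {for z0, continuous (fun z => complex.Re (rel_pos z0 z))}.
  by apply: continuous_comp; [exact: rel_pos_continuous|exact: continuous_Re].
have near0 : \forall z \near z0, 0 < complex.Re (rel_pos z0 z).
  by apply: (cvgr_gt _ xz); rewrite rel_pos_self.
have nE : \forall z \near z0, f (cis (t0 + asin (y z))) = f z.
  by apply: filterS near0 => z; rewrite /y z0E => /cis_asin_rel_pos <-.
rewrite /prop_for /continuous_at E0 in c; apply: cvg_trans c.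
exact: (@near_eq_cvg _ _ (nbhs z0) _ _ _ nE).
Qed.

Lemma derivable_lipschitz_at (G : R -> R) : derivable G 0 1 ->
  exists K d, [/\ 0 <= K, 0 < d & forall y, `|y| < d -> `|G y - G 0| <= K * `|y|].
Proof.
move=> /cvg_ex[l /cvgrPdist_lt/(_ 1 ltr01)].
rewrite near_withinE => -[d /= d0 dP]; exists (`|l| + 1), d.
split => [|//|y yd]; first by rewrite addr_ge0.
have [->|y0] := eqVneq y 0; first by rewrite subrr normr0 mulr0.
have := dP y; rewrite /ball_ /= sub0r normrN => /(_ yd y0).
rewrite /GRing.scale /= mulr1 addr0 distrC => h.
have : `|y^-1 * (G y - G 0)| <= `|l| + 1.
  rewrite -[_ * _](subrK l) (le_trans (ler_normD _ _))// addrC lerD2l.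
  exact: ltW.
by rewrite normrM normfV ler_pdivrMl ?normr_gt0// mulrC.
Qed.

(** Near z0 this is differentiability in the chart y = Im (z / z0), as |y| <= |z / z0 - 1|.
    Elsewhere |z / z0 - 1| is bounded below, and f is bounded. *)
Lemma circle_lipschitz_at f (c : R) z0 : (forall z, `|f z| <= c) ->
  (forall t, derivable (fun s => f (cis s)) t 1) ->
  exists K, 0 <= K /\ forall z, `|f z - f z0| <= K * cm (rel_pos z0 z - 1).
Proof.
move=> fc df; have [t0 _ z0E] := cis_surj z0.
have dG : derivable (fun y => f (cis (t0 + asin y))) 0 1.
  have da : is_derive (0 : R) (1 : R) (fun y => t0 + asin y) (0 + (Num.sqrt (1 - 0 ^+ 2))^-1).
    by apply: is_deriveD; apply: is_derive1_asin; rewrite ltrN10 ltr01.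
  have ds : is_derive (t0 + asin 0) (1 : R) (fun s => f (cis s)) ('D_1 (fun s => f (cis s)) (t0 + asin 0)).
    exact: DeriveDef.
  by have [] := @is_derive1_comp _ (fun s => f (cis s)) (fun y => t0 + asin y) 0 _ _ ds da.
have [K [d [K0 d0 KP]]] := derivable_lipschitz_at dG.
have c0 : 0 <= c := le_trans (normr_ge0 _) (fc z0).
exists (K + 2 * c / Num.min 1 d); split.
  by rewrite addr_ge0// divr_ge0 ?mulr_ge0// le_min ler01 ltW.
move=> z; set w := rel_pos z0 z; rewrite mulrDl.
have yw : `|complex.Im w| <= cm (w - 1).
  by have := ler_Im_cm (w - 1); case: (w) => a b /=; rewrite subr0.
have far : Num.min 1 d <= cm (w - 1) -> `|f z - f z0| <= 2 * c / Num.min 1 d * cm (w - 1).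
  move=> H; have md : 0 < Num.min 1 d by rewrite lt_min ltr01.
  rewrite (@le_trans _ _ (2 * c))//.
    by rewrite (le_trans (ler_normB _ _))// mulr2n mulrDl !mul1r lerD.
  by rewrite -mulrA ler_peMr ?mulr_ge0// mulrC ler_pdivlMr// mul1r.
have kc : 0 <= K * cm (w - 1) by rewrite mulr_ge0 ?cm_ge0.
have cc : 0 <= 2 * c / Num.min 1 d * cm (w - 1).
  by rewrite mulr_ge0 ?cm_ge0// divr_ge0 ?mulr_ge0// le_min ler01 ltW.
have [x0|x0] := lerP (complex.Re w) 0.
  rewrite (le_trans (far _)) ?lerDr// ge_min; apply/orP; left.
  have := ler_Re_cm (w - 1); have -> : complex.Re (w - 1) = complex.Re w - 1 by case: (w).
  by apply: le_trans; rewrite distrC (le_trans _ (ler_norm _))// lerDl oppr_ge0.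
have [yd|yd] := ltrP `|complex.Im w| d; last first.
  by rewrite (le_trans (far _)) ?lerDr// ge_min; apply/orP; right; exact: le_trans yw.
rewrite (@le_trans _ _ (K * cm (w - 1))) ?lerDl// (le_trans _ (ler_wpM2l K0 yw))//.
have := KP _ yd; rewrite asin0 addr0 -z0E.
by rewrite /w z0E -cis_asin_rel_pos// -z0E.
Qed.

Lemma circle_continuous_bounded f : (forall t, {for t, continuous (fun s => f (cis s))}) ->
  exists c, forall z, `|f z| <= c.
Proof.
move=> cf; have cF : {within `[0, 2 * pi], continuous (fun s : R => f (cis s))}.
  by apply: continuous_subspaceT => t; exact: cf.
have [b _ bP] := EVT_max (ltW (twopi_gt0 R)) cF.
have [a _ aP] := EVT_min (ltW (twopi_gt0 R)) cF.
exists (`|f (cis b)| + `|f (cis a)|) => z; have [t tp ->] := cis_surj z.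
have tp' : t \in `[0, 2 * pi] by rewrite in_itv.
have := aP _ tp'; have := bP _ tp'; move: (ler_norm (f (cis b))) (ler_norm (- f (cis a))).
move: (normr_ge0 (f (cis b))) (normr_ge0 (f (cis a))).
rewrite normrN ler_norml => h1 h2 h3 h4 h5 h6; apply/andP; split; lra.
Qed.

End CircleFunctions.

Section FourierCoefficients.
Context (R : realType).
Local Notation m := (circle_measure R).
Local Notation mu := (@lebesgue_measure R).
Implicit Types (F : R -> R) (n : int).

Lemma cos_sin_int2pi n : cos (n%:~R * (2 * pi)) = 1 :> R /\ sin (n%:~R * (2 * pi)) = 0 :> R.
Proof.
have := ez_cis n (0 : R); have -> : cis 0 = cis (2 * pi) :> circle R by rewrite -[2 * pi]add0r cisD2pi.
by rewrite ez_cis mulr0 cos0 sin0 => -[].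
Qed.

Definition period (F : R -> R) := forall t, F (t + 2 * pi) = F t.

Lemma period_derive1 F : period F -> period (derive1 F).
Proof.
move=> pF t; rewrite /derive1 (_ : (fun h => _) = fun h => h^-1 *: (F (h + t) - F t))//.
by apply/funext => h; rewrite addrA !pF.
Qed.

Lemma continuous_integrable_period (F : R -> R) : continuous F ->
  mu.-integrable `[0, 2 * pi] (EFin \o F).
Proof.
move=> cF; apply: continuous_compact_integrable; first exact: segment_compact.
exact: continuous_subspaceT.
Qed.

Definition cos_coef F n := (\int[mu]_(t in `[0%R, (2 * pi)%R]) (F t * cos (n%:~R * t)))%R.
Definition sin_coef F n := (\int[mu]_(t in `[0%R, (2 * pi)%R]) (F t * sin (n%:~R * t)))%R.

Lemma int_mul_is_derive n (t : R) : is_derive t (1 : R) (fun t : R => n%:~R * t) n%:~R.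
Proof.
by apply: is_derive_eq (is_deriveZ n%:~R (is_derive_id t 1)) _; rewrite /GRing.scale /= mulr1.
Qed.

Lemma is_derive_cos_int n (t : R) :
  is_derive t (1 : R) (fun t : R => cos (n%:~R * t)) (- (n%:~R * sin (n%:~R * t))).
Proof.
have h := @is_derive1_comp _ cos (fun t : R => n%:~R * t) t _ _ (is_derive_cos _) (int_mul_is_derive n t).
by apply: is_derive_eq h _; rewrite mulNr mulrC.
Qed.

Lemma is_derive_sin_int n (t : R) :
  is_derive t (1 : R) (fun t : R => sin (n%:~R * t)) (n%:~R * cos (n%:~R * t)).
Proof.
have h := @is_derive1_comp _ sin (fun t : R => n%:~R * t) t _ _ (is_derive_sin _) (int_mul_is_derive n t).
by apply: is_derive_eq h _; rewrite mulrC.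
Qed.

Lemma is_derive_continuous (F G : R -> R) : (forall t : R, is_derive t (1 : R) F (G t)) -> continuous F.
Proof. by move=> dF t; have [/derivable_continuous] := dF t. Qed.

Lemma continuous_cos_int n : continuous (fun t : R => cos (n%:~R * t)).
Proof. exact: is_derive_continuous (is_derive_cos_int n). Qed.

Lemma continuous_sin_int n : continuous (fun t : R => sin (n%:~R * t)).
Proof. exact: is_derive_continuous (is_derive_sin_int n). Qed.

Lemma continuous_mul_fun (F G : R -> R) : continuous F -> continuous G ->
  continuous (fun t => F t * G t).
Proof. by move=> cF cG t; apply: cvgM; [exact: cF|exact: cG]. Qed.

Lemma fourier_by_parts (F F' : R -> R) n : (forall t : R, is_derive t (1 : R) F (F' t)) ->
  continuous F' -> F (2 * pi) = F 0 ->
  cos_coef F' n = n%:~R * sin_coef F n /\ sin_coef F' n = - (n%:~R * cos_coef F n).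
Proof.
move=> dF cF' FF; have cF := is_derive_continuous dF.
have [c1 s0] := cos_sin_int2pi n.
have iC (G : R -> R) : continuous G -> mu.-integrable `[0, 2 * pi] (EFin \o (fun t => G t * cos (n%:~R * t))).
  by move=> cG; apply: continuous_integrable_period; apply: continuous_mul_fun => //; exact: continuous_cos_int.
have iS (G : R -> R) : continuous G -> mu.-integrable `[0, 2 * pi] (EFin \o (fun t => G t * sin (n%:~R * t))).
  by move=> cG; apply: continuous_integrable_period; apply: continuous_mul_fun => //; exact: continuous_sin_int.
have iZ (r : R) (G : R -> R) : mu.-integrable `[0, 2 * pi] (EFin \o G) ->
    mu.-integrable `[0, 2 * pi] (EFin \o (fun t => r * G t)).
  by move=> iG; rewrite (_ : _ \o _ = (fun t => r%:E * (G t)%:E)%E)//; exact: integrableZl.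
split.
- have H1 : forall t : R, is_derive t (1 : R) (fun t => F t * cos (n%:~R * t))
      (F' t * cos (n%:~R * t) - n%:~R * (F t * sin (n%:~R * t))).
    move=> t; apply: is_derive_eq (is_deriveM (dF t) (is_derive_cos_int n t)) _.
    by rewrite /GRing.scale /=; ring.
  have cG : continuous (fun t => F' t * cos (n%:~R * t) - n%:~R * (F t * sin (n%:~R * t))).
    move=> t; apply: cvgB; first by apply: continuous_mul_fun => //; exact: continuous_cos_int.
    apply: cvgM; first exact: cvg_cst.
    by apply: continuous_mul_fun => //; exact: continuous_sin_int.
  have := integral_derive_eq0 H1 cG; rewrite c1 mulr0 cos0 FF => /(_ erefl)/(congr1 fine).
  rewrite -[LHS]/((\int[mu]_(t in _) (_ - _))%R) RintegralB//; [|exact: iC|exact/iZ/iS].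
  by rewrite RintegralZl//; [move=> /eqP; rewrite subr_eq0 => /eqP|exact: iS].
- have H1 : forall t : R, is_derive t (1 : R) (fun t => F t * sin (n%:~R * t))
      (F' t * sin (n%:~R * t) + n%:~R * (F t * cos (n%:~R * t))).
    move=> t; apply: is_derive_eq (is_deriveM (dF t) (is_derive_sin_int n t)) _.
    by rewrite /GRing.scale /=; ring.
  have cG : continuous (fun t => F' t * sin (n%:~R * t) + n%:~R * (F t * cos (n%:~R * t))).
    move=> t; apply: cvgD; first by apply: continuous_mul_fun => //; exact: continuous_sin_int.
    apply: cvgM; first exact: cvg_cst.
    by apply: continuous_mul_fun => //; exact: continuous_cos_int.
  have := integral_derive_eq0 H1 cG; rewrite s0 !mulr0 sin0 mulr0 => /(_ erefl)/(congr1 fine).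
  rewrite -[LHS]/((\int[mu]_(t in _) (_ + _))%R) RintegralD//; [|exact: iS|exact/iZ/iC].
  by rewrite RintegralZl//; [move=> /eqP; rewrite addr_eq0 => /eqP|exact: iC].
Qed.

Lemma Rintegral_bound (F : R -> R) (c : R) : continuous F -> (forall t, 0 <= t <= 2 * pi -> `|F t| <= c) ->
  `|(\int[mu]_(t in `[0%R, (2 * pi)%R]) F t)%R| <= c * (2 * pi).
Proof.
move=> cF Fc; have iF := continuous_integrable_period cF.
rewrite (le_trans (le_normr_Rintegral _ iF))//.
have -> : c * (2 * pi) = (\int[mu]_(t in `[0%R, (2 * pi)%R]) c)%R.
  rewrite Rintegral_cst//= lebesgue_measure_itv/= lte_fin twopi_gt0.
  by rewrite -EFinD subr0.
apply: le_Rintegral => //.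
- apply: continuous_integrable_period => t.
  by apply: (continuous_comp (cF t)); exact: norm_continuous.
- by apply: (continuous_integrable_period (F := fun=> c)) => t; exact: cvg_cst.
Qed.

(** Each integration by parts trades a derivative for a factor n, and periodicity cancels the
    boundary terms; the coefficients of a continuous function are bounded. *)
Lemma coef_decay k F : (forall t, Ck k F t) -> period F ->
  exists2 C, 0 <= C & forall n, `|n%:~R| ^+ k * `|cos_coef F n| <= C /\ `|n%:~R| ^+ k * `|sin_coef F n| <= C.
Proof.
elim: k F => [|k IH] F CF pF.
  have cF : continuous F by exact: CF.
  have cw : {within `[0, 2 * pi], continuous F} by exact: continuous_subspaceT.
  have [b _ bP] := EVT_max (ltW (twopi_gt0 R)) cw.
  have [a _ aP] := EVT_min (ltW (twopi_gt0 R)) cw.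
  have Fc t : 0 <= t <= 2 * pi -> `|F t| <= `|F a| + `|F b|.
    move=> tp; have tp' : t \in `[0, 2 * pi] by rewrite in_itv.
    have := aP _ tp'; have := bP _ tp'; move: (ler_norm (F b)) (ler_norm (- F a)).
    move: (normr_ge0 (F b)) (normr_ge0 (F a)).
    rewrite normrN ler_norml => h1 h2 h3 h4 h5 h6; apply/andP; split; lra.
  have Fm (G : R -> R) t : `|G t| <= 1 -> 0 <= t <= 2 * pi -> `|F t * G t| <= `|F a| + `|F b|.
    by move=> G1 tp; rewrite normrM -[leRHS]mulr1 ler_pM// Fc.
  exists ((`|F a| + `|F b|) * (2 * pi)); first by rewrite mulr_ge0 ?addr_ge0 ?mulr_ge0 ?pi_ge0.
  move=> n; rewrite !mul1r; split; apply: Rintegral_bound.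
  - by apply: continuous_mul_fun => //; exact: continuous_cos_int.
  - by move=> t; apply: (Fm (fun t => cos (n%:~R * t))); rewrite ler_norml cos_geN1 cos_le1.
  - by apply: continuous_mul_fun => //; exact: continuous_sin_int.
  - by move=> t; apply: (Fm (fun t => sin (n%:~R * t))); rewrite ler_norml sin_geN1 sin_le1.
have [C C0 CP] := IH (derive1 F) (fun t => (CF t).2) (period_derive1 pF).
exists C => // n.
have dF t : is_derive t (1 : R) F (derive1 F t) by rewrite derive1E; apply: DeriveDef => //; have [] := CF t.
have [e1 e2] := fourier_by_parts n dF (fun t => Ck_continuous (CF t).2) (etrans (congr1 F (esym (add0r _))) (pF 0)).
have [h1 h2] := CP n; rewrite e1 e2 in h1 h2; rewrite !exprSr -!mulrA.
by rewrite normrN in h2; rewrite -!normrM.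
Qed.

End FourierCoefficients.

Section FourierSeries.
Context (R : realType).
Local Notation m := (circle_measure R).
Local Notation mu := (@lebesgue_measure R).
Implicit Types (f : circle R -> R) (n : int) (z : circle R) (N : nat).

Definition real_symbol f : circle R -> R[i] := fun z => (f z)%:C.

Lemma mC_real f : measurable_fun [set: circle R] f -> mC (real_symbol f).
Proof. by move=> mf; split => //; exact: measurable_cst. Qed.

Lemma bounded_real_symbol f (c : R) : measurable_fun [set: circle R] f -> (forall z, `|f z| <= c) ->
  bounded_symbol (real_symbol f).
Proof.
move=> mf fc; exists c; first exact: le_trans (normr_ge0 _) (fc (cis 0)).
by split; [exact: mC_real|apply: aeW => z; rewrite cm_real].
Qed.

Lemma circle_Rintegral (F : circle R -> R) (c : R) : measurable_fun [set: circle R] F ->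
  (forall z, `|F z| <= c) ->
  (\int[m]_z F z = (2 * pi)^-1 * \int[mu]_(t in `[0%R, (2 * pi)%R]) F (cis t))%R.
Proof.
move=> mF Fc; rewrite /Rintegral (circle_integral mF Fc).
have p0 : 0 < (2 * pi)^-1 :> R by rewrite invr_gt0 twopi_gt0.
by case: (\int[mu]_(_ in _) _)%E => [r//||]; rewrite ?gt0_muley ?gt0_muleNy ?lte_fin//= mulr0.
Qed.

Definition fhat f n : R[i] := L2_dot (toL2 m (real_symbol f)) (ezL2 R n).

Lemma cm_fhat_le f (c : R) n : measurable_fun [set: circle R] f ->
  continuous (fun t => f (cis t)) -> (forall z, `|f z| <= c) ->
  cm (fhat f n) <= (2 * pi)^-1 * (`|cos_coef (fun t => f (cis t)) n| + `|sin_coef (fun t => f (cis t)) n|).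
Proof.
move=> mf cf fc; have bf := bounded_real_symbol mf fc.
have [mr mi] := mC_ez R n.
have -> : fhat f n = Cintegral m (fun z => real_symbol f z * conjc (ez n z)).
  by apply: L2_dot_ae; [exact: (toL2E (bounded_symbol_L2 bf))|exact: E_ae|exact: bounded_symbol_L2|exact: bounded_symbol_L2 (bounded_ez _ _)].
have cmRI (w : R[i]) : cm w <= `|complex.Re w| + `|complex.Im w|.
  rewrite -ler_sqr ?nnegrE ?cm_ge0 ?addr_ge0// cm_sqr sqrrD !real_normK ?num_real//.
  by rewrite addrAC lerDl mulrn_wge0// mulr_ge0.
rewrite (le_trans (cmRI _))// mulrDr /= lerD//.
- rewrite (_ : (\int[m]__ _)%R = (2 * pi)^-1 * cos_coef (fun t => f (cis t)) n).
    by rewrite normrM gtr0_norm// invr_gt0 twopi_gt0.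
  transitivity (\int[m]_z (f z * complex.Re (ez n z)))%R.
    by apply: eq_Rintegral => z _; rewrite Defs.ReM ReJ /= mul0r subr0.
  rewrite (@circle_Rintegral (fun z => f z * complex.Re (ez n z)) c).
  + by congr (_ * _); apply: eq_Rintegral => t _; rewrite ez_cis.
  + exact: measurable_funM.
  + by move=> z; rewrite normrM -[leRHS]mulr1 ler_pM// (le_trans (ler_Re_cm _))// cm_ez.
- rewrite (_ : (\int[m]__ _)%R = (2 * pi)^-1 * - sin_coef (fun t => f (cis t)) n).
    by rewrite normrM normrN gtr0_norm// invr_gt0 twopi_gt0.
  transitivity (\int[m]_z (f z * - complex.Im (ez n z)))%R.
    by apply: eq_Rintegral => z _; rewrite Defs.ImM ImJ /= mul0r addr0.
  rewrite (@circle_Rintegral (fun z => f z * - complex.Im (ez n z)) c).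
  + congr (_ * _); rewrite -mulN1r /sin_coef; apply: etrans (RintegralZl _ _ _) => //.
      by apply: eq_Rintegral => t _; rewrite ez_cis /= mulN1r mulrN.
    by apply: continuous_integrable_period; apply: continuous_mul_fun => //; exact: continuous_sin_int.
  + by apply: measurable_funM => //; exact: measurableT_comp.
  + by move=> z; rewrite normrM normrN -[leRHS]mulr1 ler_pM// (le_trans (ler_Im_cm _))// cm_ez.
Qed.

(** Riemann-Lebesgue: the n-th term of a convergent orthonormal series is a difference of two
    partial sums. *)
Lemma coef_cvg0 (e : nat -> L2 m) (u : L2 m) (d : R) :
  (forall i j, L2_dot (e i) (e j) = (i == j)%:R) -> 0 < d ->
  exists N, forall n : nat, (N <= n)%N -> cm (L2_dot u (e n)) < d.
Proof.
move=> orth_e d0.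
have [w /cvg_nrP/(_ (d / 2))] := fourier_sum_cvg (dot := @L2_dot _ _ R m) (@L2_normE _ _ _ _) orth_e u (@L2_complete _ _ _ _).
rewrite divr_gt0// => /(_ isT)[N _ NP]; exists N => n Nn.
have nre : nr (e n) = 1.
  apply/eqP; rewrite -(eqrXn2 (n := 2)) ?nr_ge0//; apply/eqP; rewrite (nr_sqrE (@L2_normE _ _ _ _)).
  by apply: etrans (congr1 (@complex.Re R) (orth_e n n)) _; rewrite eqxx expr1n.
have -> : cm (L2_dot u (e n)) = nr (fourier_sum (@L2_dot _ _ R m) e n.+1 u - fourier_sum (@L2_dot _ _ R m) e n u).
  rewrite /fourier_sum big_ord_recr /= addrAC subrr add0r.
  by apply: etrans (esym (nrZ _ _)); rewrite nre mulr1.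
have h1 := NP n Nn; have h2 := NP n.+1 (leqW Nn); rewrite /= nrBC in h1.
set a := fourier_sum _ _ n.+1 u in h2 *; set b := fourier_sum _ _ n u in h1 *.
have -> : a - b = (a - w) - (b - w) by rewrite opprB addrA subrK.
have := nrB (a - w) (b - w).
rewrite -[nr (b - w)]nrBC in h1; rewrite nrBC in h2.
move: h1 h2; rewrite (nrBC w b); lra.
Qed.

(** Symmetric partial sum of the Fourier series: [Negz k] is the frequency -(k + 1), paired with k +
    1. *)
Definition psum f N z : R[i] := fhat f 0 * ez 0 z +
  \sum_(k < N) (fhat f k.+1 * ez k.+1 z + fhat f (Negz k) * ez (Negz k) z).

Lemma psumS f N z : psum f N.+1 z =
  psum f N z + (fhat f N.+1 * ez N.+1 z + fhat f (Negz N) * ez (Negz N) z).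
Proof. by rewrite /psum big_ord_recr /= addrA. Qed.

Lemma psum_trig f N : trig N (psum f N).
Proof.
elim: N => [|N IH].
  under [X in trig _ X]funext do rewrite /psum big_ord0 addr0.
  exact: trig_ez.
under [X in trig _ X]funext do rewrite psumS.
apply: trigD; first exact: trig_mono (leqnSn N) IH.
by apply: trigD; apply: trig_ez.
Qed.

Lemma telescope_step (T : comPzRingType) (a x y P P' Q Q' : T) :
  y * Q - a * x * P + ((a * P - P') * x + (a * Q' - Q) * y) = a * y * Q' - x * P'.
Proof. ring. Qed.

(* The Fourier series converges at z0 because (f - f z0) / (z / z0 - 1) is bounded: the
   partial sums at z0 telescope in terms of the coefficients of this quotient. *)
Lemma psum_cvg f (c K : R) z0 (d : R) : measurable_fun [set: circle R] f -> (forall z, `|f z| <= c) ->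
  0 <= K -> (forall z, `|f z - f z0| <= K * cm (rel_pos z0 z - 1)) -> 0 < d ->
  exists N0, forall N, (N0 <= N)%N -> cm (psum f N z0 - (f z0)%:C) < d.
Proof.
move=> mf fc K0 fK d0; have bf := bounded_real_symbol mf fc.
pose a := conjc (circle_val z0).
have mw : mC (fun z => rel_pos z0 z - 1).
  apply: (mCD (g := fun=> -1)); last exact: mC_cst.
  by apply: mCM; [exact: mC_circle_val|exact: mC_cst].
pose h z := cm (rel_pos z0 z - 1) ^+ 2.
have mh : measurable_fun [set: circle R] (fun z => (h z)^-1).
  have e1 : (fun z => (h z)^-1) = (fun x => x `^ (-1)) \o h.
    by apply/funext => z /=; rewrite powR_inv1// sqr_ge0.
  rewrite e1; apply: measurableT_comp; first exact: measurable_powR.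
  by have /measurable_EFinP := measurable_cm_sqr mw.
(* This is (f - f z0) / (z / z0 - 1), the inverse being written as conjugate over squared modulus;
   the value at z0 is 0, and |g| <= K by the Lipschitz bound. *)
pose g z : R[i] := (f z - f z0)%:C * (conjc (rel_pos z0 z - 1) * ((h z)^-1)%:C).
have gE z : g z * (rel_pos z0 z - 1) = (f z)%:C - (f z0)%:C.
  have -> : g z * (rel_pos z0 z - 1) =
     (f z - f z0)%:C * (((rel_pos z0 z - 1) * conjc (rel_pos z0 z - 1)) * ((h z)^-1)%:C) by rewrite /g; ring.
  rewrite mulcJ -rmorphM -rmorphM -rmorphB; congr (_%:C).
  have [h0|h0] := eqVneq (cm (rel_pos z0 z - 1)) 0; last by rewrite divff ?mulr1// expf_eq0.
  by have := fK z; rewrite h0 mulr0 normr_le0 => /eqP ->; rewrite mul0r.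
have bg : bounded_symbol g.
  exists K => //; split.
    apply: mCM; first by apply: (mC_real (f := fun z => f z - f z0)); apply: measurable_funB => //; exact: measurable_cst.
    by apply: mCM; [exact: mC_conj|exact: mC_real].
  apply: aeW => z; rewrite /g !cmM !cm_real cmJ.
  have [h0|h0] := eqVneq (cm (rel_pos z0 z - 1)) 0; first by rewrite h0 mul0r mulr0.
  have hp : 0 < cm (rel_pos z0 z - 1) by rewrite lt_def h0 cm_ge0.
  have -> : `|(h z)^-1| = (h z)^-1 by rewrite ger0_norm ?invr_ge0 ?sqr_ge0.
  have -> : cm (rel_pos z0 z - 1) / h z = (cm (rel_pos z0 z - 1))^-1.
    by rewrite /h expr2 invfM mulrA divff// mul1r.
  by rewrite ler_pdivrMr.
pose G := toL2 m g; pose dd n := L2_dot G (ezL2 R n).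
(* Coefficients of f = f z0 + (a z - 1) g, where a = 1 / z0. *)
have fhatE n : fhat f n = (f z0)%:C * (n == 0)%:R + (a * dd (n - 1) - dd n).
  have -> : fhat f n = L2_dot ((f z0)%:C *: ezL2 R 0 + (a *: multiplication (ez 1) G - G)) (ezL2 R n).
    congr (L2_dot _ _); apply: L2_eq.
    have A1 := toL2E (bounded_symbol_L2 bf).
    have A2 := L2_linE ((f z0)%:C) (ezL2 R 0) (a *: multiplication (ez 1) G - G).
    have A3 := L2_linE a (multiplication (ez 1) G) (- G).
    have A4 := L2_linE (-1) G 0.
    have A5 := multiplicationE G (bounded_ez R 1).
    have A6 := toL2E (bounded_symbol_L2 bg).
    apply: filterS3 (filterI A1 A2) (filterI A3 A4) (filterI (filterI A5 A6) (filterI (E_ae R 0) (L2_zero m))).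
    move=> z [e1 e2] [e3 e4] [[e5 e6] [e7 e8]]; rewrite e1 e2 e3.
    rewrite scaleN1r addr0 in e4; rewrite e4 e5 e6 e7 e8 ez0.
    have := gE z; rewrite /real_symbol => e9; rewrite -[(f z)%:C](subrK (f z0)%:C) -e9.
    by rewrite /ez expr1z /rel_pos -/a; ring.
  rewrite L2_dotDl L2_dotZl dot_E L2_dotBl L2_dotZl dot_multiplication_ez multiplication_E.
  by rewrite eq_sym [- 1 + n]addrC.
have az (n : int) : a * ez n z0 = ez (n - 1) z0.
  by rewrite [n - 1]addrC ezD /a -circle_val_inv.
have psumE N : psum f N z0 - (f z0)%:C = ez (Negz N) z0 * dd (Negz N) - ez N z0 * dd N.
  elim: N => [|N IH].
    rewrite /psum big_ord0 addr0 fhatE eqxx mulr1 ez0 mulr1 mul1r.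
    by have := az 0; rewrite ez0 mulr1 => ->; rewrite sub0r -[- 1]/(Negz 0); ring.
  rewrite psumS addrAC IH !fhatE /= !mulr0 !add0r.
  have := az N.+1; have -> : (N.+1 : int) - 1 = N by lia.
  have := az (Negz N); have -> : Negz N - 1 = Negz N.+1 by lia.
  by move=> <- <-; exact: telescope_step.
have [N1 N1P] := @coef_cvg0 (fun k : nat => ezL2 R k) G (d / 2) (@orth_E_nat R) (divr_gt0 d0 (ltr0Sn R 1)).
have [||N2 N2P] := @coef_cvg0 (fun k : nat => ezL2 R (Negz k)) G (d / 2).
- by move=> i j; rewrite dot_E.
- by rewrite divr_gt0.
exists (maxn N1 N2) => N; rewrite geq_max => /andP[/N1P h1 /N2P h2].
have cmez n w : cm (ez n z0 * w) = cm w by rewrite cmM cm_ez mul1r.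
rewrite psumE (le_lt_trans (cmD _ _))// cmN !cmez [ltRHS]splitr.
exact: ltrD h2 h1.
Qed.

Lemma inv_sqr_telescope (x : R) : 1 <= x -> 2 - 2 / x + x ^- 2 <= 2 - 2 / (x + 1).
Proof.
move=> x1; have x0 : 0 < x by exact: lt_le_trans x1.
have x2 : 0 < x + 1 by rewrite addr_gt0.
have -> : 2 / (x + 1) = 2 / x - 2 / (x * (x + 1)) by field; rewrite !gt_eqF.
suff : x ^- 2 <= 2 / (x * (x + 1)) by lra.
rewrite ler_pdivlMr ?mulr_gt0// mulrC ler_pdivrMr ?exprn_gt0//.
rewrite expr2; nra.
Qed.

(** Of the q + 2 powers of decay, two make the series summable and q give the rate in M. The factor
    2 - 2 / x, with x the next frequency, lets the sum of inverse squares be bounded by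
    induction. *)
Lemma psum_tail f (D : R) q M j z : 0 <= D ->
  (forall n, n != 0 -> `|n%:~R| ^+ q.+2 * cm (fhat f n) <= D) ->
  cm (psum f (M + j) z - psum f M z) <= 2 * D / M.+1%:R ^+ q * (2 - 2 / (M + j).+1%:R).
Proof.
move=> D0 fD; have M0 : 0 < M.+1%:R ^+ q :> R by rewrite exprn_gt0.
elim: j => [|j IH].
  rewrite addn0 subrr cm0; apply: mulr_ge0; first by rewrite divr_ge0 ?mulr_ge0// ltW.
  rewrite subr_ge0.
  by rewrite ler_pdivrMr// ler_peMr// ler1n.
rewrite addnS psumS addrAC (le_trans (cmD _ _))//.
set x : R := (M + j).+1%:R in IH *; have x1 : 1 <= x by rewrite /x ler1n.
have x0 : 0 < x by exact: lt_le_trans x1.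
have fb n : `|n%:~R| = x -> n != 0 -> cm (fhat f n * ez n z) <= D / M.+1%:R ^+ q / x ^+ 2.
  move=> nx n0; rewrite cmM cm_ez mulr1 ler_pdivlMr ?exprn_gt0// ler_pdivlMr//.
  rewrite (le_trans _ (fD n n0))// nx [leRHS]mulrC -mulrA ler_wpM2l ?cm_ge0// -[q.+2]addn2 exprD.
  rewrite [leLHS]mulrC ler_wpM2r ?exprn_ge0 ?(ltW x0)//.
  have Mx : M.+1%:R <= x by rewrite /x ler_nat ltnS leq_addr.
  by rewrite lerXn2r ?nnegrE ?(ltW x0)// ler0n.
have -> : (M + j).+2%:R = x + 1 :> R by rewrite /x -natr1.
have t1 : cm (fhat f (M + j).+1 * ez (M + j).+1 z + fhat f (Negz (M + j)) * ez (Negz (M + j)) z)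
    <= 2 * D / M.+1%:R ^+ q * (x ^- 2).
  rewrite (le_trans (cmD _ _))//.
  have := fb (M + j).+1; have := fb (Negz (M + j)).
  rewrite NegzE rmorphN normrN /= ger0_norm// => /(_ erefl erefl) h1 /(_ erefl erefl) h2.
  by rewrite (le_trans (lerD h2 h1))// le_eqVlt; apply/orP; left; apply/eqP; ring.
have X0 : 0 <= 2 * D / M.+1%:R ^+ q by rewrite divr_ge0 ?mulr_ge0 ?(ltW M0).
by rewrite (le_trans (lerD IH t1))// -mulrDr (ler_wpM2l X0)// inv_sqr_telescope.
Qed.

Lemma smooth_trig_approx f q : (forall t, Ck q.+2 (fun s => f (cis s)) t) -> trig_approx q (real_symbol f).
Proof.
move=> Cf; pose F t := f (cis t).
have cF t : {for t, continuous F} by exact: Ck_continuous (Cf t).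
have mf := continuous_circle_measurable (circle_continuous cF).
have [c fc] := circle_continuous_bounded cF.
have pF : period F by move=> t; rewrite /F cisD2pi.
have [C C0 CP] := coef_decay Cf pF.
have pi0 : 0 < (2 * pi)^-1 :> R by rewrite invr_gt0 twopi_gt0.
pose D := (2 * pi)^-1 * (C + C).
have D0 : 0 <= D by rewrite mulr_ge0 ?addr_ge0// ltW.
have fD n : n != 0 -> `|n%:~R| ^+ q.+2 * cm (fhat f n) <= D.
  move=> _; rewrite (le_trans (ler_wpM2l _ (cm_fhat_le n mf cF fc))) ?exprn_ge0//.
  rewrite mulrCA ler_wpM2l ?(ltW pi0)// mulrDr.
  by have [h1 h2] := CP n; rewrite lerD.
clearbody D; exists (4 * D) => [|M]; first by rewrite mulr_ge0.
exists (psum f M); first exact: psum_trig.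
(* f z is the limit of its partial sums, so the tail bound passes to f z up to an arbitrary error
   e. *)
apply: aeW => z; apply/ler_addgt0Pr => e e0.
have [K [K0 fK]] := circle_lipschitz_at z fc (fun t => (Cf t).1).
have [N NP] := psum_cvg mf fc K0 fK e0.
have := NP (M + N)%N (leq_addl _ _); have := psum_tail M N z D0 fD.
set A := psum f (M + N) z; set B := psum f M z => h1 h2.
have -> : real_symbol f z - B = (A - B) - (A - (f z)%:C) by rewrite /real_symbol; ring.
rewrite (le_trans (cmD _ _))// cmN lerD ?(ltW h2)// (le_trans h1)//.
have M0 : 0 < M.+1%:R ^+ q :> R by rewrite exprn_gt0.
have -> : 4 * D / M.+1%:R ^+ q = 2 * D / M.+1%:R ^+ q * 2 by ring.
have X0 : 0 <= 2 * D / M.+1%:R ^+ q by rewrite divr_ge0 ?mulr_ge0 ?(ltW M0).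
by rewrite (ler_wpM2l X0)// gerBl divr_ge0.
Qed.

End FourierSeries.

(** * Cutoff functions *)

Section Cutoff.
Context (R : realType).
Local Notation m := (circle_measure R).
Implicit Types (f b : circle R -> R) (w g : circle R -> R[i]) (z : circle R) (t c : R) (k q : nat).

Lemma Re_rel_pos_cis t0 t : complex.Re (rel_pos (cis t0) (cis t)) = cos (t - t0).
Proof. by rewrite /rel_pos !circle_val_cis /= cosB mulrN opprK. Qed.

Lemma closed_complement_arc (X : set (circle R)) z0 : closed X -> ~ X z0 ->
  exists2 c, c < 1 & forall z, c < complex.Re (rel_pos z0 z) -> ~ X z.
Proof.
move=> cX Xz0; have [t0 _ z0E] := cis_surj z0.
have oU : open (@cis R @^-1` (~` X)).
  by move/continuousP : (@cis_continuous R); apply; exact: closed_openC.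
have nU : \forall s \near t0, ~ X (cis s).
  by apply: open_nbhs_nbhs; split => //; rewrite /= -z0E.
have ca : {for 0, continuous (fun y : R => t0 + asin y)}.
  have cD : continuous (fun s : R => t0 + s) by move=> s; apply: cvgD; [exact: cvg_cst|exact: cvg_id].
  apply: (@continuous_comp _ _ _ asin (fun s : R => t0 + s)); last exact: cD.
  by apply: continuous_asin; rewrite ltrN10 ltr01.
rewrite /prop_for /continuous_at asin0 addr0 in ca.
have [d /= d0 dP] := ca _ nU.
(* For z / z0 = x + i y, x > 0 places z in the chart, and x > 1 - d^2 / 2 gives y^2 = 1 - x^2 <= 2
   (1 - x) < d^2. *)
exists (Num.max 0 (1 - d ^+ 2 / 2)).
  by rewrite gt_max ltr01/= ltrBlDr ltrDl divr_gt0// exprn_gt0.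
move=> z; rewrite gt_max z0E => /andP[x0 xd].
rewrite (cis_asin_rel_pos x0); apply: dP.
set w := rel_pos _ _ in x0 xd *.
rewrite /ball_ /= sub0r normrN -ltr_sqr ?nnegrE ?(ltW d0)// real_normK ?num_real//.
have := cm_sqr w; rewrite cm_rel_pos expr1n.
have := ler_Re_cm w; rewrite cm_rel_pos ger0_norm ?(ltW x0)//.
move: x0 xd; set x := complex.Re w; set y := complex.Im w => x0 xd x1 e.
have : (1 - x) * (1 - x) >= 0 by rewrite -expr2 sqr_ge0.
have -> : y ^+ 2 = 1 - x * x by rewrite -expr2 e addrAC subrr add0r.
lra.
Qed.

Lemma Ck_near_cos_sin k (a t : R) :
  Ck_near k (fun s => cos (s - a)) t /\ Ck_near k (fun s => sin (s - a)) t.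
Proof.
have ds (s : R) : is_derive s (1 : R) (fun s => s - a) 1.
  by apply: is_derive_eq (is_deriveB (is_derive_id s 1) (is_derive_cst a s 1)) _; rewrite subr0.
have dc s : is_derive s (1 : R) (fun s => cos (s - a)) (- sin (s - a)).
  have h := @is_derive1_comp _ cos (fun s : R => s - a) s _ _ (is_derive_cos _) (ds s).
  by apply: is_derive_eq h _; rewrite mulr1.
have dn s : is_derive s (1 : R) (fun s => sin (s - a)) (cos (s - a)).
  have h := @is_derive1_comp _ sin (fun s : R => s - a) s _ _ (is_derive_sin _) (ds s).
  by apply: is_derive_eq h _; rewrite mulr1.
elim: k => [|k [IHc IHs]].
  split; apply: (@filterE _ (nbhs t)) => s; apply: derivable_continuous.
    by have [] := dc s.
  by have [] := dn s.
split.
  by apply: Ck_nearS (Ck_nearN IHs); exact: (@filterE _ (nbhs t)).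
by apply: Ck_nearS IHc; exact: (@filterE _ (nbhs t)).
Qed.

Definition bump z0 c k z := pospart (complex.Re (rel_pos z0 z) - c) ^+ k.+1.

Lemma bump_ge0 z0 c k z : 0 <= bump z0 c k z.
Proof. by rewrite exprn_ge0// le_max lexx orbT. Qed.

Lemma bump_eq0 z0 c k z : complex.Re (rel_pos z0 z) <= c -> bump z0 c k z = 0.
Proof. by move=> zc; rewrite /bump /pospart (max_idPr _) ?expr0n// subr_le0. Qed.

Lemma bump_smooth z0 c k t : Ck_near k (fun s => bump z0 c k (cis s)) t.
Proof.
have [t0 _ ->] := cis_surj z0; rewrite /bump.
under [X in Ck_near _ X]funext do rewrite Re_rel_pos_cis.
apply: (@Ck_near_pospart _ k k (fun s => cos (s - t0) - c)) => //.
by apply: (Ck_nearD (G := fun=> - c)); [have [] := Ck_near_cos_sin k t0 t|exact: Ck_near_cst].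
Qed.

(** Below c' the bump vanishes in a neighbourhood; at c' and above the point is off X, because c <
    c', and f is smooth there. *)
Lemma bump_mul_smooth (X : set (circle R)) z0 c c' k f :
  (forall z, c < complex.Re (rel_pos z0 z) -> ~ X z) -> c < c' ->
  (forall t, ~ X (cis t) -> Ck_near k (fun s => f (cis s)) t) ->
  forall t, Ck_near k (fun s => bump z0 c' k (cis s) * f (cis s)) t.
Proof.
move=> cX cc Cf t; have [tc|tc] := ltrP (complex.Re (rel_pos z0 (cis t))) c'; last first.
  by apply: Ck_nearM; [exact: bump_smooth|apply/Cf/cX/(lt_le_trans cc)].
apply: Ck_near_ext (Ck_near_cst k 0 t).
have [t0 _ z0E] := cis_surj z0; rewrite z0E Re_rel_pos_cis in tc.
have cn : {for t, continuous (fun s : R => cos (s - t0))}.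
  by have [/nbhs_singleton] := Ck_near_cos_sin 0 t0 t.
have : \forall s \near t, cos (s - t0) < c' by exact: (cvgr_lt _ cn).
by apply: filterS => s sc; rewrite bump_eq0 ?mul0r// z0E Re_rel_pos_cis ltW.
Qed.

Lemma Cinfty_Ck (X : set (circle R)) g k t : closed X -> Cinfty_on (~` X) g -> ~ X (cis t) ->
  Ck_near k (fun s => complex.Re (g (cis s))) t /\ Ck_near k (fun s => complex.Im (g (cis s))) t.
Proof.
move=> cX gX Xt.
have oU : open (@cis R @^-1` (~` X)).
  by move/continuousP : (@cis_continuous R); apply; exact: closed_openC.
have nU : \forall s \near t, ~ X (cis s) by apply: open_nbhs_nbhs.
split; apply: filterS nU => s Xs; apply: Ck_derive1n => n; first exact: (gX s Xs n).1.
exact: (gX s Xs n).2.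
Qed.

Definition smooth q f := forall t, Ck_near q.+2 (fun s => f (cis s)) t.

Lemma smooth_Ck q f : smooth q f -> forall t, Ck q.+2 (fun s => f (cis s)) t.
Proof. by move=> sf t; exact: nbhs_singleton (sf t). Qed.

Lemma smooth_symbol q f : smooth q f -> bounded_symbol (real_symbol f) /\ trig_approx q (real_symbol f).
Proof.
move=> /smooth_Ck sf; split; last exact: smooth_trig_approx.
have cf t : {for t, continuous (fun s => f (cis s))} by exact: Ck_continuous (sf t).
have [c fc] := circle_continuous_bounded cf.
exact: bounded_real_symbol (continuous_circle_measurable (circle_continuous cf)) fc.
Qed.

Lemma smooth_complex_trig_approx q w : smooth q (fun z => complex.Re (w z)) -> smooth q (fun z => complex.Im (w z)) ->
  trig_approx q w.
Proof.
move=> /smooth_symbol[_ rr] /smooth_symbol[bi ri].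
rewrite (_ : w = fun z => (complex.Re (w z))%:C + 'i%C * (complex.Im (w z))%:C).
  by apply: (trig_approx_D rr); apply: trig_approx_M bi (trig_approx_cst _ _) ri; exact: bounded_symbol_cst.
by apply/funext => z; rewrite [LHS]complexE.
Qed.

(** b vanishes on X, so b w agrees almost everywhere with b g, which is smooth on the whole
    circle. *)
Lemma local_bump q w (X : set (circle R)) z0 : closed X -> ~ X z0 -> ae_Cinfty_off X w ->
  exists b, [/\ forall z, 0 <= b z, 0 < b z0, smooth q b & trig_approx q (fun z => (b z)%:C * w z)].
Proof.
move=> cX Xz0 [g gX wg]; have [c c1 cP] := closed_complement_arc cX Xz0.
have [c' /andP[cc c'1]] : exists c', c < c' < 1 by exists ((c + 1) / 2); apply/andP; split; lra.
pose b := bump z0 c' q.+2.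
exists b; split; first exact: bump_ge0.
- by rewrite exprn_gt0// lt_max rel_pos_self /= subr_gt0 c'1.
- by move=> t; exact: bump_smooth.
have bX z : X z -> b z = 0.
  move=> Xz; apply: bump_eq0; rewrite leNgt; apply/negP => h.
  by apply: (cP z) => //; exact: lt_trans h.
apply: (@trig_approx_ae _ _ (fun z => (b z)%:C * g z)).
  apply: filterS wg => z wg; have [Xz|Xz] := pselect (X z); last by rewrite wg.
  by rewrite bX// !mul0r.
have [CR CI] : (forall t, ~ X (cis t) -> Ck_near q.+2 (fun s => complex.Re (g (cis s))) t) /\
    (forall t, ~ X (cis t) -> Ck_near q.+2 (fun s => complex.Im (g (cis s))) t).
  by split => t Xt; have [] := Cinfty_Ck q.+2 cX gX Xt.
apply: smooth_complex_trig_approx => t.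
- under [X in Ck_near _ X]funext do rewrite Defs.ReM /= mul0r subr0.
  exact: (@bump_mul_smooth X z0 c c' q.+2 (fun z => complex.Re (g z))).
- under [X in Ck_near _ X]funext do rewrite Defs.ImM /= mul0r addr0.
  exact: (@bump_mul_smooth X z0 c c' q.+2 (fun z => complex.Im (g z))).
Qed.

Lemma trig_approx_sum q I (r : seq I) (w : I -> circle R -> R[i]) : (forall i, trig_approx q (w i)) ->
  trig_approx q (fun z => \sum_(i <- r) w i z).
Proof.
move=> rw; elim: r => [|i r IH].
  by under [X in trig_approx _ X]funext do rewrite big_nil; exact: trig_approx_cst.
by under [X in trig_approx _ X]funext do rewrite big_cons; exact: trig_approx_D.
Qed.

(** A partition of unity: [B true] collects the bumps that make w1 smooth, [B false] those that make
    w2 smooth, and B true / (B true + B false) is the cutoff. *)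
Lemma separated_locally q w1 w2 : bounded_symbol w1 -> bounded_symbol w2 ->
  (forall z, exists X : set (circle R), [/\ closed X, ~ X z & ae_Cinfty_off X w1 \/ ae_Cinfty_off X w2]) ->
  separated q w1 w2.
Proof.
move=> bw1 bw2 H.
have loc (t : R) : exists b : bool * (circle R -> R), [/\ forall z, 0 <= b.2 z, 0 < b.2 (cis t), smooth q b.2 &
    trig_approx q (fun z => (b.2 z)%:C * (if b.1 then w1 z else w2 z))].
  have [X [cX Xt [h|h]]] := H (cis t); have [b [b0 b1 sb rb]] := local_bump q cX Xt h.
    by exists (true, b).
  by exists (false, b).
have [b bP] := choice loc.
(* The cover is pulled back to [0, 2 pi], which [cis] maps onto the circle. *)
have cU : compact `[0 : R, 2 * pi] by exact: segment_compact.
rewrite compact_cover in cU.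
have [||D _ DP] := cU R setT (fun t => [set s | 0 < (b t).2 (cis s)]).
- move=> t _; have [_ _ /smooth_Ck sb _] := bP t.
  rewrite openE => s /= sb0; have cn := Ck_continuous (sb s).
  exact: (cvgr_gt _ cn).
- by move=> s _; exists s => //=; have [] := bP s.
pose B (e : bool) z := \sum_(t <- D) (if (b t).1 == e then (b t).2 z else 0).
have nn e t z : 0 <= (if (b t).1 == e then (b t).2 z else 0) by case: ifP => // _; have [] := bP t.
have B0 e z : 0 <= B e z by apply: sumr_ge0 => t _; exact: nn.
have sB e : smooth q (B e).
  move=> t; apply: (@Ck_near_sum _ _ _ _ (fun i s => if (b i).1 == e then (b i).2 (cis s) else 0)) => i.
  have [ie|ie] := eqVneq (b i).1 e; last exact: Ck_near_cst.
  by have [_ _ sb _] := bP i; exact: sb.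
have rB e : trig_approx q (fun z => (B e z)%:C * (if e then w1 z else w2 z)).
  under [X in trig_approx _ X]funext do rewrite /B rmorph_sum /= mulr_suml.
  apply: (@trig_approx_sum q _ _ (fun i z => (if (b i).1 == e then (b i).2 z else 0)%:C * (if e then w1 z else w2 z))) => i.
  have [ie|ie] := eqVneq (b i).1 e; first by have [_ _ _] := bP i; rewrite ie.
  by under [X in trig_approx _ X]funext do rewrite mul0r; exact: trig_approx_cst.
have S0 z : 0 < B true z + B false z.
  have [s sp zE] := cis_surj z.
  have [t /= tD st] : (\bigcup_(i in [set` D]) [set s | 0 < (b i).2 (cis s)]) s by apply: DP; rewrite /= in_itv.
  have pos e : (b t).1 = e -> 0 < B e z.
    move=> te; rewrite /B (big_rem t)//= te eqxx ltr_pwDl// ?zE//.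
    by apply: sumr_ge0 => i _; rewrite -zE; exact: nn.
  case E : (b t).1; first by rewrite ltr_pwDl ?B0// pos.
  by rewrite ltr_wpDl ?B0// pos.
pose V z := (B true z + B false z)^-1.
have sV : smooth q V.
  move=> t; apply: (@Ck_nearV _ _ (fun s => B true (cis s) + B false (cis s))).
    by apply: (@filterE _ (nbhs t)) => s; rewrite gt_eqF.
  by apply: Ck_nearD; exact: sB.
have [bV rV] := smooth_symbol sV.
have [bT rT] := smooth_symbol (sB true).
have [bF rF] := smooth_symbol (sB false).
exists (fun z => real_symbol V z * real_symbol (B true) z); split.
- exact: bounded_symbolM.
- by move=> z; rewrite /real_symbol rmorphM /= !oppr0.
- exact: trig_approx_M.
- under [X in trig_approx _ X]funext do rewrite -mulrA.
  apply: trig_approx_M => //; [exact: bounded_symbolM|exact: (rB true)].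
- rewrite (_ : (fun z => _) = fun z => real_symbol V z * (real_symbol (B false) z * w2 z)).
    by apply: trig_approx_M => //; [exact: bounded_symbolM|exact: (rB false)].
  apply/funext => z; rewrite mulrA; congr (_ * _).
  rewrite /real_symbol -!rmorphM -(rmorph1 (@real_complex R)) -rmorphB; congr (_%:C).
  have S1 := S0 z; rewrite /V; field; exact: lt0r_neq0.
Qed.

(** [sing_supp] is an intersection, so a point outside it is outside some closed X of the family; by
    disjointness this holds at each point for w1 or for w2. *)
Lemma disjoint_sing_supp_separated q w1 w2 : bounded_symbol w1 -> bounded_symbol w2 ->
  sing_supp w1 `&` sing_supp w2 = set0 -> separated q w1 w2.
Proof.
move=> bw1 bw2 disj; apply: separated_locally => // z.
have out w : ~ sing_supp w z -> exists X : set (circle R), [/\ closed X, ~ X z & ae_Cinfty_off X w].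
  move=> nz; apply: contrapT => no; apply: nz => X [[cX wX] _].
  by apply: contrapT => Xz; apply: no; exists X.
have [z1|/out[X [cX Xz wX]]] := pselect (sing_supp w1 z); last by exists X; split => //; left.
have [z2|/out[X [cX Xz wX]]] := pselect (sing_supp w2 z); last by exists X; split => //; right.
by have : (sing_supp w1 `&` sing_supp w2) z by []; rewrite disj.
Qed.

End Cutoff.

(** u is squeezed between its tail infima and suprema, whose limits are the lower and upper
    limits. *)
Lemma cvg_limn_einf_esup (R : realType) (u : nat -> \bar R) (l : \bar R) :
  (l <= limn_einf u)%E -> (limn_esup u <= l)%E -> u @ \oo --> l.
Proof.
move=> l1 l2; have l3 := limn_einf_sup u.
have e1 : limn_einf u = l by apply/eqP; rewrite eq_le l1 (le_trans l3 l2).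
have e2 : limn_esup u = l by apply/eqP; rewrite eq_le l2 (le_trans l1 l3).
apply: (@squeeze_cvge _ _ _ _ (einfs u) _ (esups u)).
- apply: nearW => n; apply/andP; split.
    by apply: ereal_inf_lbound; exists n => //=.
  by apply: ereal_sup_ubound; exists n => //=.
- by rewrite -e1 limn_einf_lim; exact: is_cvg_einfs.
- by rewrite -e2 limn_esup_lim; exact: is_cvg_esups.
Qed.

Theorem theorem1p1 (R : realType) (L : nat) (L_gt0 : (0 < L)%N)
    (omega : 'I_L -> circle R -> R[i])
    (omega_bounded : forall l, Linfty (omega l))
    (hankel_compact : forall l, compact_operator (hankel (omega l)))
    (disjoint_supp : forall l j, l != j ->
      sing_supp (omega l) `&` sing_supp (omega j) = set0)
    (p : R) (p_gt0 : 0 < p) :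
  let omega_sum : circle R -> R[i] := fun z => \sum_(l < L) omega l z in
  let u (w : circle R -> R[i]) : nat -> \bar R :=
    fun n => (n%:R * hankel_sv w n `^ p)%:E in
  [/\ (limn_esup (u omega_sum) <= \sum_(l < L) limn_esup (u (omega l)))%E,
      (limn_einf (u omega_sum) >= \sum_(l < L) limn_einf (u (omega l)))%E &
      forall a : 'I_L -> \bar R,
        (forall l, u (omega l) @ \oo --> a l) ->
        u omega_sum @ \oo --> (\sum_(l < L) a l)%E].
Proof.
move=> omega_sum u; case: L L_gt0 omega omega_bounded hankel_compact disjoint_supp @omega_sum => [//|n] _ omega ob hc ds omega_sum.
have bo l : bounded_symbol (omega l) by have [c c0 h] := Linfty_bounded (ob l); exists c.
(* Starting from 5 / p makes the inequality 4 < q p strict. *)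
have [q qp] := nat_ubound (5 / p).
have {}qp : 4 < q%:R * p.
  by rewrite -ltr_pdivrMr// (lt_le_trans _ qp)// ltr_pM2r ?invr_gt0// ltr_nat.
have hA l : compact_adj (@H2_dot R) (hankel (omega l)) (hankel (symbol_adj (omega l))).
  split; [exact/hankel_linear/bo|by move=> h h'; exact/hankel_adj/bo|exact: hc].
have sA l j : l != j ->
   small q (fun h => hankel (symbol_adj (omega l)) (hankel (omega j) h)) /\
   small q (fun h => hankel (omega l) (hankel (symbol_adj (omega j)) h)).
  move=> lj; apply: small_separated => //; apply: disjoint_sing_supp_separated => //.
  by apply: ds; rewrite eq_sym.
have [_ hsup hinf] := singular_value_sum (@H2_normE R) (@H2_complete R) p_gt0 qp hA sA.
have SE : hankel omega_sum = fun h => \sum_l hankel (omega l) h.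
  by apply/funext => h; exact: hankel_sum.
have uE : u omega_sum = scaled_seq p (singular_value (@H2_dot R) (fun h => \sum_l hankel (omega l) h)).
  by rewrite -SE.
split; [by rewrite uE|by rewrite uE|move=> a ua].
have ue l : limn_esup (u (omega l)) = a l.
  by rewrite (is_cvg_limn_esupE (cvgP _ (ua l))); exact: cvg_lim.
have ui l : limn_einf (u (omega l)) = a l.
  by rewrite (is_cvg_limn_einfE (cvgP _ (ua l))); exact: cvg_lim.
have ei := eq_bigr _ (fun l _ => ui l); have es := eq_bigr _ (fun l _ => ue l).
by apply: cvg_limn_einf_esup; rewrite uE; [rewrite -ei|rewrite -es].
Qed.
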